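(* Let $A$ be a finite subset of $(0,1]\cup\{2,\infty\}$. Then the quasi-Banach space $\bigoplus_{p\in A}\ell_p$ (where $\ell_\infty$ means $c_0$) has a unique unconditional basis up to a permutation; that is, every normalized unconditional basis of $\bigoplus_{p\in A}\ell_p$ is permutatively equivalent to the canonical unit vector basis of $\bigoplus_{p\in A}\ell_p$.
   Context: Scalars are real or complex. A quasi-Banach space is a complete quasi-normed space (triangle inequality up to a constant $\kappa\ge1$). For $0<p<\infty$, $\ell_p$ is the usual sequence space with $\Vert(a_n)\Vert=(\sum_n|a_n|^p)^{1/p}$; the symbol $\ell_\infty$ denotes $c_0$ with the supremum norm. A finite direct sum $\bigoplus_{i\in F}\mathbb{X}_i$ is the Cartesian product with quasi-norm $\Vert(x_i)_i\Vert=\sup_{i\in F}\Vert x_i\Vert$. The canonical basis of $\bigoplus_{p\in A}\ell_p$ consists of the vectors having one coordinate (in the $p$-th summand) equal to a unit vector of $\ell_p$ and the other coordinates equal to zero. A countable family $(\mathbf{x}_j)_{j\in J}$ is an unconditional basis of $\mathbb{X}$ if every $f\in\mathbb{X}$ has a unique expansion $f=\sum_{j\in J}a_j\,\mathbf{x}_j$ with unconditional convergence; it is normalized if $\Vert\mathbf{x}_j\Vert=1$ for all $j$. Two families $(\mathbf{x}_j)_{j\in J}$ in $\mathbb{X}$ and $(\mathbf{y}_i)_{i\in I}$ in $\mathbb{Y}$ are permutatively equivalent if there are a bijection $\pi\colon J\to I$ and a linear isomorphism $T$ (bounded with bounded inverse) from the closed linear span of $(\mathbf{x}_j)_{j\in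 J}$ onto the closed linear span of $(\mathbf{y}_i)_{i\in I}$ with $T(\mathbf{x}_j)=\mathbf{y}_{\pi(j)}$ for all $j\in J$. A quasi-Banach space $\mathbb{X}$ with an unconditional basis $\mathcal{B}$ is said to have a unique unconditional basis up to a permutation if every normalized unconditional basis of $\mathbb{X}$ is permutatively equivalent to $\mathcal{B}$. *)

(* Defs.v *)
From HB Require Import structures.
From mathcomp Require Import all_boot all_order all_algebra finmap complex interval_inference.
From mathcomp Require Import all_classical all_reals.
From mathcomp Require Import topology normedtype sequences exp summability.
From mathcomp Require Import lra.

Set Implicit Arguments.
Unset Strict Implicit.
Unset Printing Implicit Defensive.

Import Order.TTheory GRing.Theory Num.Theory.
Import numFieldNormedType.Exports.
Import ComplexField.Normc.

Local Open Scope classical_set_scope.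
Local Open Scope ring_scope.

Variant scalar_kind := RealScalars | ComplexScalars.

Definition scalars (R : realType) (k : scalar_kind) : numFieldType :=
  match k with RealScalars => R | ComplexScalars => R[i] end.

(* The norm of R[i] as a numFieldType takes its values in R[i]; quasi-norms
   need a modulus with values in R. *)
Definition modulus (R : realType) (k : scalar_kind) : scalars R k -> R :=
  match k with RealScalars => fun x => `|x| | ComplexScalars => @normc R end.

Section modulus_theory.
Context {R : realType} {k : scalar_kind}.
Implicit Types a b : scalars R k.

Lemma modulus0 : modulus (0 : scalars R k) = 0.
Proof. by case: k => /=; [exact: normr0|exact: normc0]. Qed.

Lemma modulus1 : modulus (1 : scalars R k) = 1.
Proof. by case: k => /=; [exact: normr1|exact: normc1]. Qed.

Lemma modulus_ge0 a : 0 <= modulus a.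
Proof. by case: k a => a //=; case: a => x y /=; exact: sqrtr_ge0. Qed.

Lemma modulus_eq0 a : modulus a = 0 -> a = 0.
Proof. by case: k a => a /=; [move/normr0_eq0|move/eq0_normc]. Qed.

Lemma modulusM a b : modulus (a * b) = modulus a * modulus b.
Proof. by case: k a b => a b /=; [exact: normrM|exact: normcM]. Qed.

Lemma modulusD a b : modulus (a + b) <= modulus a + modulus b.
Proof. by case: k a b => a b /=; [exact: ler_normD|exact: le_normcD]. Qed.

Lemma modulusN a : modulus (- a) = modulus a.
Proof. by case: k a => a /=; [exact: normrN|exact: normcN]. Qed.

End modulus_theory.

Lemma real_cauchy_cvg (R : realType) (u : nat -> R) :
  (forall e : R, 0 < e ->
    exists N, forall m n, (N <= m)%N -> (N <= n)%N -> `|u m - u n| < e) ->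
  exists l, forall e : R, 0 < e ->
    exists N, forall n, (N <= n)%N -> `|u n - l| < e.
Proof.
move=> uC.
have /cauchy_cvgP/cvg_ex[l ul] : cauchy (u @ \oo).
  apply: cauchy_exP => e /uC[N HN]; exists (u N); exists N => // n /= Nn.
  exact: HN.
exists l => e e0.
have /cvgrPdist_lt/(_ _ e0)[N _ HN] := ul.
by exists N => n /HN /=; rewrite distrC.
Qed.

Lemma scalars_complete (R : realType) (k : scalar_kind)
    (u : nat -> scalars R k) :
  (forall e : R, 0 < e ->
    exists N, forall m n, (N <= m)%N -> (N <= n)%N -> modulus (u m - u n) < e) ->
  exists l, forall e : R, 0 < e ->
    exists N, forall n, (N <= n)%N -> modulus (u n - l) < e.
Proof.
case: k u => u /= uC; first exact: real_cauchy_cvg.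
have normcRe (z : R[i]) : `|complex.Re z| <= normc z.
  by case: z => x y /=; rewrite -sqrtr_sqr ler_wsqrtr// lerDl sqr_ge0.
have normcIm (z : R[i]) : `|complex.Im z| <= normc z.
  by case: z => x y /=; rewrite -sqrtr_sqr ler_wsqrtr// lerDr sqr_ge0.
have normcReIm (z : R[i]) : normc z <= `|complex.Re z| + `|complex.Im z|.
  case: z => x y /=.
  rewrite -[leRHS]ger0_norm ?addr_ge0// -sqrtr_sqr ler_wsqrtr//.
  rewrite sqrrD !real_normK ?num_real//.
  by rewrite lerD2r lerDl mulrn_wge0// mulr_ge0.
have [|x ux] := @real_cauchy_cvg R (fun n => complex.Re (u n)).
  move=> e /uC[N HN]; exists N => m n Nm Nn; apply: le_lt_trans (HN _ _ Nm Nn).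
  by rewrite -raddfB; exact: normcRe.
have [|y uy] := @real_cauchy_cvg R (fun n => complex.Im (u n)).
  move=> e /uC[N HN]; exists N => m n Nm Nn; apply: le_lt_trans (HN _ _ Nm Nn).
  by rewrite -raddfB; exact: normcIm.
exists (x +i* y)%C => e e0.
have e20 : 0 < e / 2 by rewrite divr_gt0.
have [N1 H1] := ux _ e20; have [N2 H2] := uy _ e20.
exists (maxn N1 N2) => n; rewrite geq_max => /andP[/H1 h1 /H2 h2].
apply: le_lt_trans (normcReIm _) _; rewrite !raddfB/=.
lra.
Qed.

HB.mixin Record Lmodule_isQuasiBanach (R : realType) (k : scalar_kind) X
    of GRing.Lmodule (scalars R k) X := {
  qnorm : X -> R ;
  qnorm_ge0 : forall x, 0 <= qnorm x ;
  qnorm_eq0 : forall x, qnorm x = 0 -> x = 0 ;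
  qnormZ : forall (a : scalars R k) x, qnorm (a *: x) = modulus a * qnorm x ;
  qnormD : exists2 kappa : R, 1 <= kappa &
    forall x y, qnorm (x + y) <= kappa * (qnorm x + qnorm y) ;
  qnorm_complete : forall u : nat -> X,
    (forall e : R, 0 < e -> exists N, forall m n,
      (N <= m)%N -> (N <= n)%N -> qnorm (u m - u n) < e) ->
    exists l, qnorm (u n - l) @[n --> \oo] --> (0 : R)
}.

#[short(type="quasiBanachType")]
HB.structure Definition QuasiBanach (R : realType) (k : scalar_kind) :=
  {X of GRing.Lmodule (scalars R k) X & Lmodule_isQuasiBanach R k X}.

Section bases.
Context {R : realType} {k : scalar_kind}.
Local Notation K := (scalars R k).

(* Convergence of the net of finite partial sums. *)
Definition unconditional_sum (X : quasiBanachType R k) (J : countType)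
    (v : J -> X) (f : X) : Prop :=
  qnorm (partial_sum v F - f) @[F --> totally] --> (0 : R).

Definition unconditional_basis (X : quasiBanachType R k) (J : countType)
    (x : J -> X) : Prop :=
  forall f : X, exists! a : J -> K, unconditional_sum (fun j => a j *: x j) f.

Definition normalized (X : quasiBanachType R k) (J : countType)
    (x : J -> X) : Prop :=
  forall j, qnorm (x j) = 1.

Definition linear_span (X : quasiBanachType R k) (J : countType)
    (x : J -> X) : set X :=
  [set f | exists (F : {fset J}) (a : J -> K),
    f = partial_sum (fun j => a j *: x j) F].

Definition closed_span (X : quasiBanachType R k) (J : countType)
    (x : J -> X) : set X :=
  [set f | forall e : R, 0 < e ->
    exists2 g, linear_span x g & qnorm (f - g) < e].

(* T is only meaningful on the subspace V, which it maps onto W. *)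
Definition linear_isomorphism (X Y : quasiBanachType R k)
    (V : set X) (W : set Y) (T : X -> Y) : Prop :=
  [/\ forall (a : K) f g, V f -> V g -> T (a *: f + g) = a *: T f + T g,
      set_bij V W T,
      exists C : R, forall f, V f -> qnorm (T f) <= C * qnorm f
    & exists C : R, forall f, V f -> qnorm f <= C * qnorm (T f)].

Definition permutatively_equivalent (X Y : quasiBanachType R k)
    (J I : countType) (x : J -> X) (y : I -> Y) : Prop :=
  exists (pi : J -> I) (T : X -> Y),
    [/\ bijective pi,
        linear_isomorphism (closed_span x) (closed_span y) T
      & forall j, T (x j) = y (pi j)].

Definition has_unique_unconditional_basis (X : quasiBanachType R k)
    (I : countType) (b : I -> X) : Prop :=
  unconditional_basis b /\
  forall (J : countType) (x : J -> X),
    unconditional_basis x -> normalized x -> permutatively_equivalent x b.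

End bases.

Section sequence_spaces.
Context {R : realType} (k : scalar_kind).
Local Notation K := (scalars R k).
(* {posnum \bar R} is ]0, +oo], with +oo included; the regular module K^o makes
   [nat -> K^o] a K-module. *)
Implicit Types (p : {posnum \bar R}) (a b : nat -> K^o) (c d e : R).

(* The exponent +oo stands for c_0, not for the bounded sequences. *)
Definition in_ell (p : \bar R) (a : nat -> K^o) : Prop :=
  match p with
  | r%:E => cvgn (series (fun n => modulus (a n) `^ r))
  | +oo%E => modulus (a n) @[n --> \oo] --> (0 : R)
  | -oo%E => False
  end.

Definition ell_norm (p : \bar R) (a : nat -> K^o) : R :=
  match p with
  | r%:E => (limn (series (fun n => modulus (a n) `^ r))) `^ r^-1
  | +oo%E => sup (range (fun n => modulus (a n)))
  | -oo%E => 0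
  end.

(* [forall n, ell_bound p c a n] says that a has norm at most c; it
   does not say that a tends to 0 when p = +oo. *)
Definition ell_bound (p : \bar R) c a n : Prop :=
  match p with
  | r%:E => series (fun n => modulus (a n) `^ r) n <= c `^ r
  | +oo%E => modulus (a n) <= c
  | -oo%E => False
  end.

Lemma exponentP p : exists2 q, p%:num = q & (q = +oo%E \/ exists2 r, 0 < r & q = r%:E).
Proof.
exists p%:num => //.
have : (0 < p%:num)%E by exact: gt0e.
case: (p%:num) => [r| |].
- by rewrite lte_fin => r0; right; exists r.
- by left.
- by rewrite ltNge leNye.
Qed.

Lemma nondecreasing_powR_series r a : nondecreasing_seq (series (fun n => modulus (a n) `^ r)).
Proof.
by apply/nondecreasing_seqP => n; rewrite seriesSr lerDl powR_ge0.
Qed.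

Lemma lim_powR_series_ge0 (r : R) a :
  cvgn (series (fun n => modulus (a n) `^ r)) ->
  0 <= limn (series (fun n => modulus (a n) `^ r)).
Proof.
move=> ac; apply: limr_ge => //; apply: nearW => n.
by apply: sumr_ge0 => i _; exact: powR_ge0.
Qed.

Lemma powR_series_le_lim (r : R) a :
  cvgn (series (fun n => modulus (a n) `^ r)) -> forall n,
  series (fun n => modulus (a n) `^ r) n <=
    limn (series (fun n => modulus (a n) `^ r)).
Proof.
by move=> ac; apply: nondecreasing_cvgn_le => //; exact: nondecreasing_powR_series.
Qed.

Lemma powR_mulVK (r : R) c : 0 < r -> 0 <= c -> (c `^ r) `^ r^-1 = c.
Proof. by move=> r0 c0; rewrite -powRrM mulfV ?gt_eqF// powRr1. Qed.

Lemma powR_mulKV (r : R) c : 0 < r -> 0 <= c -> (c `^ r^-1) `^ r = c.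
Proof. by move=> r0 c0; rewrite -powRrM mulVf ?gt_eqF// powRr1. Qed.

Lemma le_powR (r : R) c d : 0 <= r -> 0 <= c -> c <= d -> c `^ r <= d `^ r.
Proof.
move=> r0 c0 cd.
by apply: ge0_ler_powR => //; rewrite nnegrE// (le_trans c0).
Qed.

Lemma ell_norm_ge0 p a : 0 <= ell_norm p%:num a.
Proof.
have [q -> [->|[r r0 ->]]] := exponentP p; last exact: powR_ge0.
have [aub|naub] := pselect (has_ubound (range (fun n => modulus (a n)))).
  by apply: le_trans (modulus_ge0 (a 0%N)) _; apply: ub_le_sup => //; exists 0%N.
by rewrite /= sup_out// => -[].
Qed.

Lemma ell_bounded p a : in_ell p%:num a -> exists c, forall n, ell_bound p%:num c a n.
Proof.
have [q -> [->|[r r0 ->]]] := exponentP p => /= ain.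
  have /cvg_has_ub[M HM] : cvgn (fun n => modulus (a n)) by apply/cvg_ex; exists 0.
  by exists M => n; rewrite (le_trans (ler_norm _))// HM//; exists n.
exists ((limn (series (fun n => modulus (a n) `^ r))) `^ r^-1) => n.
rewrite powR_mulKV//; first exact: powR_series_le_lim.
exact: lim_powR_series_ge0.
Qed.

Lemma ell_bound_norm p a : in_ell p%:num a ->
  forall n, ell_bound p%:num (ell_norm p%:num a) a n.
Proof.
move=> /[dup] /ell_bounded.
have [q -> [->|[r r0 ->]]] := exponentP p => /= -[c ac] ain n.
  by apply: ub_le_sup; [exists c => _ [m _ <-]; exact: ac|exists n].
rewrite powR_mulKV//; first exact: powR_series_le_lim.
exact: lim_powR_series_ge0.
Qed.

Lemma ell_norm_le p a c : in_ell p%:num a -> 0 <= c ->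
  (forall n, ell_bound p%:num c a n) -> ell_norm p%:num a <= c.
Proof.
have [q -> [->|[r r0 ->]]] := exponentP p => /= ain c0 ac.
  apply: ge_sup; first by exists (modulus (a 0%N)), 0%N.
  by move=> _ [n _ <-].
have rV0 : 0 <= r^-1 by rewrite invr_ge0 ltW.
apply: (@le_trans _ _ ((c `^ r) `^ r^-1)); last by rewrite powR_mulVK.
apply: le_powR => //; first exact: lim_powR_series_ge0.
by apply: limr_le => //; exact: nearW.
Qed.

Lemma ell_bound_modulus p a c : 0 <= c ->
  (forall n, ell_bound p%:num c a n) -> forall n, modulus (a n) <= c.
Proof.
have [q -> [->|[r r0 ->]]] := exponentP p => //= c0 ac n.
have rV0 : 0 <= r^-1 by rewrite invr_ge0 ltW.
apply: (@le_trans _ _ ((c `^ r) `^ r^-1)); last by rewrite powR_mulVK.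
apply: (@le_trans _ _ ((modulus (a n) `^ r) `^ r^-1)).
  by rewrite powR_mulVK ?modulus_ge0.
apply: le_powR => //; first exact: powR_ge0.
apply: le_trans (ac n.+1).
by rewrite seriesSr lerDr sumr_ge0// => i _; exact: powR_ge0.
Qed.

Definition ell_kappa (p : \bar R) : R :=
  match p with r%:E => 2 * 2 `^ r^-1 | _ => 1 end.

Lemma ell_kappa_ge1 p : 1 <= ell_kappa p%:num.
Proof.
have [q -> [->|[r r0 ->]]] := exponentP p => //=.
have : 1 <= 2 `^ r^-1 :> R.
  by rewrite -[leLHS](powRr0 2) ler_powR ?invr_ge0 ?(ltW r0)// ler1n.
lra.
Qed.

Lemma ell_boundD p a b c d n : 0 <= c -> 0 <= d ->
  ell_bound p%:num c a n -> ell_bound p%:num d b n ->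
  ell_bound p%:num (ell_kappa p%:num * (c + d)) (a + b) n.
Proof.
have [q -> [->|[r r0 ->]]] := exponentP p => /= c0 d0 ac bd.
  by rewrite mul1r (le_trans (modulusD _ _))// lerD.
have r0' := ltW r0.
have cd0 : 0 <= c + d by rewrite addr_ge0.
rewrite !powRM ?mulr_ge0 ?powR_ge0// powR_mulKV//.
have hs : forall i, modulus ((a + b) i) `^ r <=
    2 `^ r * (modulus (a i) `^ r + modulus (b i) `^ r).
  move=> i; have ma := modulus_ge0 (a i); have mb := modulus_ge0 (b i).
  have h := modulusD (a i) (b i).
  have [ab|/ltW ba] := leP (modulus (a i)) (modulus (b i)).
    apply: (@le_trans _ _ ((2 * modulus (b i)) `^ r)).
      by apply: le_powR => //; [exact: modulus_ge0|rewrite (le_trans h)//; lra].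
    by rewrite powRM// ler_wpM2l ?powR_ge0// lerDr powR_ge0.
  apply: (@le_trans _ _ ((2 * modulus (a i)) `^ r)).
    by apply: le_powR => //; [exact: modulus_ge0|rewrite (le_trans h)//; lra].
  by rewrite powRM// ler_wpM2l ?powR_ge0// lerDl powR_ge0.
rewrite /series/= in ac bd *.
apply: (le_trans (ler_sum _ (fun i _ => hs i))).
rewrite -mulr_sumr big_split/= -mulrA ler_wpM2l ?powR_ge0//.
have hc : c `^ r <= (c + d) `^ r by apply: le_powR => //; lra.
have hd : d `^ r <= (c + d) `^ r by apply: le_powR => //; lra.
lra.
Qed.

Lemma ell_boundZ p (s : K) a c n : 0 <= c ->
  ell_bound p%:num c a n -> ell_bound p%:num (modulus s * c) (s *: a) n.
Proof.
have [q -> [->|[r r0 ->]]] := exponentP p => /= c0 ac.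
  by rewrite modulusM ler_wpM2l ?modulus_ge0.
rewrite powRM ?modulus_ge0//; apply: le_trans (ler_wpM2l (powR_ge0 _ _) ac).
rewrite /series/= mulr_sumr; apply: ler_sum => i _.
by rewrite modulusM powRM ?modulus_ge0.
Qed.

Lemma ell_bound_small p n e : 0 < e -> exists2 d, 0 < d &
  forall a, (forall i, (i <= n)%N -> modulus (a i) <= d) -> ell_bound p%:num e a n.
Proof.
have [q -> [->|[r r0 ->]]] := exponentP p => /= e0; first by exists e => // a; apply.
have er0 : 0 < e `^ r / n.+1%:R by rewrite divr_gt0 ?powR_gt0.
exists ((e `^ r / n.+1%:R) `^ r^-1); first by rewrite powR_gt0.
move=> a ad.
apply: (@le_trans _ _ (\sum_(0 <= i < n) (e `^ r / n.+1%:R))).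
  rewrite /series/= big_nat [leRHS]big_nat; apply: ler_sum => i /andP[_ /ltnW/ad ai].
  by rewrite -[leRHS](powR_mulKV r0) ?(ltW er0)// le_powR ?modulus_ge0 ?(ltW r0).
rewrite sumr_const_nat subn0 -[_ *+ _]mulr_natr -mulrA ler_piMr ?powR_ge0//.
by rewrite mulrC ler_pdivrMr// mul1r ler_nat.
Qed.

Lemma in_ell_cauchy p a : (forall e, 0 < e ->
    exists2 b, in_ell p%:num b & forall n, ell_bound p%:num e (a - b) n) ->
  in_ell p%:num a.
Proof.
have [q qE [q0|[r r0 q0]]] := exponentP p; rewrite qE q0 => h.
  apply/cvgrPdist_lt => e e0.
  have e20 : 0 < e / 2 by rewrite divr_gt0.
  have [b /cvgrPdist_lt/(_ _ e20)[N _ HN] hb] := h _ e20.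
  exists N => // n /HN /=; rewrite !sub0r !normrN !ger0_norm ?modulus_ge0// => bn.
  have := hb n => /= abn; have := modulusD (a n - b n) (b n); rewrite subrK.
  by move=> /le_lt_trans; apply; rewrite (_ : (a - b) n = a n - b n) in abn => //; lra.
have [b bin hb] := h _ ltr01.
have := bin; rewrite -q0 -qE => bin'.
have hn n : ell_bound p%:num (ell_kappa p%:num * (1 + ell_norm p%:num b)) ((a - b) + b) n.
  apply: ell_boundD => //; [exact: ell_norm_ge0|by rewrite qE q0|].
  exact: ell_bound_norm.
rewrite subrK qE q0 /= in hn *.
apply: nondecreasing_is_cvgn; first exact: nondecreasing_powR_series.
by eexists => _ [n _ <-]; exact: hn.
Qed.

Lemma in_ellD p a b : in_ell p%:num a -> in_ell p%:num b -> in_ell p%:num (a + b).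
Proof.
move=> /[dup] ain /ell_bound_norm/= ac /[dup] bin /ell_bound_norm/= bc.
have := fun n => ell_boundD (ell_norm_ge0 _ _) (ell_norm_ge0 _ _) (ac n) (bc n).
have [q qE [q0|[r r0 q0]]] := exponentP p; rewrite qE q0 in ain bin * => /= abc.
  have := cvgD ain bin; rewrite addr0 => abD.
  apply: (@squeeze_cvgr _ _ _ _ (cst 0) (fun n => modulus (a n) + modulus (b n))).
  - by apply: nearW => n; rewrite modulus_ge0; exact: modulusD.
  - exact: cvg_cst.
  - exact: abD.
apply: nondecreasing_is_cvgn; first exact: nondecreasing_powR_series.
by eexists => _ [n _ <-]; exact: abc.
Qed.

Lemma in_ellZ p (s : K) a : in_ell p%:num a -> in_ell p%:num (s *: a).
Proof.
move=> /[dup] ain /ell_bound_norm/= ac.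
have := fun n => ell_boundZ s (ell_norm_ge0 _ _) (ac n).
have [q qE [q0|[r r0 q0]]] := exponentP p; rewrite qE q0 in ain * => /= sac.
  rewrite (_ : (fun n => modulus ((s *: a) n)) = (fun n => modulus s * modulus (a n))).
    by rewrite -[X in _ --> X](mulr0 (modulus s)); apply: cvgM => //; exact: cvg_cst.
  by apply/funext => n; exact: modulusM.
apply: nondecreasing_is_cvgn; first exact: nondecreasing_powR_series.
by eexists => _ [n _ <-]; exact: sac.
Qed.

(* Finitely supported sequences belong to every space. *)
Lemma in_ell_finite_support p a (N : nat) :
  (forall n, (N <= n)%N -> a n = 0) -> in_ell p%:num a.
Proof.
have [q -> [->|[r r0 ->]]] := exponentP p => /= aN.
  apply: (@cvg_trans _ (cst (0 : R) @ \oo)); last exact: cvg_cst.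
  by apply: near_eq_cvg; exists N => // n /= /aN ->; rewrite modulus0.
apply: nondecreasing_is_cvgn; first exact: nondecreasing_powR_series.
exists (series (fun n => modulus (a n) `^ r) N) => _ [n _ <-].
have [nN|/ltnW Nn] := leqP n N; first exact: nondecreasing_powR_series.
rewrite /series/= (big_cat_nat (leq0n N) Nn)//= [X in _ + X]big_nat [X in _ + X]big1 ?addr0//.
by move=> i /andP[/aN -> _]; rewrite modulus0 powR0 ?gt_eqF.
Qed.

Lemma in_ell0 p : in_ell p%:num 0.
Proof. by apply: (@in_ell_finite_support _ _ 0%N). Qed.

Definition ell_pred (p : {posnum \bar R}) : {pred (nat -> K^o)} :=
  [pred a | `[< in_ell p%:num a >]].

Lemma ell_submod p : submod_closed (ell_pred p).
Proof.
split; first by apply/asboolP; exact: in_ell0.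
move=> s a b /asboolP ain /asboolP bin; apply/asboolP.
by apply: in_ellD => //; exact: in_ellZ.
Qed.

HB.instance Definition _ p :=
  GRing.isSubmodClosed.Build K (nat -> K^o) (ell_pred p) (ell_submod p).

Record ell p := Ell { ell_seq :> nat -> K^o ; _ : ell_seq \in ell_pred p }.

HB.instance Definition _ p := [isSub of ell p for @ell_seq p].
HB.instance Definition _ p := [Choice of ell p by <:].
HB.instance Definition _ p := [SubChoice_isSubLmodule of ell p by <:].

Lemma ell_seqD p (x y : ell p) :
  (x + y : ell p) = (x : nat -> K^o) + (y : nat -> K^o) :> (nat -> K^o).
Proof. by []. Qed.

Lemma ell_seqB p (x y : ell p) :
  (x - y : ell p) = (x : nat -> K^o) - (y : nat -> K^o) :> (nat -> K^o).
Proof. by []. Qed.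

Lemma ell_seqZ p (s : K) (x : ell p) :
  (s *: x : ell p) = s *: (x : nat -> K^o) :> (nat -> K^o).
Proof. by []. Qed.

Lemma ellP p (x : ell p) : in_ell p%:num x.
Proof. by case: x => a /= /asboolP. Qed.

Definition ell_qnorm p (x : ell p) : R := ell_norm p%:num x.

Lemma ell_qnorm_ge0 p (x : ell p) : 0 <= ell_qnorm x.
Proof. exact: ell_norm_ge0. Qed.

Lemma ell_modulus_le p (x : ell p) n : modulus (x n) <= ell_qnorm x.
Proof.
apply: (@ell_bound_modulus p); first exact: ell_norm_ge0.
exact/ell_bound_norm/ellP.
Qed.

Lemma ell_qnorm_eq0 p (x : ell p) : ell_qnorm x = 0 -> x = 0.
Proof.
move=> x0; apply/val_inj/funext => n /=; apply/modulus_eq0/le_anti.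
by rewrite modulus_ge0 andbT -x0 ell_modulus_le.
Qed.

Lemma ell_qnormZ_le p (s : K) (x : ell p) :
  ell_qnorm (s *: x) <= modulus s * ell_qnorm x.
Proof.
apply: ell_norm_le; [exact: ellP|by rewrite mulr_ge0 ?modulus_ge0 ?ell_qnorm_ge0|] => n.
rewrite ell_seqZ; apply: ell_boundZ; first exact: ell_norm_ge0.
exact/ell_bound_norm/ellP.
Qed.

Lemma ell_qnormZ p (s : K) (x : ell p) :
  ell_qnorm (s *: x) = modulus s * ell_qnorm x.
Proof.
apply/le_anti; rewrite ell_qnormZ_le/=.
have [->|s0] := eqVneq s 0; first by rewrite modulus0 mul0r ell_qnorm_ge0.
have sV : modulus s * modulus s^-1 = 1 by rewrite -modulusM mulfV// modulus1.
rewrite -{1}[x](scalerK s0) (le_trans (ler_wpM2l (modulus_ge0 _) (ell_qnormZ_le _ _)))//.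
by rewrite mulrA sV mul1r.
Qed.

Lemma ell_qnormD p : exists2 kappa : R, 1 <= kappa &
  forall x y : ell p, ell_qnorm (x + y) <= kappa * (ell_qnorm x + ell_qnorm y).
Proof.
exists (ell_kappa p%:num); first exact: ell_kappa_ge1.
move=> x y; apply: ell_norm_le; first exact: ellP.
  rewrite mulr_ge0 ?addr_ge0 ?ell_qnorm_ge0//.
  by rewrite (le_trans ler01)// ell_kappa_ge1.
move=> n; rewrite ell_seqD; apply: ell_boundD; try exact: ell_norm_ge0.
  exact/ell_bound_norm/ellP.
exact/ell_bound_norm/ellP.
Qed.

Lemma ell_complete p (u : nat -> ell p) :
  (forall e : R, 0 < e -> exists N, forall m n,
    (N <= m)%N -> (N <= n)%N -> ell_qnorm (u m - u n) < e) ->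
  exists l, ell_qnorm (u n - l) @[n --> \oo] --> (0 : R).
Proof.
move=> uC.
have /choice[l ul] : forall i, exists l : K, forall e : R, 0 < e ->
    exists N, forall n, (N <= n)%N -> modulus (u n i - l) < e.
  move=> i; apply: scalars_complete => e /uC[N HN]; exists N => m n Nm Nn.
  by apply: le_lt_trans (HN _ _ Nm Nn); exact: (ell_modulus_le (u m - u n) i).
have k0 : 0 < ell_kappa p%:num by rewrite (lt_le_trans ltr01)// ell_kappa_ge1.
have ulb e : 0 < e -> exists N, forall n, (N <= n)%N ->
    forall j, ell_bound p%:num e ((l : nat -> K^o) - u n) j.
  move=> e0; pose d := e / ell_kappa p%:num / 2.
  have d0 : 0 < d by rewrite !divr_gt0.
  have [N HN] := uC _ d0; exists N => n Nn j.
  have [h h0 hb] := ell_bound_small p j d0.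
  have [M HM] : exists M, forall m, (M <= m)%N -> forall i, (i <= j)%N ->
      modulus (u m i - l i) <= h.
    elim: j {hb} => [|j [M HM]].
      have [M HM] := ul 0%N _ h0; exists M => m /HM/ltW mh i.
      by rewrite leqn0 => /eqP ->.
    have [M' HM'] := ul j.+1 _ h0; exists (maxn M M') => m.
    rewrite geq_max => /andP[/HM mh /HM'/ltW mh'] i.
    by rewrite leq_eqVlt => /predU1P[->//|]; exact: mh.
  pose m := maxn M N.
  have lm : ell_bound p%:num d ((l : nat -> K^o) - u m) j.
    apply: hb => i ij; rewrite -modulusN.
    rewrite (_ : - _ = u m i - l i); last by rewrite opprB.
    by apply: HM => //; exact: leq_maxl.
  have um : ell_bound p%:num (ell_qnorm (u m - u n)) (u m - u n) j.
    exact/ell_bound_norm/ellP.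
  have mn : ell_qnorm (u m - u n) <= d by rewrite ltW// HN// leq_maxr.
  have := ell_boundD (ltW d0) (ell_qnorm_ge0 _) lm um.
  rewrite [_ + (_ : nat -> K^o)](_ : _ = (l : nat -> K^o) - u n); last first.
    by apply/funext => i; rewrite /GRing.add/= addrA subrK.
  have cd : ell_kappa p%:num * (d + ell_qnorm (u m - u n)) <= e.
    apply: (@le_trans _ _ (ell_kappa p%:num * (d + d))).
      by rewrite ler_wpM2l ?(ltW k0)// lerD2l.
    by rewrite -splitr mulrC divfK// gt_eqF.
  have cd0 : 0 <= ell_kappa p%:num * (d + ell_qnorm (u m - u n)).
    by rewrite mulr_ge0 ?addr_ge0 ?ell_qnorm_ge0 ?ltW.
  move: cd cd0; move: (ell_kappa _ * _) => c.
  have [q -> [->|[r r0 ->]]] := exponentP p => /= ce c0 h1; first exact: le_trans ce.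
  by apply: le_trans h1 _; apply: le_powR => //; exact: ltW.
have lin : in_ell p%:num l.
  apply: in_ell_cauchy => e /ulb[N HN]; exists (u N); first exact: ellP.
  exact: HN.
have lin' : (l : nat -> K^o) \in ell_pred p by exact/asboolP.
exists (Ell lin'); apply/cvgrPdist_le => e /[dup] e0 /ulb[N HN].
exists N => // n /= Nn; rewrite sub0r normrN ger0_norm ?ell_qnorm_ge0//.
rewrite -opprB -scaleN1r ell_qnormZ modulusN modulus1 mul1r.
by apply: ell_norm_le; [exact: ellP|exact: ltW|exact: HN].
Qed.

HB.instance Definition _ p := @Lmodule_isQuasiBanach.Build R k (ell p)
  (@ell_qnorm p) (@ell_qnorm_ge0 p) (@ell_qnorm_eq0 p) (@ell_qnormZ p)
  (@ell_qnormD p) (@ell_complete p).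

Definition unit_seq (n : nat) : nat -> K^o := fun i => (i == n)%:R.

Lemma unit_seqP p n : unit_seq n \in ell_pred p.
Proof.
apply/asboolP/(@in_ell_finite_support _ _ n.+1) => i ni.
by rewrite /unit_seq gtn_eqF.
Qed.

Definition unit_vector p (n : nat) : ell p := Ell (unit_seqP p n).

End sequence_spaces.

Section direct_sum.
Context {R : realType} {k : scalar_kind} {I : finType}.
Context (X : I -> quasiBanachType R k).
Local Notation K := (scalars R k).

Definition direct_sum := forall i, X i.
Implicit Types x y : direct_sum.

HB.instance Definition _ := gen_eqMixin direct_sum.
HB.instance Definition _ := gen_choiceMixin direct_sum.

Definition direct_sum_add x y : direct_sum := fun i => x i + y i.
Definition direct_sum_opp x : direct_sum := fun i => - x i.
Definition direct_sum_zero : direct_sum := fun i => 0.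
Definition direct_sum_scale (a : K) x : direct_sum := fun i => a *: x i.

Lemma direct_sum_addA : associative direct_sum_add.
Proof. by move=> x y z; apply: functional_extensionality_dep => i; exact: addrA. Qed.

Lemma direct_sum_addC : commutative direct_sum_add.
Proof. by move=> x y; apply: functional_extensionality_dep => i; exact: addrC. Qed.

Lemma direct_sum_add0 : left_id direct_sum_zero direct_sum_add.
Proof. by move=> x; apply: functional_extensionality_dep => i; exact: add0r. Qed.

Lemma direct_sum_addN : left_inverse direct_sum_zero direct_sum_opp direct_sum_add.
Proof. by move=> x; apply: functional_extensionality_dep => i; exact: addNr. Qed.

HB.instance Definition _ := GRing.isZmodule.Build direct_sum
  direct_sum_addA direct_sum_addC direct_sum_add0 direct_sum_addN.

Lemma direct_sum_scaleA (a b : K) x :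
  direct_sum_scale a (direct_sum_scale b x) = direct_sum_scale (a * b) x.
Proof. by apply: functional_extensionality_dep => i; exact: scalerA. Qed.

Lemma direct_sum_scale1 : left_id 1 direct_sum_scale.
Proof. by move=> x; apply: functional_extensionality_dep => i; exact: scale1r. Qed.

Lemma direct_sum_scaleDr : right_distributive direct_sum_scale +%R.
Proof. by move=> a x y; apply: functional_extensionality_dep => i; exact: scalerDr. Qed.

Lemma direct_sum_scaleDl x : {morph direct_sum_scale^~ x : a b / a + b}.
Proof. by move=> a b; apply: functional_extensionality_dep => i; exact: scalerDl. Qed.

HB.instance Definition _ := GRing.Zmodule_isLmodule.Build K direct_sum
  direct_sum_scaleA direct_sum_scale1 direct_sum_scaleDr direct_sum_scaleDl.

(* The supremum over the finite index set; it is 0 when I is empty. *)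
Definition direct_sum_qnorm x : R := \big[Num.max/0]_(i : I) qnorm (x i).

Lemma direct_sum_qnorm_ge0 x : 0 <= direct_sum_qnorm x.
Proof. exact: bigmax_ge_id. Qed.

Lemma qnorm_le_direct_sum x i : qnorm (x i) <= direct_sum_qnorm x.
Proof. exact: (le_bigmax _ (fun i => qnorm (x i))). Qed.

Lemma direct_sum_qnorm_le x (c : R) :
  0 <= c -> (forall i, qnorm (x i) <= c) -> direct_sum_qnorm x <= c.
Proof. by move=> c0 xc; apply: bigmax_le. Qed.

Lemma direct_sum_qnorm_eq0 x : direct_sum_qnorm x = 0 -> x = 0.
Proof.
move=> x0; apply: functional_extensionality_dep => i; apply/qnorm_eq0/le_anti.
by rewrite qnorm_ge0 andbT -x0 qnorm_le_direct_sum.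
Qed.

Lemma direct_sum_qnormZ (a : K) x :
  direct_sum_qnorm (a *: x) = modulus a * direct_sum_qnorm x.
Proof.
rewrite /direct_sum_qnorm (eq_bigr _ (fun i _ => qnormZ a (x i))).
rewrite (big_morph (fun r => modulus a * r) (id1 := 0) (op1 := Num.max))//.
  by move=> r s; rewrite maxr_pMr// modulus_ge0.
by rewrite mulr0.
Qed.

Lemma direct_sum_qnormD : exists2 kappa : R, 1 <= kappa &
  forall x y, direct_sum_qnorm (x + y) <=
    kappa * (direct_sum_qnorm x + direct_sum_qnorm y).
Proof.
have /choice[c hc] : forall i, exists c : R, 1 <= c /\
    forall u v : X i, qnorm (u + v) <= c * (qnorm u + qnorm v).
  by move=> i; have [c] := @qnormD R k (X i); exists c.
pose c' := \big[Num.max/1]_(i : I) c i.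
have c'1 : 1 <= c' by exact: bigmax_ge_id.
exists c' => // x y.
have c'0 : 0 <= c' by rewrite (le_trans ler01).
apply: direct_sum_qnorm_le => [|i].
  by rewrite mulr_ge0 ?addr_ge0 ?direct_sum_qnorm_ge0.
apply: le_trans ((hc i).2 _ _) _; apply: ler_pM => //.
- by rewrite (le_trans ler01)//; exact: (hc i).1.
- by rewrite addr_ge0 ?qnorm_ge0.
- exact: le_bigmax.
- by rewrite lerD// qnorm_le_direct_sum.
Qed.

Lemma direct_sum_complete (u : nat -> direct_sum) :
  (forall e : R, 0 < e -> exists N, forall m n,
    (N <= m)%N -> (N <= n)%N -> direct_sum_qnorm (u m - u n) < e) ->
  exists l, direct_sum_qnorm (u n - l) @[n --> \oo] --> (0 : R).
Proof.
move=> uC.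
have ex_l : forall i, exists l : X i, qnorm (u n i - l) @[n --> \oo] --> (0 : R).
  move=> i; apply: (@qnorm_complete R k (X i) (fun n => u n i)) => e /uC[N HN].
  exists N => m n Nm Nn; apply: le_lt_trans (HN _ _ Nm Nn).
  exact: (qnorm_le_direct_sum (u m - u n) i).
pose l : direct_sum := fun i => projT1 (cid (ex_l i)).
have ul i : qnorm (u n i - l i) @[n --> \oo] --> (0 : R).
  by rewrite /l; case: cid.
exists l; apply/cvgrPdist_le => e e0.
have : \forall n \near \oo, forall i : I, qnorm (u n i - l i) <= e.
  apply: filter_forall => i.
  have /cvgrPdist_le/(_ _ e0) := ul i; apply: filterS => n.
  by rewrite sub0r normrN ger0_norm ?qnorm_ge0.
apply: filterS => n ne.
rewrite sub0r normrN ger0_norm ?direct_sum_qnorm_ge0//.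
by apply: direct_sum_qnorm_le => //; exact: ltW.
Qed.

HB.instance Definition _ := @Lmodule_isQuasiBanach.Build R k direct_sum
  direct_sum_qnorm direct_sum_qnorm_ge0 direct_sum_qnorm_eq0 direct_sum_qnormZ
  direct_sum_qnormD direct_sum_complete.

End direct_sum.
Arguments direct_sum {R k I} X.

Definition ell_sum (R : realType) (k : scalar_kind)
    (A : {fset {posnum \bar R}}) : quasiBanachType R k :=
  direct_sum (fun p : A => ell k (val p) : quasiBanachType R k).

(* Indexed by the pairs (p, n) with p in A. *)
Definition canonical_basis (R : realType) (k : scalar_kind)
    (A : {fset {posnum \bar R}}) (pn : A * nat) : ell_sum k A :=
  fun q => if q == pn.1 then unit_vector k (val q) pn.2 else 0.

(* Main.v *)
From HB Require Import structures.
Require Import Defs.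
From mathcomp Require Import all_boot all_order all_algebra finmap complex interval_inference.
From mathcomp Require Import all_classical all_reals.
From mathcomp Require Import topology normedtype sequences exp summability.
From mathcomp Require Import ring lra.

(* Let e be the canonical basis, with biorthogonal functionals e_i^*, and x another
   normalized unconditional basis, with functionals x_j^*.  Splitting
   1 = x_j^*(x_j) = sum_i e_i^*(x_j) x_j^*(e_i) along the finitely many summands l_p
   assigns to each j an exponent p for which the partial sum is at least c > 0;
   let J_p be the set of these j.  It is shown that (x_j)_{j in J_p} is equivalent
   to the basis of l_p.  By unconditionality and Khintchine's inequality the norm
   of sum_j b_j x_j is equivalent to the largest of the square functions
   || (sum_j |b_j e_i^*(x_j)|^2)^{1/2} ||_{l_p} (sum_j |b_j e_i^*(x_j)| in place of
   the square function for c_0); in particular the lattice structure induced by x is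
   L-convex, which replaces the averaging arguments of locally convex spaces.
   - Upper l_p estimates, p <= 1 or p = 2: L-convexity applied to random signs of
     the parts of the x_j lying in l_p.
   - Lower estimates: l_p(l_2) embeds in l_2(l_p), so (x_j)_{j in J_p} dominates l_2;
     hence sum_{j in J_p} |x_j^*(e_i)|^2 is bounded, and for p <= 1 this, with
     sum_i |e_i^*(x_j) x_j^*(e_i)| >= c, improves the l_2 estimate to l_p.
   - c_0: the dual argument, in which Khintchine's inequality is replaced by
     truncated sign sums.
   Finally, J_p is infinite: exchanging the roles of e and x, all but finitely many
   vectors of the canonical basis of l_p are assigned to p by x, which is impossible
   if J_p is finite because e_i^*(x_j) tends to 0 along i. *)

Set Implicit Arguments.
Unset Strict Implicit.
Unset Printing Implicit Defensive.

Import Order.TTheory GRing.Theory Num.Theory.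
Import numFieldNormedType.Exports.
Import ComplexField.Normc.

Local Open Scope classical_set_scope.
Local Open Scope ring_scope.

(** * Sign vectors and Khintchine's inequality *)

Section sign_vectors.
Context {S : finType}.
Implicit Types (s : {ffun S -> bool}) (i : S).

(** For p < 1 there is no convexity through which vectors could be averaged, and duality is too weak
    to replace it. Averages over signs are therefore finite and are applied only to scalar
    quantities, and the two bases meet only through the matrices e_i^*(x_j) and x_j^*(e_i).
    Equivalence with the basis of l_p is expressed by inequalities between finite sums with a
    constant; in this form it is both hypothesis and conclusion of the comparison of two bases, so
    the comparison can be run a second time with e and x exchanged. The detour through l_2 is a
    bootstrap: the l_2 estimate holds for arbitrary coefficients, in particular for the entries of
    the matrices themselves, and the column bounds obtained in this way are what the sharp estimate
    needs. *)

Definition flip i s : {ffun S -> bool} := [ffun j => (j == i) (+) s j].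

Lemma flipK i : involutive (flip i).
Proof. by move=> s; apply/ffunP => j; rewrite !ffunE addbA addbb. Qed.

Lemma sum_flip (V : nmodType) i (F : {ffun S -> bool} -> V) :
  \sum_s F (flip i s) = \sum_s F s.
Proof. by rewrite [RHS](reindex_inj (inv_inj (flipK i))). Qed.

Definition signed (V : zmodType) (b : bool) (v : V) : V := if b then - v else v.

Lemma signedN (V : zmodType) b (v : V) : signed (~~ b) v = - signed b v.
Proof. by case: b; rewrite /= ?opprK. Qed.

Definition sign_sum (V : zmodType) (c : S -> V) s : V := \sum_i signed (s i) (c i).

Lemma sign_sum_flip (V : zmodType) (c : S -> V) i s :
  sign_sum c (flip i s) = sign_sum c s - signed (s i) (c i) *+ 2.
Proof.
rewrite /sign_sum (bigD1 i)//= [in RHS](bigD1 i)//= ffunE eqxx/=.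
have -> : \sum_(j | j != i) signed (flip i s j) (c j) =
    \sum_(j | j != i) signed (s j) (c j).
  by apply: eq_bigr => j /negPf ji; rewrite ffunE ji.
by rewrite signedN mulr2n opprD addrACA subrr add0r addrC.
Qed.

Definition nsigns : nat := #|{ffun S -> bool}|.

Lemma nsigns_gt0 : (0 < nsigns)%N.
Proof. by apply/card_gt0P; exists [ffun=> true]. Qed.

End sign_vectors.
Arguments nsigns : clear implicits.

Section real_sign_moments.
Context {R : realType} {S : finType}.
Implicit Types (c : S -> R) (s : {ffun S -> bool}).
Local Notation N := ((nsigns S)%:R : R).

(** Pairing a sign vector with its flip at [i] replaces the independence of the [i]-th sign: only
    the part of [F] that is odd in this sign contributes. *)
Lemma sum_sign_correlation i c (F : {ffun S -> bool} -> R) :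
  2 * (\sum_(s : {ffun S -> bool}) signed (s i) (c i) * F s) =
  \sum_(s : {ffun S -> bool}) signed (s i) (c i) * (F s - F (flip i s)).
Proof.
rewrite mulr_natl mulr2n -{2}(sum_flip i) -big_split/=; apply: eq_bigr => s _.
by rewrite ffunE eqxx/= signedN mulNr mulrBr.
Qed.

Lemma sum_sign_sumM c i :
  \sum_(s : {ffun S -> bool}) signed (s i) (c i) * sign_sum c s = N * c i ^+ 2.
Proof.
have := sum_sign_correlation i c (sign_sum c).
rewrite [X in _ = X -> _](eq_bigr (fun=> 2 * c i ^+ 2)) => [|s _]; last first.
  by rewrite sign_sum_flip; case: (s i) => /=; rewrite mulr2n; ring.
rewrite sumr_const -[X in _ = X]mulr_natl -/(nsigns S).
by move: (\sum_s _) => x; lra.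
Qed.

Lemma sum_sign_sum_sqr c :
  \sum_s sign_sum c s ^+ 2 = N * \sum_i c i ^+ 2.
Proof.
rewrite mulr_sumr.
under eq_bigr => s _ do rewrite expr2 {1}/sign_sum mulr_suml.
by rewrite exchange_big/=; apply: eq_bigr => i _; rewrite sum_sign_sumM.
Qed.

Lemma sum_sign_sum_pow4 c :
  \sum_s sign_sum c s ^+ 4 <= 3 * N * (\sum_i c i ^+ 2) ^+ 2.
Proof.
set V := \sum_i c i ^+ 2; have V0 : 0 <= V by apply: sumr_ge0 => i _; exact: sqr_ge0.
have h i : \sum_(s : {ffun S -> bool}) signed (s i) (c i) * sign_sum c s ^+ 3 <= 3 * N * V * c i ^+ 2.
  have := sum_sign_correlation i c (fun s => sign_sum c s ^+ 3).
  (* With [u] the signed coefficient and [x] the sign sum, this expands [u (x^3 - (x - 2u)^3)]. The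
     total over all signs is [6 N V c_i^2 - 4 N c_i^4], whose negative part is dropped. *)
  rewrite [X in _ = X -> _](eq_bigr (fun s => (6 * c i ^+ 2) * sign_sum c s ^+ 2 -
       (12 * c i ^+ 2) * (signed (s i) (c i) * sign_sum c s) + 8 * c i ^+ 4)); last first.
    by move=> s _; rewrite sign_sum_flip; case: (s i) => /=; rewrite mulr2n; ring.
  rewrite !big_split/= sumrN -!mulr_sumr sum_sign_sum_sqr sum_sign_sumM -/V.
  rewrite sumr_const -[_ *+ #|_|]mulr_natl -/(nsigns S).
  have : 0 <= N * c i ^+ 4 by rewrite mulr_ge0// exprn_even_ge0.
  move=> h4 hx; apply: (@le_trans _ _ (3 * N * V * c i ^+ 2 - 2 * (N * c i ^+ 4))); last first.
    by rewrite gerBl mulr_ge0.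
  have t : (2 : R) != 0 by rewrite pnatr_eq0.
  rewrite le_eqVlt; apply/orP; left; apply/eqP/(mulfI t); rewrite hx mulrBr; ring.
rewrite [leRHS](_ : _ = \sum_i 3 * N * V * c i ^+ 2); last first.
  by rewrite -mulr_sumr -/V; ring.
apply: le_trans (ler_sum _ (fun i _ => h i)); rewrite le_eqVlt; apply/orP; left; apply/eqP.
under eq_bigr => s _ do rewrite exprS {1}/sign_sum mulr_suml.
by rewrite exchange_big.
Qed.

End real_sign_moments.

Section scalar_parts.
Context {R : realType} {k : scalar_kind}.
Local Notation K := (scalars R k).
Implicit Types (z w : K).

Definition re_part : K -> R :=
  match k return scalars R k -> R with RealScalars => id | ComplexScalars => @complex.Re R end.
Definition im_part : K -> R :=
  match k return scalars R k -> R with RealScalars => fun=> 0 | ComplexScalars => @complex.Im R end.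
Definition of_real : R -> K :=
  match k return R -> scalars R k with RealScalars => id | ComplexScalars => real_complex R end.

Lemma re_partB z w : re_part (z - w) = re_part z - re_part w.
Proof. by rewrite /re_part; case: k z w => //= z w; rewrite raddfB. Qed.

Lemma im_partB z w : im_part (z - w) = im_part z - im_part w.
Proof. by rewrite /im_part; case: k z w => //= z w; rewrite ?subr0// raddfB. Qed.

Lemma modulus_sqr z : modulus z ^+ 2 = re_part z ^+ 2 + im_part z ^+ 2.
Proof.
rewrite /re_part/im_part; case: k z => [z|[a b]] /=.
  by rewrite expr0n addr0 real_normK// num_real.
by rewrite sqr_sqrtr// addr_ge0 ?sqr_ge0.
Qed.

Lemma modulus_of_real (a : R) : modulus (of_real a) = `|a|.
Proof.
rewrite /of_real; case: k => //=.
by rewrite expr0n addr0 sqrtr_sqr.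
Qed.

Lemma of_realM (a b : R) : of_real (a * b) = of_real a * of_real b.
Proof. by rewrite /of_real; case: k => //=; rewrite rmorphM. Qed.

Lemma of_real0 : of_real 0 = 0. Proof. by rewrite /of_real; case: k. Qed.

HB.instance Definition _ := GRing.isZmodMorphism.Build K R re_part re_partB.
HB.instance Definition _ := GRing.isZmodMorphism.Build K R im_part im_partB.

Lemma of_realB (a b : R) : of_real (a - b) = of_real a - of_real b.
Proof. by rewrite /of_real; case: k => //=; rewrite rmorphB. Qed.
HB.instance Definition _ := GRing.isZmodMorphism.Build R K of_real of_realB.

Lemma modulus_phase z : exists2 w, modulus w <= 1 & z * w = of_real (modulus z).
Proof.
have [->|z0] := eqVneq z 0.
  by exists 0; rewrite ?modulus0// mul0r of_real0.
exists (of_real (modulus z) / z); last by rewrite mulrC divfK.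
have mz : modulus z != 0 by apply: contra_neq z0; exact: modulus_eq0.
have : modulus (z * (of_real (modulus z) / z)) = modulus z.
  by rewrite mulrC divfK// modulus_of_real ger0_norm// modulus_ge0.
by rewrite modulusM -[X in _ = X]mulr1 => /(mulfI mz) ->.
Qed.

Lemma modulusB z w : modulus (z - w) = modulus (w - z).
Proof. by rewrite -modulusN opprB. Qed.

Lemma modulus_dist z w : `|modulus z - modulus w| <= modulus (z - w).
Proof.
have := modulusD (z - w) w; have := modulusD (w - z) z.
by rewrite !subrK [modulus (w - z)]modulusB ler_norml; lra.
Qed.

Lemma modulus_sum (I : Type) (r : seq I) (P : pred I) (F : I -> K) :
  modulus (\sum_(i <- r | P i) F i) <= \sum_(i <- r | P i) modulus (F i).
Proof.
apply: (big_ind2 (fun a b => modulus a <= b)) => //; first by rewrite modulus0.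
by move=> a b c d ab cd; rewrite (le_trans (modulusD _ _))// lerD.
Qed.

Lemma modulus_signed b z : modulus (signed b z) = modulus z.
Proof. by case: b => //=; rewrite modulusN. Qed.

End scalar_parts.

Section khintchine.
Context {R : realType} {k : scalar_kind} {S : finType}.
Local Notation K := (scalars R k).
Local Notation N := ((nsigns S)%:R : R).
Implicit Types (c : S -> K) (s : {ffun S -> bool}).

Lemma modulusMn (z : K) n : modulus (z *+ n) = modulus z * n%:R.
Proof.
have of_real1 : of_real 1 = 1 :> K by rewrite /of_real; case: (k).
rewrite -[z *+ n]mulr_natr modulusM; congr (_ * _).
by rewrite -of_real1 -raddfMn modulus_of_real normr_nat.
Qed.

Lemma raddf_sign_sum (V W : zmodType) (f : {additive V -> W}) (c : S -> V) s :
  f (sign_sum c s) = sign_sum (f \o c) s.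
Proof. by rewrite raddf_sum; apply: eq_bigr => i _; case: (s i); rewrite /= ?raddfN. Qed.

Lemma sum_modulus_sign_sum_sqr c :
  \sum_s modulus (sign_sum c s) ^+ 2 = N * \sum_i modulus (c i) ^+ 2.
Proof.
under eq_bigr do rewrite modulus_sqr !raddf_sign_sum.
rewrite big_split/= !sum_sign_sum_sqr -mulrDr -big_split/=.
by congr (_ * _); apply: eq_bigr => i _; rewrite modulus_sqr.
Qed.

Lemma sum_modulus_sign_sum_pow4 c :
  \sum_s modulus (sign_sum c s) ^+ 4 <= 6 * N * (\sum_i modulus (c i) ^+ 2) ^+ 2.
Proof.
have h : forall s, modulus (sign_sum c s) ^+ 4 <=
    2 * sign_sum (re_part \o c) s ^+ 4 + 2 * sign_sum (im_part \o c) s ^+ 4.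
  move=> s; rewrite -[4%N]/(2 * 2)%N exprM modulus_sqr !raddf_sign_sum !exprM.
  move: (_ ^+ 2) (sign_sum (im_part \o c) s ^+ 2) => a b.
  have := sqr_ge0 (a - b); nra.
apply: le_trans (ler_sum _ (fun s _ => h s)) _; rewrite big_split/= -!mulr_sumr.
have := sum_sign_sum_pow4 (re_part \o c); have := sum_sign_sum_pow4 (im_part \o c).
under [X in _ -> _ -> _ <= _ * X ^+ 2]eq_bigr do rewrite modulus_sqr.
rewrite big_split/=.
have : 0 <= \sum_i re_part (c i) ^+ 2 by apply: sumr_ge0 => i _; exact: sqr_ge0.
have : 0 <= \sum_i im_part (c i) ^+ 2 by apply: sumr_ge0 => i _; exact: sqr_ge0.
move: (\sum_i _ ^+ 2) (\sum_i re_part _ ^+ 2) => a b a0 b0 ha hb.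
have N0 : 0 <= N by [].
have : 0 <= N * (a * b) by rewrite !mulr_ge0.
move: N ha hb => n ha hb nab; rewrite sqrrD; nra.
Qed.

(* Paley-Zygmund: by the fourth moment, |S|^2 cannot concentrate where it is
   below a quarter of its mean. *)
Lemma sign_sum_paley_zygmund c :
  N <= 12 * (#|[pred s | \sum_i modulus (c i) ^+ 2 <= 4 * modulus (sign_sum c s) ^+ 2]|)%:R.
Proof.
set V := \sum_i _; set G := [pred s | _].
have V0 : 0 <= V by apply: sumr_ge0 => i _; exact: sqr_ge0.
have [VE|Vn0] := eqVneq V 0.
  rewrite (_ : #|G| = nsigns S) ?ler_peMl ?ler1n//.
  by apply: eq_card => s; rewrite !inE VE mulr_ge0// sqr_ge0.
have {Vn0}V0 : 0 < V by rewrite lt_neqAle eq_sym Vn0.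
(* Let [t] be the squared modulus. Outside [G] the left side is at most [6 V^2]; on [G] it is at
   most [144 V^2 + t^2], because [(12 V - t)^2 >= 0]. Summation compares [24 N V^2] with
   [12 N V^2 + 144 V^2 #|G|]. *)
have h s : 24 * V * modulus (sign_sum c s) ^+ 2 <=
    6 * V ^+ 2 + modulus (sign_sum c s) ^+ 4 + 144 * V ^+ 2 * (s \in G)%:R.
  rewrite -[4%N]/(2 * 2)%N exprM; have : 0 <= modulus (sign_sum c s) ^+ 2 by exact: sqr_ge0.
  rewrite inE/=; move: (_ ^+ 2) => t t0.
  have [Vt|Vt] := leP V (4 * t) => /=.
    by rewrite mulr1; have := sqr_ge0 (12 * V - t); have := sqr_ge0 V; nra.
  by rewrite mulr0 addr0; have := sqr_ge0 t; nra.
have := ler_sum (index_enum _) (fun s (_ : true) => h s).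
rewrite !big_split/= -!mulr_sumr sum_modulus_sign_sum_sqr -/V sumr_const.
have -> : \sum_s (s \in G)%:R = #|G|%:R :> R.
  by rewrite -sum1_card natr_sum [RHS]big_mkcond/=; apply: eq_bigr => s _; case: (s \in G).
have := sum_modulus_sign_sum_pow4 c; rewrite -/V.
move: (\sum_s _) => x; rewrite -[_ *+ #|_|]mulr_natl -/(nsigns S) => h4 hh.
have V20 : 0 < V ^+ 2 by rewrite exprn_gt0.
rewrite -(ler_pM2r V20); set n := (nsigns S)%:R in h4 hh *.
by move: (#|G|%:R : R) hh => g hh; clearbody n; lra.
Qed.

(** Signs read off the real parts prevent cancellation among them, and likewise for the imaginary
    parts; the better of the two choices loses a factor 2. *)
Lemma sum_le_sign_sum c :
  exists s, \sum_i modulus (c i) <= 2 * modulus (sign_sum c s).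
Proof.
have part (f : {additive K -> R}) : (forall z, `|f z| <= modulus z) ->
    exists s, \sum_i `|f (c i)| <= modulus (sign_sum c s).
  move=> fle; exists [ffun i => f (c i) < 0]; apply: le_trans (fle _).
  rewrite raddf_sign_sum (le_trans _ (ler_norm _))// ler_sum// => i _.
  by rewrite ffunE; case: ltP => fc /=; [rewrite ltr0_norm|rewrite ger0_norm].
have le_mod (z : K) (a : R) : a ^+ 2 <= modulus z ^+ 2 -> `|a| <= modulus z.
  by rewrite -real_normK ?num_real// ler_pXn2r// nnegrE// modulus_ge0.
have [s1 h1] : exists s, \sum_i `|re_part (c i)| <= modulus (sign_sum c s).
  by apply: part => z; apply: le_mod; rewrite modulus_sqr lerDl sqr_ge0.
have [s2 h2] : exists s, \sum_i `|im_part (c i)| <= modulus (sign_sum c s).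
  by apply: part => z; apply: le_mod; rewrite modulus_sqr lerDr sqr_ge0.
have h : \sum_i modulus (c i) <= modulus (sign_sum c s1) + modulus (sign_sum c s2).
  apply: le_trans (lerD h1 h2); rewrite -big_split/=; apply: ler_sum => i _.
  rewrite -(@ler_pXn2r _ 2) ?nnegrE ?addr_ge0 ?modulus_ge0// modulus_sqr.
  rewrite sqrrD !real_normK ?num_real// lerD2r lerDl mulrn_wge0// mulr_ge0//.
by have [s12|/ltW s21] := leP (modulus (sign_sum c s1)) (modulus (sign_sum c s2));
  [exists s2|exists s1]; rewrite mulr_natl mulr2n (le_trans h)// lerD.
Qed.

(** [B] and its preimage under the flip have the same cardinality, and together they cover [G]. *)
Lemma card_flip_le (j : S) (G B : pred {ffun S -> bool}) :
  (forall s, G s -> B s || B (flip j s)) -> (#|G| <= 2 * #|B|)%N.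
Proof.
move=> GB; rewrite mul2n -addnn.
have -> : (#|B| + #|B| = #|B| + #|[pred s | B (flip j s)]|)%N.
  congr (_ + _)%N; rewrite -(fintype.card_image (inv_inj (flipK j)) B); apply: eq_card => s.
  rewrite inE; apply/fintype.imageP/idP => [[t Bt ->]|Bs]; first by rewrite flipK.
  by exists (flip j s); rewrite ?flipK.
apply: leq_trans (_ : #|predU B [pred s | B (flip j s)]| <= _)%N.
  by apply: subset_leq_card; apply/fintype.subsetP => s; rewrite !inE; exact: GB.
by rewrite -cardUI leq_addr.
Qed.

Lemma sign_sum_flip_ge c j s (r : R) :
  r * 2 <= modulus (sign_sum c s - sign_sum c (flip j s)) ->
  (r <= modulus (sign_sum c s)) || (r <= modulus (sign_sum c (flip j s))).
Proof.
move=> h; have := le_trans h (modulusD _ _); rewrite modulusN => {}h.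
by apply/orP; have [|] := leP r (modulus (sign_sum c s)); [left|right; lra].
Qed.

(** Two sign vectors differing only at [j] give sums that differ by [2 c_j], so one of the two sums
    is large. No moment is involved: the other coefficients are arbitrary. *)
Lemma sign_sum_half c j :
  (nsigns S <= 2 * #|[pred s | (modulus (c j) <= modulus (sign_sum c s))%R]|)%N.
Proof.
apply: (@card_flip_le j predT) => s _; apply: sign_sum_flip_ge.
by rewrite sign_sum_flip opprB addrC subrK modulusMn modulus_signed.
Qed.

End khintchine.

(** * Inequalities for powers *)

Section power_inequalities.
Context {R : realType}.
Implicit Types (a b t v w h p q : R).

Lemma powR_sqr_half a q : 0 <= a -> (a ^+ 2) `^ (q / 2) = a `^ q.
Proof.
by move=> a0; rewrite -powR_mulrn// -powRrM mulrC divfK// pnatr_eq0.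
Qed.

(** The chord of a concave power between 0 and [v] lies below its graph. *)
Lemma ge_powR_affine h t v : 0 < h <= 1 -> 0 <= t <= v ->
  v `^ h * (t / v) <= t `^ h.
Proof.
move=> /andP[h0 h1] /andP[t0 tv].
have [->|tn0] := eqVneq t 0; first by rewrite mul0r mulr0 powR_ge0.
have {tn0}t0 : 0 < t by rewrite lt_neqAle eq_sym tn0.
have v0 : 0 < v by apply: lt_le_trans tv.
rewrite -{2}[t](divfK (lt0r_neq0 v0)) powRM ?divr_ge0 ?(ltW t0) ?(ltW v0)//.
rewrite mulrC ler_pM2r ?powR_gt0// ger1_powR// divr_gt0//=.
by rewrite ler_pdivrMr// mul1r.
Qed.

(** Substitute for Jensen's inequality: with an affine majorant, a sum of powers only involves the
    mean of [t]. The scale [v] is free and will be set to the expected size of [t]. *)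
Lemma powR_le_affine h t v : 0 < h <= 1 -> 0 <= t -> 0 < v ->
  t `^ h <= v `^ h * (1 + t / v).
Proof.
move=> /andP[h0 h1] t0 v0; rewrite mulrDr mulr1.
have [tv|vt] := leP t v.
  by rewrite (le_trans (le_powR (ltW h0) t0 tv))// lerDl mulr_ge0 ?powR_ge0 ?divr_ge0 ?(ltW v0).
rewrite -{1}[t](divfK (lt0r_neq0 v0)) powRM ?divr_ge0 ?(ltW v0)// mulrC.
rewrite (le_trans _ (_ : v `^ h * (t / v) <= _)) ?lerDr ?powR_ge0//.
by rewrite ler_pM2l ?powR_gt0// ler1_powR// ler_pdivlMr// mul1r ltW.
Qed.

Lemma powR_mul_le_add h t v : 0 < h < 1 -> 0 <= t -> 0 <= v ->
  t `^ h * v `^ (1 - h) <= t + v.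
Proof.
move=> /andP[h0 h1] t0 v0.
have m0 : 0 <= Num.max t v by rewrite le_max t0.
apply: le_trans (_ : Num.max t v `^ h * Num.max t v `^ (1 - h) <= _).
  by apply: ler_pM; rewrite ?powR_ge0// le_powR ?le_max ?lexx ?orbT// ?subr_ge0 ltW.
have e1 : h + (1 - h) = 1 by ring.
rewrite -powRD e1 ?oner_eq0// powRr1//.
by rewrite ge_max lerDl lerDr t0 v0.
Qed.

End power_inequalities.

Section khintchine_powR.
Context {R : realType} {k : scalar_kind} {S : finType}.
Local Notation K := (scalars R k).
Local Notation N := ((nsigns S)%:R : R).
Implicit Types (c : S -> K) (s : {ffun S -> bool}) (q : R).

(** Only the signs of the Paley-Zygmund set are kept; they are at least one twelfth of all signs,
    and on them the power is as large as required up to [4^(q/2)]. *)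
Lemma khintchine_lower c q : 0 < q ->
  N * (\sum_i modulus (c i) ^+ 2) `^ (q / 2) <=
  12 * 4 `^ (q / 2) * \sum_s modulus (sign_sum c s) `^ q.
Proof.
move=> q0; have q20 : 0 <= q / 2 by rewrite divr_ge0// ltW.
set V := \sum_i modulus (c i) ^+ 2.
have V0 : 0 <= V by apply: sumr_ge0 => i _; exact: sqr_ge0.
apply: le_trans (ler_wpM2r (powR_ge0 _ _) (sign_sum_paley_zygmund c)) _.
rewrite -!mulrA ler_pM2l// -sum1_card natr_sum mulr_suml mulr_sumr.
rewrite [leLHS]big_mkcond/=; apply: ler_sum => s _; rewrite inE/=.
case: ifPn => [hs|_]; last by rewrite mulr_ge0 ?powR_ge0.
rewrite mul1r -(powR_sqr_half q (modulus_ge0 _)) -powRM ?sqr_ge0//.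
exact: le_powR.
Qed.

(** The affine majorant is taken at the scale [V], which is the mean of the squared modulus; its two
    terms then contribute equally, whence the constant 2. *)
Lemma khintchine_upper c q : 0 < q <= 2 ->
  \sum_s modulus (sign_sum c s) `^ q <=
  2 * N * (\sum_i modulus (c i) ^+ 2) `^ (q / 2).
Proof.
move=> /andP[q0 q2].
have h01 : 0 < q / 2 <= 1 by rewrite divr_gt0//= ler_pdivrMr// mul1r.
set V := \sum_i modulus (c i) ^+ 2.
have V0 : 0 <= V by apply: sumr_ge0 => i _; exact: sqr_ge0.
have := sum_modulus_sign_sum_sqr c; rewrite -/V => hV.
have [VE|Vn0] := eqVneq V 0.
  rewrite big1 ?mulr_ge0 ?powR_ge0// => s _.
  rewrite -(powR_sqr_half q (modulus_ge0 _)) (_ : _ ^+ 2 = 0) ?powR0//.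
    by rewrite gt_eqF// (andP h01).1.
  move/eqP : hV; rewrite VE mulr0 psumr_eq0 => [/allP/(_ s)|t _]; last exact: sqr_ge0.
  by rewrite mem_index_enum => /(_ isT)/eqP.
have {Vn0}V0 : 0 < V by rewrite lt_neqAle eq_sym Vn0.
have h s : modulus (sign_sum c s) `^ q <=
    V `^ (q / 2) * (1 + modulus (sign_sum c s) ^+ 2 / V).
  by rewrite -(powR_sqr_half q (modulus_ge0 _)) powR_le_affine// sqr_ge0.
apply: le_trans (ler_sum _ (fun s _ => h s)) _.
rewrite -mulr_sumr big_split/= -mulr_suml hV sumr_const -[_ *+ _]mulr_natr mul1r.
by rewrite -/(nsigns S) mulfK ?gt_eqF// mulrC mulr_natl mulr2n.
Qed.

End khintchine_powR.

(** * Radial truncation of scalars *)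

Section radial_truncation.
Context {R : realType} {k : scalar_kind} (M : R) (M0 : 0 < M).
Local Notation K := (scalars R k).
Implicit Types (z w : K).

(** The radial retraction onto the ball of radius [M]: the phase of [z] is kept. *)
Definition truncate z : K := of_real (M / Num.max M (modulus z)) * z.

Let den_gt0 z : 0 < Num.max M (modulus z).
Proof. by rewrite lt_max M0. Qed.

Let modulus_coef (z : K) : modulus (of_real (M / Num.max M (modulus z)) : K) = M / Num.max M (modulus z).
Proof. by rewrite modulus_of_real ger0_norm// divr_ge0 ?ltW. Qed.

Lemma truncate_le z : modulus (truncate z) <= M.
Proof.
rewrite modulusM modulus_coef -mulrA ler_piMr ?(ltW M0)//.
by rewrite mulrC ler_pdivrMr// mul1r le_max lexx orbT.
Qed.

Lemma truncate_id z : modulus z <= M -> truncate z = z.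
Proof.
move=> zM; rewrite /truncate max_l// divff ?gt_eqF//.
by rewrite (_ : of_real 1 = 1 :> K) ?mul1r// /of_real; case: (k).
Qed.

(** The factor attached to [z] is at most 1, and the change of factor, multiplied by the modulus of
    [w], is at most the change of modulus. Each contributes the distance of [z] and [w] once. *)
Lemma truncate_lipschitz z w : modulus (truncate z - truncate w) <= 2 * modulus (z - w).
Proof.
set mz := Num.max M (modulus z); set mw := Num.max M (modulus w).
have -> : truncate z - truncate w = of_real (M / mz) * (z - w) + of_real (M / mz - M / mw) * w.
  by rewrite /truncate raddfB/= -/mz -/mw; ring.
rewrite mulr_natl mulr2n (le_trans (modulusD _ _))// lerD//.
  rewrite modulusM modulus_coef ler_piMl ?modulus_ge0//.
  by rewrite ler_pdivrMr ?den_gt0// mul1r le_max lexx.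
rewrite modulusM modulus_of_real.
have -> : M / mz - M / mw = (M / mz) * ((mw - mz) / mw).
  by field; rewrite !gt_eqF ?den_gt0.
rewrite [X in X * _]normrM (@ger0_norm _ (M / mz)); last by rewrite divr_ge0// ltW// den_gt0.
rewrite [X in _ * X * _]normrM normfV (@ger0_norm _ mw) ?(ltW (den_gt0 _)) ?(ltW M0)//.
apply: le_trans (_ : 1 * (`|mw - mz| * 1) <= _).
  rewrite -mulrA ler_pM ?divr_ge0 ?mulr_ge0 ?invr_ge0 ?modulus_ge0 ?(ltW (den_gt0 _)) ?(ltW M0)//.
    by rewrite ler_pdivrMr ?den_gt0// mul1r le_max lexx.
  rewrite -mulrA ler_wpM2l// mulrC ler_pdivrMr ?den_gt0// mul1r.
  by rewrite le_max lexx orbT.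
rewrite mul1r mulr1; apply: le_trans (modulus_dist z w); rewrite distrC.
move: (modulus z) (modulus w) @mz @mw => a b /=.
have := ler_norm (a - b); have := ler_norm (b - a); rewrite (distrC b a).
rewrite distrC ler_norml; have [Ma|aM] := leP M a; have [Mb|bM] := leP M b; lra.
Qed.

End radial_truncation.

(** * Mixed-norm inequalities for finite matrices *)

Section mixed_norm_inequalities.
Context {R : realType} {F G : finType}.
Implicit Types (a : F -> R) (u y z : F -> G -> R).

(* Minkowski's inequality for l_p(l_2) into l_2(l_p), in linearized form: every
   t^p is estimated by the affine function of t^2 touching it at a scale which
   depends on j. *)
Lemma mixed_norm_l2 (p c M : R) a u : 0 < p <= 2 -> 0 < c -> 0 < M ->
  (forall j, 0 <= a j) -> (forall j i, 0 <= u j i) ->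
  (forall j, c * a j `^ p <= \sum_i u j i `^ p) ->
  \sum_i (\sum_j u j i ^+ 2) `^ (p / 2) <= M `^ p ->
  \sum_j a j ^+ 2 <= ((c / 2) `^ (p / 2)^-1)^-1 * M ^+ 2.
Proof.
move=> /andP[p0 p2] c0 M0 a0 u0 au uM.
have h0 : 0 < p / 2 by rewrite divr_gt0.
have h01 : 0 < p / 2 <= 1 by rewrite h0 ler_pdivrMr// mul1r.
pose V i := \sum_j u j i ^+ 2.
have V0 i : 0 <= V i by apply: sumr_ge0 => j _; exact: sqr_ge0.
set zeta := (c / 2) `^ _; have zeta0 : 0 < zeta by rewrite powR_gt0// divr_gt0.
have zetah : zeta `^ (p / 2) = c / 2 by rewrite powR_mulKV// divr_ge0// ltW.
(* [Z j] is the share of [sum_i V_i^(p/2)] credited to row [j], in proportion to [u_ji^2] within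
   each column; the shares add up to at most [M^p]. *)
pose Z j := \sum_i V i `^ (p / 2) * (u j i ^+ 2 / V i).
have aZ j : a j ^+ 2 <= zeta^-1 * (M ^+ 2 / M `^ p) * Z j.
  have Z0 : 0 <= Z j.
    by apply: sumr_ge0 => i _; rewrite mulr_ge0 ?powR_ge0// divr_ge0// sqr_ge0.
  have [->|aj0] := eqVneq (a j) 0.
    by rewrite expr0n !mulr_ge0 ?invr_ge0 ?powR_ge0 ?sqr_ge0// ltW.
  have {aj0}aj0 : 0 < a j by rewrite lt_neqAle eq_sym aj0 a0.
  (* With this scale the constant terms of the affine majorants use up at most half of the lower
     bound [c a_j^p]; the other half bounds [Z j] from below. *)
  pose sigma := zeta * (a j / M) ^+ 2.
  have sigma0 : 0 < sigma by rewrite mulr_gt0// exprn_gt0// divr_gt0.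
  have sigmah : sigma `^ (p / 2) = c / 2 * (a j `^ p / M `^ p).
    rewrite powRM ?sqr_ge0 ?(ltW zeta0)// zetah powR_sqr_half ?divr_ge0 ?(ltW M0)//.
    rewrite powRM ?invr_ge0 ?(ltW M0)//; congr (_ * (_ * _)).
    by rewrite -[M^-1]powR_inv1 ?(ltW M0)// -powRrM mulN1r powRN.
  have Mp0 : 0 < M `^ p by exact: powR_gt0.
  have ap0 : 0 < a j `^ p by exact: powR_gt0.
  have h i : u j i `^ p <= sigma `^ (p / 2) * V i `^ (p / 2) +
      (sigma `^ (p / 2) / sigma) * (V i `^ (p / 2) * (u j i ^+ 2 / V i)).
    rewrite -powR_sqr_half//; have [Vi0|Vi0] := eqVneq (V i) 0.
      suff -> : u j i = 0 by rewrite expr0n/= powR0 ?gt_eqF// mul0r !mulr0 addr0 mulr_ge0 ?powR_ge0.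
      apply/eqP; rewrite -sqrf_eq0; move/eqP : Vi0.
      by rewrite psumr_eq0 => [/allP/(_ j)|? _]; rewrite ?sqr_ge0// mem_index_enum => /(_ isT).
    have {}Vi0 : 0 < V i by rewrite lt_neqAle eq_sym Vi0 V0.
    have := powR_le_affine h01 (sqr_ge0 (u j i)) (mulr_gt0 sigma0 Vi0).
    rewrite [(sigma * _) `^ _]powRM ?(ltW sigma0)// => /le_trans; apply; rewrite le_eqVlt; apply/orP; left; apply/eqP.
    by field; rewrite !gt_eqF.
  have := le_trans (au j) (ler_sum _ (fun i _ => h i)).
  rewrite big_split/= -!mulr_sumr -/(Z j).
  have : sigma `^ (p / 2) * \sum_i V i `^ (p / 2) <= c / 2 * a j `^ p.
    rewrite sigmah -mulrA ler_pM2l ?divr_gt0// -mulrA -[leRHS]mulr1 ler_pM2l//.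
    by rewrite mulrC ler_pdivrMr// mul1r.
  move=> h1 h2.
  have h3 : c / 2 * a j `^ p <= (sigma `^ (p / 2) / sigma) * Z j by lra.
  have c20 : 0 < c / 2 by rewrite divr_gt0.
  have {}h3 : 1 <= Z j / (M `^ p * sigma).
    rewrite -(ler_pM2l ap0) mulr1 -(ler_pM2l c20) (le_trans h3)// sigmah.
    by rewrite le_eqVlt; apply/orP; left; apply/eqP; field; rewrite !gt_eqF.
  rewrite -[leLHS]mulr1 (le_trans (ler_wpM2l (sqr_ge0 _) h3))//.
  rewrite le_eqVlt; apply/orP; left; apply/eqP.
  by rewrite /sigma; field; rewrite !gt_eqF.
apply: le_trans (ler_sum _ (fun j _ => aZ j)) _.
rewrite -mulr_sumr -mulrA ler_wpM2l ?invr_ge0 ?(ltW zeta0)//.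
rewrite -mulrA ler_piMr ?sqr_ge0// mulrC ler_pdivrMr ?powR_gt0// mul1r.
apply: le_trans uM; rewrite exchange_big/=; apply: ler_sum => i _.
rewrite -mulr_sumr -mulr_suml -/(V i) ler_piMr ?powR_ge0//.
by have [->|Vi0] := eqVneq (V i) 0; rewrite ?mul0r// divff.
Qed.

(** The terms with small [z] are absorbed by [c]; for the others [y z] is at most a multiple of
    [y^p z^(2-p)]. After [(a y)^p] is written through [((a y)^2 / V)^(p/2)], a weighted mean
    inequality separates a share of [V] from [z^2], and both have bounded sums over [j]. *)
Lemma mixed_norm_lp (p c B : R) a y z : 0 < p <= 1 -> 0 < c -> 1 <= B ->
  (forall j, 0 <= a j) -> (forall j i, 0 <= y j i <= B) -> (forall j i, 0 <= z j i) ->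
  (forall j, \sum_i y j i `^ p <= B) -> (forall j, c <= \sum_i y j i * z j i) ->
  (forall i, \sum_j z j i ^+ 2 <= B) ->
  \sum_j a j `^ p <= (2 / c) * B * (c / (2 * B ^+ 2)) `^ (p - 1) * (1 + B) *
    \sum_i (\sum_j (a j * y j i) ^+ 2) `^ (p / 2).
Proof.
move=> /andP[p0 p1] c0 B1 a0 y0 z0 yB cyz zB.
have B0 : 0 < B by apply: lt_le_trans B1.
have h01 : 0 < p / 2 < 1 by rewrite divr_gt0//= ltr_pdivrMr// mul1r (le_lt_trans p1)// ltr1n.
(* Threshold between small and large [z]: the small ones contribute at most
   [B * eta * B = c / 2]. *)
set eta := c / _; have eta0 : 0 < eta by rewrite divr_gt0// mulr_gt0// exprn_gt0.
pose V i := \sum_j (a j * y j i) ^+ 2.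
have V0 i : 0 <= V i by apply: sumr_ge0 => j _; exact: sqr_ge0.
have yz j i : y j i * z j i <= B * eta * y j i `^ p + B * eta `^ (p - 1) * (y j i `^ p * z j i `^ (2 - p)).
  have /andP[yji0 yjiB] := y0 j i.
  have yp : y j i <= B * y j i `^ p.
    have [->|yn0] := eqVneq (y j i) 0; first by rewrite mulr_ge0 ?powR_ge0 ?ltW.
    have yE : y j i = y j i `^ (1 - p) * y j i `^ p.
      by rewrite -powRD ?subrK ?powRr1// yn0 implybT.
    rewrite [leLHS]yE ler_wpM2r ?powR_ge0//.
    have := le_powR (_ : 0 <= 1 - p) yji0 yjiB; rewrite subr_ge0 => /(_ p1)/le_trans; apply.
    by rewrite ler1_powR// gerBl ltW.
  have zeta : z j i <= eta + eta `^ (p - 1) * z j i `^ (2 - p).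
    have [zeta|/ltW etaz] := leP (z j i) eta.
      by rewrite (le_trans zeta)// lerDl mulr_ge0 ?powR_ge0.
    have zz0 : 0 < z j i by apply: lt_le_trans etaz.
    apply: (@le_trans _ _ (eta `^ (p - 1) * z j i `^ (2 - p))); last by rewrite lerDr ltW.
    rewrite (_ : 2 - p = 1 + (1 - p)); last by ring.
    have -> : z j i `^ (1 + (1 - p)) = z j i * z j i `^ (1 - p).
      by rewrite powRD ?powRr1// (gt_eqF zz0) implybT.
    rewrite mulrCA ler_peMr//.
    rewrite (_ : p - 1 = - (1 - p)); last by rewrite opprB.
    rewrite powRN mulrC ler_pdivlMr ?powR_gt0// mul1r.
    by rewrite le_powR// ?subr_ge0// ltW.
  apply: le_trans (ler_wpM2r (z0 j i) yp) _.
  apply: le_trans (ler_wpM2l _ zeta) _; first by rewrite mulr_ge0 ?powR_ge0 ?ltW.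
  by rewrite le_eqVlt; apply/orP; left; apply/eqP; ring.
have cQ j : c / 2 <= B * eta `^ (p - 1) * \sum_i y j i `^ p * z j i `^ (2 - p).
  have := le_trans (cyz j) (ler_sum _ (fun i _ => yz j i)).
  rewrite big_split/= -!mulr_sumr.
  have : B * eta * \sum_i y j i `^ p <= c / 2.
    apply: le_trans (ler_wpM2l _ (yB j)) _; first by rewrite mulr_ge0 ?(ltW B0) ?(ltW eta0).
    by rewrite le_eqVlt; apply/orP; left; apply/eqP; rewrite /eta; field; rewrite gt_eqF.
  lra.
have aQ j : a j `^ p <= (2 / c) * B * eta `^ (p - 1) *
    \sum_i V i `^ (p / 2) * ((a j * y j i) ^+ 2 / V i + z j i ^+ 2).
  have -> : a j `^ p = (2 / c) * (a j `^ p * (c / 2)) by field; rewrite gt_eqF.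
  rewrite -!mulrA ler_pM2l// ler_pM2l ?invr_gt0//.
  apply: le_trans (ler_wpM2l (powR_ge0 _ _) (cQ j)) _.
  rewrite mulrCA -!mulrA ler_pM2l// ler_pM2l ?powR_gt0//.
  rewrite mulr_sumr; apply: ler_sum => i _.
  have /andP[yji0 _] := y0 j i.
  rewrite mulrA -powRM// -powR_sqr_half ?mulr_ge0//.
  have [Vi0|Vi0] := eqVneq (V i) 0.
    suff -> : a j * y j i = 0.
      by rewrite expr0n/= powR0 ?gt_eqF// ?divr_gt0// mul0r mulr_ge0 ?powR_ge0// mul0r add0r sqr_ge0.
    apply/eqP; rewrite -sqrf_eq0; move/eqP : Vi0.
    by rewrite psumr_eq0 => [/allP/(_ j)|? _]; rewrite ?sqr_ge0// mem_index_enum => /(_ isT).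
  have {}Vi0 : 0 < V i by rewrite lt_neqAle eq_sym Vi0 V0.
  rewrite -{1}[_ ^+ 2](divfK (lt0r_neq0 Vi0)) powRM ?divr_ge0 ?sqr_ge0//.
  rewrite [_ * V i `^ _]mulrC -mulrA ler_pM2l ?powR_gt0//.
  have -> : z j i `^ (2 - p) = (z j i ^+ 2) `^ (1 - p / 2).
    rewrite -(powR_sqr_half (2 - p) (z0 j i)); congr (_ `^ _); by field.
  by apply: powR_mul_le_add => //; rewrite ?divr_ge0 ?sqr_ge0.
apply: le_trans (ler_sum _ (fun j _ => aQ j)) _.
rewrite -mulr_sumr -!mulrA; do 2 rewrite ler_wpM2l ?invr_ge0 ?(ltW c0)//.
rewrite ler_wpM2l ?(ltW B0)// ler_wpM2l ?powR_ge0//.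
rewrite exchange_big/= mulr_sumr; apply: ler_sum => i _.
rewrite -mulr_sumr mulrC ler_wpM2r ?powR_ge0// big_split/= lerD//.
rewrite -mulr_suml -/(V i).
by have [->|Vi0] := eqVneq (V i) 0; rewrite ?mul0r// divff.
Qed.

End mixed_norm_inequalities.

(** * Unconditional bases of quasi-Banach spaces *)

Section quasi_norm.
Context {R : realType} {k : scalar_kind} {X : quasiBanachType R k}.
Local Notation K := (scalars R k).
Implicit Types (f g : X) (kappa : R).

Lemma qnorm0 : qnorm (0 : X) = 0.
Proof. by rewrite -(scale0r (0 : X)) qnormZ modulus0 mul0r. Qed.

Lemma qnormN f : qnorm (- f) = qnorm f.
Proof. by rewrite -scaleN1r qnormZ modulusN modulus1 mul1r. Qed.

Lemma qnormC f g : qnorm (f - g) = qnorm (g - f).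
Proof. by rewrite -qnormN opprB. Qed.

Definition quasi_triangle kappa :=
  1 <= kappa /\ forall f g, qnorm (f + g) <= kappa * (qnorm f + qnorm g).

Lemma quasi_triangleP : exists kappa, quasi_triangle kappa.
Proof. by have [kappa k1 kD] := @qnormD R k X; exists kappa. Qed.

Lemma qnormB_le kappa f g : quasi_triangle kappa ->
  qnorm (f - g) <= kappa * (qnorm f + qnorm g).
Proof. by move=> [_ kD]; rewrite (le_trans (kD _ _))// qnormN. Qed.

Lemma qnorm_dist_le kappa f g h : quasi_triangle kappa ->
  qnorm (f - h) <= kappa * (qnorm (f - g) + qnorm (g - h)).
Proof. by move=> [_ kD]; rewrite (le_trans _ (kD _ _))// addrA subrK. Qed.

Lemma qnorm_sum_le kappa (S : Type) (r : seq S) (P : pred S) (v : S -> X) :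
  quasi_triangle kappa ->
  qnorm (\sum_(i <- r | P i) v i) <= kappa ^+ size r * \sum_(i <- r | P i) qnorm (v i).
Proof.
move=> [k1 kD]; have k0 : 0 <= kappa by lra.
elim: r => [|i r IH]; first by rewrite !big_nil qnorm0 mulr0.
have s0 : 0 <= \sum_(i0 <- r | P i0) qnorm (v i0) by apply: sumr_ge0 => *; exact: qnorm_ge0.
rewrite !big_cons /=; case: (P i).
  rewrite (le_trans (kD _ _))// exprS -mulrA ler_wpM2l// mulrDr lerD//.
  by rewrite ler_peMl ?qnorm_ge0// exprn_ege1.
by rewrite (le_trans IH)// exprS -mulrA ler_peMl// mulr_ge0// exprn_ge0.
Qed.

(** In a quasi-norm every further summand costs a factor [kappa]; the ratio [1 / (2 * kappa)] of the
    bounds pays for it and leaves a geometric series of ratio one half. *)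
Lemma qnorm_geometric_sum kappa (g : nat -> X) (rho : nat -> R) :
  quasi_triangle kappa -> (forall n, qnorm (g n) <= rho n) ->
  (forall n, rho n.+1 <= rho n / (2 * kappa)) ->
  forall n d, qnorm (\sum_(n <= i < n + d) g i) <= 2 * kappa * rho n.
Proof.
move=> [k1 kD] gr rhoS n d; have k0 : 0 < kappa by lra.
have rho0 m : 0 <= rho m := le_trans (qnorm_ge0 _) (gr m).
elim: d n => [|d IH] n.
  by rewrite addn0 big_geq// qnorm0 mulr_ge0// mulr_ge0// ltW.
rewrite big_ltn; last by rewrite addnS ltnS leq_addr.
rewrite -addSnnS.
apply: le_trans (kD _ _) _.
have := rhoS n; rewrite ler_pdivlMr ?mulr_gt0//.
move: (IH n.+1) (gr n) => h1 h2 h3.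
rewrite [leRHS](_ : 2 * kappa * rho n = kappa * (2 * rho n)); last by ring.
rewrite ler_pM2l//.
by move: h1 h2; set s := qnorm _; set t := qnorm _; lra.
Qed.

Lemma geometric_small (rho : nat -> R) kappa : 1 <= kappa -> 0 <= rho 0%N ->
  (forall n, rho n.+1 <= rho n / (2 * kappa)) -> (forall n, 0 <= rho n) ->
  forall e, 0 < e -> exists N, forall n, (N <= n)%N -> rho n < e.
Proof.
move=> k1 r0 rS rho0 e e0.
have h n : rho n <= rho 0%N / (2 ^+ n).
  elim: n => [|n IH]; first by rewrite expr0 divr1.
  apply: le_trans (rS n) _; rewrite ler_pdivrMr; last lra.
  apply: le_trans IH _; have -> : rho 0%N / 2 ^+ n.+1 * (2 * kappa) = rho 0%N / 2 ^+ n * kappa.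
    by rewrite exprS; field; rewrite expf_neq0// pnatr_eq0.
  by rewrite ler_peMr// divr_ge0// exprn_ge0.
have [N hN] : exists N : nat, rho 0%N / e < N%:R.
  by exists (Num.bound (rho 0%N / e)); apply: archi_boundP; rewrite divr_ge0// ltW.
exists N => n Nn; apply: le_lt_trans (h n) _.
rewrite ltr_pdivrMr ?exprn_gt0// mulrC -ltr_pdivrMr// (lt_le_trans hN)//.
by rewrite -natrX ler_nat (leq_trans Nn)// ltnW// ltn_expl.
Qed.

Lemma quasi_Banach_series kappa (g : nat -> X) (rho : nat -> R) :
  quasi_triangle kappa -> (forall n, qnorm (g n) <= rho n) ->
  (forall n, rho n.+1 <= rho n / (2 * kappa)) ->
  exists l, forall n, qnorm (l - \sum_(0 <= i < n) g i) <= 2 * kappa ^+ 2 * rho n.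
Proof.
move=> kq gr rS; have [k1 kD] := kq; have k0 : 0 < kappa by lra.
have rho0 m : 0 <= rho m := le_trans (qnorm_ge0 _) (gr m).
have small := geometric_small k1 (rho0 _) rS rho0.
have diff m n : (n <= m)%N ->
    qnorm (\sum_(0 <= i < m) g i - \sum_(0 <= i < n) g i) <= 2 * kappa * rho n.
  move=> nm; rewrite (big_cat_nat (leq0n n) nm)//= addrAC subrr add0r.
  by rewrite -(subnKC nm); exact: qnorm_geometric_sum.
have [e e0|l hl] := @qnorm_complete R k X (fun n => \sum_(0 <= i < n) g i).
  have e2 : 0 < e / (2 * kappa) by rewrite divr_gt0 ?mulr_gt0.
  have [N hN] := small _ e2.
  have hlt n : (N <= n)%N -> 2 * kappa * rho n < e.
    by move=> /hN; rewrite ltr_pdivlMr ?mulr_gt0// mulrC.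
  exists N => m n Nm Nn; have [mn|/ltnW nm] := leqP m n.
    by rewrite qnormC (le_lt_trans (diff _ _ mn))// hlt.
  by rewrite (le_lt_trans (diff _ _ nm))// hlt.
exists l => n; apply/ler_addgt0Pr => e e0.
have ek0 : 0 < e / kappa by rewrite divr_gt0.
have /cvgrPdist_lt/(_ _ ek0)[M _ hM] := hl.
have := hM (maxn M n) (leq_maxl _ _); rewrite /= sub0r normrN ger0_norm ?qnorm_ge0// => hm.
apply: le_trans (qnorm_dist_le _ (\sum_(0 <= i < maxn M n) g i) _ kq) _.
rewrite qnormC; have := diff _ _ (leq_maxr M n); rewrite -(ler_pM2l k0) => hd.
by move: hm; rewrite ltr_pdivlMr// mulrDr; lra.
Qed.

Lemma partial_sum_small (J : choiceType) (x : J -> X) (F : {fset J}) (e : R) : 0 < e ->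
  exists2 d, 0 < d & forall a : J -> K, (forall j, modulus (a j) <= d) ->
    qnorm (partial_sum (fun j => a j *: x j) F) <= e.
Proof.
move=> e0; have [kappa kq] := quasi_triangleP; have k1 := kq.1.
set r := index_enum F.
pose B := kappa ^+ size r * \sum_(j <- r) qnorm (x (val j)).
have B0 : 0 <= B.
  by rewrite mulr_ge0 ?exprn_ge0//; [lra|apply: sumr_ge0 => *; exact: qnorm_ge0].
exists (e / (B + 1)); first by rewrite divr_gt0// ltr_wpDl.
move=> a ad; apply: le_trans (qnorm_sum_le _ _ _ kq) _.
apply: (@le_trans _ _ (B * (e / (B + 1)))).
  rewrite -/r /B -mulrA ler_wpM2l ?exprn_ge0//; first lra.
  rewrite mulr_suml; apply: ler_sum => j _.
  by rewrite qnormZ mulrC ler_wpM2l ?qnorm_ge0.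
by rewrite mulrCA ler_piMr ?(ltW e0)// ler_pdivrMr ?mul1r ?lerDl// ltr_wpDl.
Qed.

End quasi_norm.

(** * Boundedness of the coordinate projections of an unconditional basis *)

Section basis_coordinates.
Context {R : realType} {k : scalar_kind} {X : quasiBanachType R k} {J : countType}.
Local Notation K := (scalars R k).
Implicit Types (x : J -> X) (c : X -> J -> K) (f g : X) (F : {fset J}).

Definition lcomb x (a : J -> K) F : X := partial_sum (fun j => a j *: x j) F.

Lemma lcombD x (a : J -> K) (b : J -> K) F (t : K) :
  lcomb x (fun j => t * a j + b j) F = t *: lcomb x a F + lcomb x b F.
Proof.
rewrite /lcomb /partial_sum scaler_sumr -big_split/=; apply: eq_bigr => j _.
by rewrite scalerDl scalerA.
Qed.

Lemma lcombB x (a : J -> K) (b : J -> K) F :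
  lcomb x (fun j => a j - b j) F = lcomb x a F - lcomb x b F.
Proof.
rewrite /lcomb /partial_sum -sumrB; apply: eq_bigr => j _.
by rewrite scalerBl.
Qed.

Lemma lcombU x (a : J -> K) F G : [disjoint F & G]%fset ->
  lcomb x a (F `|` G)%fset = lcomb x a F + lcomb x a G.
Proof.
move=> FG; rewrite /lcomb /partial_sum -!(big_seq_fsetE _ _ predT (fun j => a j *: x j))/=.
rewrite -big_cat/=; apply: perm_big; apply: uniq_perm; rewrite ?fset_uniq//.
  rewrite cat_uniq !fset_uniq/= andbT; apply/hasPn => j jG.
  by apply: contraTN jG => jF; exact: (fdisjointP FG).
by move=> j; rewrite mem_cat inE.
Qed.

Lemma unconditional_sumP (v : J -> X) f :
  unconditional_sum v f <-> forall e : R, 0 < e -> exists F0 : {fset J},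
    forall F : {fset J}, (F0 `<=` F)%fset -> qnorm (partial_sum v F - f) < e.
Proof.
have tF : Filter (@totally J) by apply: (filter_filter (ProperFilter := totally_filter)).
split=> [/cvgrPdist_lt h e e0|h].
  have [F0 _ hF0] := h e e0.
  by exists F0 => F /hF0 /=; rewrite sub0r normrN ger0_norm// qnorm_ge0.
apply/cvgrPdist_lt => e e0; have [F0 hF0] := h e e0; exists F0 => // F /hF0 /=.
by rewrite sub0r normrN ger0_norm// qnorm_ge0.
Qed.

(** The form in which unconditional bases are used later. The constant [D] bounds the projections
    onto all finite sets of coordinates at once, which is the quantitative content of
    unconditionality. *)
Record basis_coords x c (D : R) : Prop := BasisCoords {
  coords_linear : forall a f g j, c (a *: f + g) j = a * c f j + c g j ;
  coords_dual : forall i j, c (x i) j = (i == j)%:R ;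
  coords_bound_ge1 : 1 <= D ;
  coords_bounded : forall F f, qnorm (lcomb x (c f) F) <= D * qnorm f ;
  coords_cvg : forall f (e : R), 0 < e -> exists F0 : {fset J},
    forall F, (F0 `<=` F)%fset -> qnorm (lcomb x (c f) F - f) < e }.

Section coords_of_basis.
Context (x : J -> X) (xb : unconditional_basis x).

Context (c : X -> J -> K) (hc : forall f, unconditional_sum (fun j => c f j *: x j) f).

Let uniq f (a : J -> K) : unconditional_sum (fun j => a j *: x j) f -> c f = a.
Proof.
by move=> ha; have [b [_ hb]] := xb f; rewrite -(hb _ ha) -(hb _ (hc f)).
Qed.

Let cvg f (e : R) : 0 < e -> exists F0 : {fset J},
  forall F, (F0 `<=` F)%fset -> qnorm (lcomb x (c f) F - f) < e.
Proof. by move: e; exact/unconditional_sumP. Qed.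

Let linear a f g j : c (a *: f + g) j = a * c f j + c g j.
Proof.
suff -> : c (a *: f + g) = fun j => a * c f j + c g j by [].
apply/uniq/unconditional_sumP => e e0.
have [kappa kq] := @quasi_triangleP R k X; have k1 := kq.1.
have d0 : 0 < e / kappa / 2 by rewrite !divr_gt0//; lra.
have ma : 0 < modulus a + 1 by rewrite ltr_wpDl ?modulus_ge0.
have [F1 h1] := cvg f (divr_gt0 d0 ma); have [F2 h2] := cvg g d0.
exists (F1 `|` F2)%fset => F; rewrite fsubUset => /andP[/h1 {}h1 /h2 {}h2].
rewrite -/(lcomb x (fun j => a * c f j + c g j) F) lcombD opprD addrACA -scalerBr.
apply: le_lt_trans (kq.2 _ _) _; rewrite qnormZ mulrC -ltr_pdivlMr; last lra.
have : modulus a * qnorm (lcomb x (c f) F - f) <= e / kappa / 2.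
  rewrite ltr_pdivlMr// in h1; apply: le_trans (ltW h1).
  by rewrite mulrC ler_wpM2l ?qnorm_ge0// lerDl.
lra.
Qed.

Let dual i j : c (x i) j = (i == j)%:R.
Proof.
rewrite (uniq (a := fun j => (i == j)%:R))//; apply/unconditional_sumP => e e0.
exists [fset i]%fset => F; rewrite fsub1set => iF.
rewrite /partial_sum (bigD1 [` iF]%fset)//= eqxx scale1r big1 ?addr0 ?subrr ?qnorm0// => j' ij.
by rewrite (_ : (i == _) = false) ?scale0r//; apply: contraNF ij => /eqP e'; apply/eqP/val_inj; rewrite /= e'.
Qed.

(** Sublevel sets of the supremum over [F] of the norms of the projections of [f]; this supremum
    will be shown to be bounded by a multiple of [qnorm]. *)
Let bnd f (t : R) := forall F, qnorm (lcomb x (c f) F) <= t.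

Let bndW f t s : bnd f t -> t <= s -> bnd f s.
Proof. by move=> ft ts F; exact: le_trans (ft F) ts. Qed.

Let c0 j : c 0 j = 0.
Proof. by have := linear (-1) 0 0 j; rewrite scaler0 addr0 mulN1r addNr. Qed.

Let cZ a f j : c (a *: f) j = a * c f j.
Proof. by rewrite -[a *: f]addr0 linear c0 addr0. Qed.

Let cB f g j : c (f - g) j = c f j - c g j.
Proof. by rewrite addrC -scaleN1r linear mulN1r addrC. Qed.

Let c_sum (g : nat -> X) m n j : c (\sum_(m <= i < n) g i) j = \sum_(m <= i < n) c (g i) j.
Proof.
apply: (big_morph (fun f => c f j)) => // f g'.
by rewrite -[f]scale1r linear mul1r scale1r.
Qed.

Let lcomb_sum (g : nat -> X) m n F :
  lcomb x (c (\sum_(m <= i < n) g i)) F = \sum_(m <= i < n) lcomb x (c (g i)) F.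
Proof.
rewrite /lcomb /partial_sum exchange_big/=; apply: eq_bigr => j _.
by rewrite c_sum scaler_suml.
Qed.

Let bnd_ex f : exists t, bnd f t.
Proof.
have [kappa kq] := @quasi_triangleP R k X; have k1 := kq.1.
have [F0 hF0] := cvg f (@ltr01 R).
pose B := \big[Num.max/0]_(E <- fpowerset F0) qnorm (lcomb x (c f) E).
have hB E : (E `<=` F0)%fset -> qnorm (lcomb x (c f) E) <= B.
  by move=> EF; rewrite /B; apply: (le_bigmax_seq 0 E predT (fun E => qnorm (lcomb x (c f) E))) => //; rewrite fpowersetE.
exists (kappa * (kappa * (1 + qnorm f) + B)) => G.
(* The first set contains [F0], so the corresponding sum is close to [f]; the second is one of the
   finitely many subsets of [F0]. *)
have -> : lcomb x (c f) G = lcomb x (c f) (G `|` F0)%fset - lcomb x (c f) (F0 `\` G)%fset.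
  have -> : (G `|` F0 = G `|` (F0 `\` G))%fset.
    by apply/fsetP => j; rewrite !inE; case: (j \in G).
  rewrite lcombU ?addrK//; apply/fdisjointP => j jG; by rewrite !inE jG.
apply: le_trans (qnormB_le _ _ kq) _; rewrite ler_wpM2l//; first lra.
rewrite lerD//; last by rewrite hB// fsubDset fsubsetUr.
have := hF0 (G `|` F0)%fset (fsubsetUr _ _) => h.
rewrite -[X in qnorm X](subrK f); apply: le_trans (kq.2 _ _) _.
by rewrite ler_wpM2l//; [lra|rewrite lerD// ltW].
Qed.

(* Baire's argument: otherwise a sequence of shrinking balls avoids every set
   [bnd _ n], and so does its limit. *)
Let bnd_somewhere_dense : exists (n : nat) (f0 : X) (rho : R), 0 < rho /\
  forall g, qnorm g < rho -> forall e, 0 < e -> exists2 a, bnd a n%:R & qnorm (f0 + g - a) < e.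
Proof.
apply: contrapT => hn.
have step (n : nat) (f0 : X) (rho : R) : exists ge : X * R, 0 < rho ->
    [/\ qnorm ge.1 <= rho, 0 < ge.2 & forall a, bnd a n%:R -> ge.2 <= qnorm (f0 + ge.1 - a)].
  have [rho0|] := ltP 0 rho; last by move=> ?; exists (0, 0); lra.
  apply: contrapT => h; apply: hn; exists n, f0, rho; split => // g grho e e0.
  apply: contrapT => hg; apply: h; exists (g, e) => _; split => //; first exact: ltW.
  by move=> a an; rewrite leNgt; apply/negP => ha; apply: hg; exists a.
have [kappa kq] := @quasi_triangleP R k X; have k1 := kq.1; have k0 : 0 < kappa by lra.
have /choice[st hst] : forall p : nat * X * R, exists ge : X * R, 0 < p.2 ->
    [/\ qnorm ge.1 <= p.2, 0 < ge.2 & forall a, bnd a p.1.1%:R -> ge.2 <= qnorm (p.1.2 + ge.1 - a)].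
  by move=> [[n f0] rho]; exact: step.
(* The first bound makes the corrections summable. By the second, the limit stays closer to the new
   centre than the gap between this centre and the [n]-th set. *)
pose next (p : nat * X * R) : nat * X * R :=
  (p.1.1.+1, p.1.2 + (st p).1, Num.min (p.2 / (2 * kappa)) ((st p).2 / (4 * kappa ^+ 2))).
pose s n := iter n next (0%N, 0, 1).
have sn n : (s n).1.1 = n by elim: n => //= n ->.
have s0 n : 0 < (s n).2.
  elim: n => [|n IH]; first exact: ltr01.
  have [_ h _] := hst _ IH.
  by rewrite /= lt_min !divr_gt0 ?mulr_gt0 ?exprn_gt0.
pose g n := (st (s n)).1.
have sg n : (s n).1.2 = \sum_(0 <= i < n) g i.
  elim: n => [|n IH]; first by rewrite big_geq.
  by rewrite big_nat_recr//= -IH.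
have grho n : qnorm (g n) <= (s n).2 by have [] := hst _ (s0 n).
have rhoS n : (s n.+1).2 <= (s n).2 / (2 * kappa) by rewrite /= ge_min lexx.
have [l hl] := quasi_Banach_series kq grho rhoS.
have [t ht] := bnd_ex l.
pose n := Num.bound `|t|.
have tn : bnd l n%:R.
  by apply: bndW ht _; rewrite (le_trans (ler_norm _))// ltW// archi_boundP.
have [_ e0 he] := hst _ (s0 n).
have := he l; rewrite sn => /(_ tn).
rewrite (_ : (s n).1.2 + _ = \sum_(0 <= i < n.+1) g i); last by rewrite -sg.
rewrite qnormC => h.
have := le_trans h (hl n.+1); rewrite leNgt => /negP; apply.
rewrite mulrC -ltr_pdivlMr ?mulr_gt0 ?exprn_gt0//.
apply: (@le_lt_trans _ _ ((st (s n)).2 / (4 * kappa ^+ 2))); first by rewrite /= ge_min lexx orbT.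
rewrite ltr_pM2l// ltf_pV2 ?posrE ?mulr_gt0 ?exprn_gt0// ltr_pM2r ?exprn_gt0//; lra.
Qed.

(** The ball provided by Baire's argument is moved to the origin by subtracting approximants of
    [f0 + t g] and of [f0]; homogeneity then removes its radius. *)
Let bnd_dense : exists2 M : R, 0 < M &
  forall g (e : R), 0 < e -> exists2 a, bnd a (M * qnorm g) & qnorm (g - a) < e.
Proof.
have [n [f0 [rho [rho0 dense]]]] := bnd_somewhere_dense.
have [kappa kq] := @quasi_triangleP R k X; have k1 := kq.1; have k0 : 0 < kappa by lra.
exists (4 * kappa * (n%:R + 1) / rho).
  by rewrite divr_gt0// !mulr_gt0// ltr_wpDl.
move=> g e e0; have [g0|g0] := eqVneq (qnorm g) 0.
  rewrite g0 mulr0 (qnorm_eq0 _ g0); exists 0; last by rewrite subrr qnorm0.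
  move=> F; rewrite /lcomb /partial_sum big1 ?qnorm0// => j _.
  by rewrite c0 scale0r.
have {}g0 : 0 < qnorm g by rewrite lt_neqAle eq_sym g0 qnorm_ge0.
pose t := rho / (2 * qnorm g); have t0 : 0 < t by rewrite divr_gt0// mulr_gt0.
have mt : modulus (of_real t : K) = t by rewrite modulus_of_real ger0_norm// ltW.
have d0 : 0 < e * t / (2 * kappa) by apply: divr_gt0; apply: mulr_gt0.
have tg : qnorm (of_real t *: g) < rho.
  rewrite qnormZ mt /t invfM mulrA mulfVK ?gt_eqF//; lra.
have [a1 a1n ha1] := dense _ tg _ d0.
have z0 : qnorm (0 : X) < rho by rewrite qnorm0.
have [a0 a0n ha0] := dense _ z0 _ d0.
have mtV : modulus ((of_real t)^-1 : K) = t^-1.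
  have ot0 : of_real t != 0 :> K.
    by apply: contraTneq t0 => ot; rewrite -mt ot modulus0 ltxx.
  by apply: (mulfI (lt0r_neq0 t0)); rewrite -{1}mt -modulusM !mulfV ?modulus1// gt_eqF.
have otK : (of_real t)^-1 *: (of_real t *: g) = g.
  rewrite scalerA mulVf ?scale1r//.
  by apply: contraTneq t0 => ot; rewrite -mt ot modulus0 ltxx.
exists ((of_real t)^-1 *: (a1 - a0)).
  move=> F.
  have -> : lcomb x (c ((of_real t)^-1 *: (a1 - a0))) F =
      (of_real t)^-1 *: (lcomb x (c a1) F - lcomb x (c a0) F).
    rewrite -lcombB /lcomb /partial_sum scaler_sumr; apply: eq_bigr => j _.
    by rewrite cZ cB scalerA.
  rewrite qnormZ mtV mulrC ler_pdivrMr//.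
  apply: le_trans (qnormB_le _ _ kq) _.
  apply: (@le_trans _ _ (kappa * (n%:R + n%:R))).
    by rewrite ler_wpM2l ?lerD ?(ltW k0).
  rewrite (_ : _ * _ * t = 2 * kappa * (n%:R + 1)); last first.
    by rewrite /t; field; rewrite !gt_eqF.
  rewrite [leRHS](_ : _ = kappa * (2 * (n%:R + 1))); last by ring.
  by rewrite ler_pM2l//; lra.
rewrite -{1}otK -scalerBr qnormZ mtV mulrC ltr_pdivrMr//.
rewrite (_ : _ - _ = (f0 + of_real t *: g - a1) - (f0 + 0 - a0)); last first.
  by rewrite addr0 !opprB [RHS]addrC -!addrA addKr addrCA.
apply: le_lt_trans (qnormB_le _ _ kq) _.
rewrite mulrC -ltr_pdivlMr//.
have : e * t / kappa = e * t / (2 * kappa) + e * t / (2 * kappa).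
  by field; rewrite gt_eqF.
lra.
Qed.

(** As in the open mapping theorem, [f] is written as a series of approximants with geometrically
    decreasing residuals. Their coefficients add up to some [b], since the scalars are complete;
    uniqueness of expansions, in place of a closed graph argument, identifies [b] with [c f]. *)
Let bnd_qnorm : exists2 C : R, 0 <= C & forall f, bnd f (C * qnorm f).
Proof.
have [M M0 dense] := bnd_dense.
have [kappa kq] := @quasi_triangleP R k X; have k1 := kq.1; have k0 : 0 < kappa by lra.
exists (2 * kappa ^+ 2 * M); first by rewrite !mulr_ge0// ?exprn_ge0// ltW.
move=> f; have [f0|f0] := eqVneq (qnorm f) 0.
  rewrite f0 mulr0 (qnorm_eq0 _ f0) => F.
  rewrite /lcomb /partial_sum big1 ?qnorm0// => j _; by rewrite c0 scale0r.
have {}f0 : 0 < qnorm f by rewrite lt_neqAle eq_sym f0 qnorm_ge0.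
have k20 : 0 < 2 * kappa by rewrite mulr_gt0.
pose del n := qnorm f / (2 * kappa) ^+ n.
have del0 n : 0 < del n by rewrite divr_gt0// exprn_gt0.
have /choice[ap hap] : forall p : X * nat, exists a, bnd a (M * qnorm p.1) /\
    qnorm (p.1 - a) < del p.2.+1.
  by move=> [h n]; have [a ha ha'] := dense h _ (del0 n.+1); exists a.
(* [r n] is what remains of [f] after [n] approximants. *)
pose r := fix r n := if n is m.+1 then r m - ap (r m, m) else f.
pose a n := ap (r n, n).
have rdel n : qnorm (r n) <= del n.
  case: n => [|n]; first by rewrite /del expr0 divr1.
  by rewrite ltW//; exact: (hap (r n, n)).2.
pose rho n := M * del n.
have rho0 n : 0 <= rho n by rewrite mulr_ge0// ltW.
have abnd n : bnd (a n) (rho n).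
  by apply: bndW (hap (r n, n)).1 _; rewrite ler_wpM2l ?(ltW M0)//; exact: rdel.
have rhoS n : rho n.+1 <= rho n / (2 * kappa).
  by rewrite /rho /del exprSr invfM !mulrA.
have sa n : \sum_(0 <= i < n) a i = f - r n.
  elim: n => [|n IH]; first by rewrite big_geq// subrr.
  by rewrite big_nat_recr//= IH opprB -addrA; congr (_ + _); exact: addrC.
have psum F n d : qnorm (\sum_(n <= i < n + d) lcomb x (c (a i)) F) <= 2 * kappa * rho n.
  by apply: qnorm_geometric_sum => // i; exact: abnd.
have small e : 0 < e -> exists N, forall n, (N <= n)%N -> 2 * kappa ^+ 2 * rho n < e.
  move=> e0; have e2 : 0 < e / (2 * kappa ^+ 2) by rewrite divr_gt0// mulr_gt0// exprn_gt0.
  have [N hN] := geometric_small k1 (rho0 _) rhoS rho0 e2.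
  by exists N => n /hN; rewrite ltr_pdivlMr ?mulr_gt0 ?exprn_gt0// mulrC.
have xn0 j : x j != 0.
  by apply/eqP => xj0; have := dual j j; rewrite xj0 c0 eqxx => /eqP; rewrite eq_sym oner_eq0.
have [b hb] : exists b : J -> K, forall j e, 0 < e ->
    exists N, forall n, (N <= n)%N -> modulus (\sum_(0 <= i < n) c (a i) j - b j) < e.
  suff /choice[b hb] : forall j, exists bj : K, forall e : R, 0 < e ->
     exists N, forall n, (N <= n)%N -> modulus (\sum_(0 <= i < n) c (a i) j - bj) < e.
    by exists b.
  move=> j; apply: scalars_complete => e e0.
  have xj0 : 0 < qnorm (x j).
    by rewrite lt_neqAle qnorm_ge0 andbT eq_sym; apply: contra_neq (xn0 j); exact: qnorm_eq0.
  have [N hN] := small _ (mulr_gt0 e0 xj0).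
  have diff m n : (N <= n)%N -> (n <= m)%N ->
      modulus (\sum_(0 <= i < m) c (a i) j - \sum_(0 <= i < n) c (a i) j) < e.
    move=> Nn nm; rewrite -(ltr_pM2r xj0) -qnormZ.
    rewrite (big_cat_nat (leq0n n) nm)//= addrAC subrr add0r.
    have := psum [fset j]%fset n (m - n)%N; rewrite subnKC// => h.
    apply: le_lt_trans (_ : 2 * kappa * rho n < _); last first.
      apply: le_lt_trans (hN _ Nn); rewrite ler_wpM2r// expr2 mulrA ler_peMr//.
      by rewrite ltW.
    apply: le_trans h; rewrite scaler_suml le_eqVlt; apply/orP; left; apply/eqP; congr qnorm; apply: eq_bigr => i _.
    by rewrite /lcomb /partial_sum big_fset1.
  exists N => m n Nm Nn; have [mn|/ltnW nm] := leqP m n; last exact: diff.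
  by rewrite modulusB diff.
have lb F n : qnorm (lcomb x b F - \sum_(0 <= i < n) lcomb x (c (a i)) F) <= 2 * kappa ^+ 2 * rho n.
  apply/ler_addgt0Pr => e e0.
  have ek0 : 0 < e / kappa by rewrite divr_gt0.
  have [d dd0 hd] := partial_sum_small x F ek0.
  have /choice[N hN] : forall j, exists N, forall n, (N <= n)%N ->
      modulus (\sum_(0 <= i < n) c (a i) j - b j) < d by move=> j; exact: hb.
  (* Beyond [m] terms all coefficients indexed by the finite set [F] are within [d] of their limits;
     [m] depends on [F], but the final bound does not. *)
  pose m := maxn n (\max_(j : F) N (val j)).
  have nm : (n <= m)%N by exact: leq_maxl.
  apply: le_trans (qnorm_dist_le _ (\sum_(0 <= i < m) lcomb x (c (a i)) F) _ kq) _.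
  have h1 : qnorm (lcomb x b F - \sum_(0 <= i < m) lcomb x (c (a i)) F) <= e / kappa.
    rewrite qnormC -lcomb_sum -lcombB.
    (* Set to zero outside [F], because [partial_sum_small] asks for smallness of all
       coefficients. *)
    pose a' j := if j \in F then c (\sum_(0 <= i < m) a i) j - b j else 0.
    have -> : lcomb x (fun j => c (\sum_(0 <= i < m) a i) j - b j) F = lcomb x a' F.
      by apply: eq_bigr => j _; rewrite /a' (valP j).
    apply: hd => j; rewrite /a'; case: ifPn => jF; last by rewrite modulus0 ltW.
    rewrite c_sum ltW// hN// leq_max; apply/orP; right.
    exact: (@leq_bigmax _ (fun j : F => N (val j)) [` jF]%fset).
  have h2 := psum F n (m - n)%N; rewrite subnKC// in h2.
  rewrite (big_cat_nat (leq0n n) nm)//= in h1 *.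
  rewrite [X in _ + qnorm X](_ : _ = \sum_(n <= i < m) lcomb x (c (a i)) F); last first.
    by rewrite addrAC subrr add0r.
  rewrite mulrDr [leRHS]addrC lerD//; first by rewrite mulrC -ler_pdivlMr.
  rewrite (_ : 2 * kappa ^+ 2 * rho n = kappa * (2 * kappa * rho n)); last by ring.
  by rewrite ler_pM2l.
have cf : c f = b.
  apply/uniq/unconditional_sumP => e e0.
  pose d := e / (kappa * (1 + 2 * kappa)) / 2.
  have d0 : 0 < d by rewrite !divr_gt0// mulr_gt0//; lra.
  have [N hN] := small _ d0.
  have [N' hN'] : exists N, forall n, (N <= n)%N -> del n < d.
    apply: (@geometric_small R del kappa) => //; last by move=> n; exact: ltW.
    - by rewrite ltW.
    - by move=> n; rewrite /del exprSr invfM !mulrA.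
  pose n := maxn N N'.
  have [F0 hF0] := cvg (\sum_(0 <= i < n) a i) d0.
  exists F0 => F /hF0 hF.
  rewrite -/(lcomb x b F).
  apply: le_lt_trans (qnorm_dist_le _ (\sum_(0 <= i < n) lcomb x (c (a i)) F) _ kq) _.
  have h1 := le_lt_trans (lb F n) (hN _ (leq_maxl _ _)).
  have h2 := qnorm_dist_le (\sum_(0 <= i < n) lcomb x (c (a i)) F) (\sum_(0 <= i < n) a i) f kq.
  rewrite lcomb_sum in hF.
  have h3 : qnorm (\sum_(0 <= i < n) a i - f) < d.
    rewrite sa addrAC subrr add0r qnormN (le_lt_trans (rdel n))// hN'//.
    exact: leq_maxr.
  have eE : e = 2 * (kappa * (d + kappa * (d + d))).
    by rewrite /d; field; rewrite !gt_eqF//; lra.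
  have h4 : kappa * (d + kappa * (d + d)) < e by rewrite eE; move: e0; rewrite {1}eE; lra.
  apply: le_lt_trans h4; rewrite ler_pM2l// lerD ?(ltW h1)// (le_trans h2)//.
  by rewrite ler_pM2l// lerD// ltW.
move=> F; rewrite cf; have := lb F 0%N; rewrite big_geq// subr0 /rho /del expr0 divr1.
by rewrite mulrA.
Qed.

Lemma bounded_coords : exists D, basis_coords x c D.
Proof.
have [C C0 hC] := bnd_qnorm.
exists (Num.max 1 C); split.
- exact: linear.
- exact: dual.
- by rewrite le_max lexx.
- move=> F f; apply: le_trans (hC f F) _.
  by rewrite ler_wpM2r ?qnorm_ge0// le_max lexx orbT.
- by move=> f e; exact: cvg.
Qed.

End coords_of_basis.

Theorem unconditional_basis_coords x : unconditional_basis x ->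
  exists c D, basis_coords x c D.
Proof.
move=> xb.
have [c hc] : exists c : X -> J -> K, forall f, unconditional_sum (fun j => c f j *: x j) f.
  have /choice[c hc] : forall f, exists a : J -> K, unconditional_sum (fun j => a j *: x j) f.
    by move=> f; have [a [ha _]] := xb f; exists a.
  by exists c.
by have [D hD] := bounded_coords xb hc; exists c, D.
Qed.

End basis_coordinates.

(** * Comparison of two bases *)

Section finite_sums.
Context {R : realType} {I : choiceType}.

Lemma sum_fset_le (phi : I -> R) (G G' : {fset I}) : (G `<=` G')%fset ->
  (forall i, 0 <= phi i) -> \sum_(i : G) phi (val i) <= \sum_(i : G') phi (val i).
Proof.
move=> GG' phi0; rewrite -!(big_seq_fsetE _ _ predT phi)/=.
have -> : G = [fset i in G' | i \in G]%fset.
  by apply/fsetP => i; rewrite !inE/=; case iG: (i \in G); rewrite ?andbF// (fsubsetP GG').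
rewrite -big_fset_condE/= [leLHS]big_mkcond/=; by apply: ler_sum => i _; case: ifP.
Qed.

Lemma sum_fset_class {V : nmodType} {A : finType} (cl : I -> A) (v : I -> V) (G : {fset I}) :
  \sum_(i : G) v (val i) =
  \sum_(al : A) \sum_(i : [fset i in G | cl i == al]%fset) v (val i).
Proof.
rewrite -(big_seq_fsetE _ _ predT v)/= (partition_big cl predT)//=; apply: eq_bigr => al _.
by rewrite -(big_seq_fsetE _ _ predT v)/= -big_fset_condE.
Qed.

Lemma exists_ge_mean {A : finType} (phi : A -> R) (m : R) : 0 < m ->
  m <= \sum_al phi al -> exists al, m / #|A|%:R <= phi al.
Proof.
move=> m0 hm; apply: contrapT => /forallNP h.
have A0 : (0 < #|A|)%N.
  rewrite lt0n; apply: contraTneq hm => /card0_eq A0; rewrite big1 ?leNgt ?m0// => al.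
  by have := A0 al.
have : \sum_al phi al < \sum_(al : A) m / #|A|%:R.
  have [al _] : exists al : A, true by move/card_gt0P : A0 => [al _]; exists al.
  by apply: ltr_sum => [|b _]; [apply/hasP; exists al; rewrite ?mem_index_enum|rewrite ltNge; apply/negP/h].
rewrite sumr_const -[_ *+ _]mulr_natr divfK ?pnatr_eq0 -?lt0n//.
by rewrite ltNge hm.
Qed.

Lemma pigeonhole {A S : finType} (f : S -> A) : (0 < #|S|)%N ->
  exists al, #|S|%:R / #|A|%:R <= #|[pred s | f s == al]|%:R :> R.
Proof.
move=> S0; apply: (exists_ge_mean (phi := fun al => #|[pred s | f s == al]|%:R)); first by rewrite ltr0n.
rewrite -natr_sum ler_nat -[leqLHS]sum1_card (partition_big f predT)//=.
by apply: leq_sum => al _; rewrite sum1_card.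
Qed.

(** Chord estimates at the total [T]; the proportions [t_i / T] add up to 1. *)
Lemma powR_sum_le {S : finType} (t : S -> R) r : 0 < r <= 1 -> (forall i, 0 <= t i) ->
  (\sum_i t i) `^ r <= \sum_i t i `^ r.
Proof.
move=> /andP[r0 r1] t0; set T := \sum_i t i.
have T0 : 0 <= T by exact: sumr_ge0.
have h i : T `^ r * (t i / T) <= t i `^ r.
  apply: ge_powR_affine; rewrite ?r0// t0/= /T (bigD1 i)//= lerDl.
  by apply: sumr_ge0.
apply: le_trans (ler_sum _ (fun i _ => h i)); rewrite -mulr_sumr -mulr_suml -/T.
have [->|Tn0] := eqVneq T 0; first by rewrite powR0 ?mul0r// gt_eqF.
by rewrite divff// mulr1.
Qed.

End finite_sums.

Section basis_lemmas.
Context {R : realType} {k : scalar_kind} {X : quasiBanachType R k} {J : countType}.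
Local Notation K := (scalars R k).
Context (x : J -> X) (c : X -> J -> K) (D : R) (xc : basis_coords x c D).
Implicit Types (f g : X) (F : {fset J}).

Lemma coords0 j : c 0 j = 0.
Proof. by have := coords_linear xc (-1) 0 0 j; rewrite scaler0 addr0 mulN1r addNr. Qed.

Lemma coordsZ a f j : c (a *: f) j = a * c f j.
Proof. by rewrite -[a *: f]addr0 (coords_linear xc) coords0 addr0. Qed.

Lemma coordsD f g j : c (f + g) j = c f j + c g j.
Proof. by have := coords_linear xc 1 f g j; rewrite scale1r mul1r. Qed.

Lemma coordsN f j : c (- f) j = - c f j.
Proof. by rewrite -scaleN1r coordsZ mulN1r. Qed.

Lemma coordsB f g j : c (f - g) j = c f j - c g j.
Proof. by rewrite coordsD coordsN. Qed.

Lemma coords_sum (S : Type) (r : seq S) (P : pred S) (v : S -> X) j :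
  c (\sum_(i <- r | P i) v i) j = \sum_(i <- r | P i) c (v i) j.
Proof. by apply: (big_morph (fun f => c f j)); [move=> ? ?; exact: coordsD|exact: coords0]. Qed.

Lemma coords_sign_sum (S : finType) (v : S -> X) s j :
  c (sign_sum v s) j = sign_sum (fun i => c (v i) j) s.
Proof. by rewrite coords_sum; apply: eq_bigr => i _; case: (s i) => //=; rewrite coordsN. Qed.

Lemma coords_lcomb (a : J -> K) F (j : F) : c (lcomb x a F) (val j) = a (val j).
Proof.
rewrite /lcomb /partial_sum coords_sum (bigD1 j)//= coordsZ (coords_dual xc) eqxx mulr1.
rewrite big1 ?addr0// => i ij; rewrite coordsZ (coords_dual xc).
by rewrite (_ : (_ == _) = false) ?mulr0//; apply: contraNF ij => /eqP e; apply/eqP/val_inj.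
Qed.

(** Signs are realised by projections: with [E] the set of negative signs, the signed sum is the
    projection onto [F] minus twice the one onto [E], whence 3 = 1 + 2. *)
Lemma sign_sum_bound kappa F f s : quasi_triangle (X := X) kappa ->
  qnorm (sign_sum (fun j : F => c f (val j) *: x (val j)) s) <= 3 * kappa * D * qnorm f.
Proof.
move=> kq; pose P (j : J) := if insub j is Some j' then s j' else false.
pose E := [fset j in F | P j]%fset.
have -> : sign_sum (fun j : F => c f (val j) *: x (val j)) s = lcomb x (c f) F - lcomb x (c f) E *+ 2.
  rewrite [lcomb x _ E](_ : _ = \sum_(j : F | s j) c f (val j) *: x (val j)); last first.
    rewrite /lcomb /partial_sum -(big_seq_fsetE _ _ predT (fun j => c f j *: x j))/=.
    rewrite -big_fset_condE/= (big_seq_fsetE _ _ P (fun j => c f j *: x j))/=.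
    by apply: eq_bigl => j; rewrite /P valK.
  rewrite /lcomb /partial_sum [X in _ - X *+ 2]big_mkcond/= -sumrMnl -sumrB; apply: eq_bigr => j _.
  by case: (s j) => /=; rewrite ?mul0rn ?subr0// mulr2n opprD addrA subrr sub0r.
apply: le_trans (qnormB_le _ _ kq) _.
rewrite -scaler_nat qnormZ -[2%:R]mul1r mulr_natr modulusMn modulus1 mul1r.
have := coords_bounded xc F f; have := coords_bounded xc E f.
move: kq => [k1 _] h1 h2.
rewrite (_ : 3 * kappa * D * qnorm f = kappa * (D * qnorm f + 2 * (D * qnorm f))); last by ring.
by rewrite ler_wpM2l ?lerD// ?ler_wpM2l//; lra.
Qed.

Context (xn : normalized x).

Lemma coords_le f j : modulus (c f j) <= D * qnorm f.
Proof.
have := coords_bounded xc [fset j]%fset f; rewrite /lcomb /partial_sum.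
by rewrite -(big_seq_fsetE _ _ predT (fun j => c f j *: x j))/= big_seq_fset1 qnormZ xn mulr1.
Qed.

End basis_lemmas.

(** * Classes of basis vectors equivalent to the basis of l_p *)

Section ell_classes.
Context {R : realType} {k : scalar_kind} {X : quasiBanachType R k}.
Local Notation K := (scalars R k).

(** Powers are compared without extracting roots; every exponent that is not real is read as the
    supremum norm. *)
Definition ell_le (p : \bar R) (I : countType) (G : {fset I}) (a : I -> K) (M : R) : Prop :=
  if p is r%:E then \sum_(i : G) modulus (a (val i)) `^ r <= M `^ r
  else forall i : G, modulus (a (val i)) <= M.

(* Only finite sums are involved, which makes the notion symmetric in the two
   bases to be compared. *)
Definition ell_class (I : countType) (e : I -> X) (p : \bar R) (P : pred I) (C : R) : Prop :=
  forall (G : {fset I}) (a : I -> K), (forall i : G, P (val i)) ->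
    (forall M, 0 <= M -> ell_le p G a M -> qnorm (lcomb e a G) <= C * M) /\
    ell_le p G a (C * qnorm (lcomb e a G)).

Definition ell_classes (A : finType) (pe : A -> \bar R) (I : countType) (e : I -> X)
    (cl : I -> A) (C : R) : Prop :=
  forall al, ell_class e (pe al) (fun i => cl i == al) C.

Variant admissible : \bar R -> Prop :=
| AdmissibleLe1 r of 0 < r <= 1 : admissible r%:E
| AdmissibleTwo : admissible 2%:E
| AdmissibleInfty : admissible +oo%E.

Definition in_class (A : finType) (I : countType) (cl : I -> A) (al : A) (G : {fset I}) : Prop :=
  forall i : G, cl (val i) == al.

Lemma admissible_finite (r : R) : admissible r%:E -> 0 < r <= 2.
Proof.
move=> h; inversion h as [s hs|hs|]; last lra.
by move: hs => /andP[s0 s1]; rewrite s0/= (le_trans s1)// ler1n.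
Qed.

Section one_class.
Context (I : countType) (e : I -> X) (P : pred I) (C : R).

Lemma ell_class_upper r (G : {fset I}) a : ell_class e r%:E P C -> 0 < r -> 0 <= C ->
  (forall i : G, P (val i)) ->
  qnorm (lcomb e a G) `^ r <= C `^ r * \sum_(i : G) modulus (a (val i)) `^ r.
Proof.
move=> eP r0 C0 GP; have [h _] := eP G a GP.
set s := \sum_(i : G) _; have s0 : 0 <= s by apply: sumr_ge0 => i _; exact: powR_ge0.
have := h (s `^ r^-1) (powR_ge0 _ _); rewrite /= powR_mulKV// lexx => /(_ isT) {}h.
have := le_powR (ltW r0) (qnorm_ge0 _) h.
by rewrite powRM ?powR_ge0// powR_mulKV.
Qed.

Lemma ell_class_lower r (G : {fset I}) a : ell_class e r%:E P C -> 0 < r -> 0 <= C ->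
  (forall i : G, P (val i)) ->
  \sum_(i : G) modulus (a (val i)) `^ r <= C `^ r * qnorm (lcomb e a G) `^ r.
Proof.
by move=> eP r0 C0 GP; have [_] := eP G a GP; rewrite /= powRM// qnorm_ge0.
Qed.

Lemma ell_class_sup (G : {fset I}) a : ell_class e +oo%E P C -> 0 < C ->
  (forall i : G, P (val i)) -> 0 < qnorm (lcomb e a G) ->
  exists i : G, qnorm (lcomb e a G) <= 2 * C * modulus (a (val i)).
Proof.
move=> eP C0 GP n0; apply: contrapT => /forallNP h.
have [h' _] := eP G a GP; have C20 : 0 < 2 * C by rewrite mulr_gt0.
have := h' (qnorm (lcomb e a G) / (2 * C)); rewrite divr_ge0 ?(ltW n0) ?(ltW C20)//.
have -> : C * (qnorm (lcomb e a G) / (2 * C)) = qnorm (lcomb e a G) / 2.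
  by field; rewrite gt_eqF.
suff aC : ell_le +oo%E G a (qnorm (lcomb e a G) / (2 * C)) by move=> /(_ isT aC); lra.
move=> i /=; rewrite ler_pdivlMr// mulrC ltW// ltNge; exact/negP/h.
Qed.

End one_class.
End ell_classes.

(** * Square functions *)

Section comparison.
Context {R : realType} {k : scalar_kind} {X : quasiBanachType R k} {A : finType}.
Local Notation K := (scalars R k).
Context (pe : A -> \bar R) (peA : forall al, admissible (pe al)).
Context {J : countType} (x : J -> X) (c : X -> J -> K) (D : R).
Context (xc : basis_coords x c D) (xn : normalized x).
Context {I : countType} (e : I -> X) (d : X -> I -> K).
Context (ec : basis_coords e d D) (en : normalized e) (cl : I -> A).
Context (eE : ell_classes pe e cl D).
Implicit Types (f g : X) (F : {fset J}) (G : {fset I}) (al : A).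

Let D1 : 1 <= D := coords_bound_ge1 xc.
Let D0 : 0 < D. Proof. by apply: lt_le_trans D1. Qed.

(** All sign changes of [f] in the basis [x] have norm at most a multiple of that of [f], hence
    bounded [l_r] sums of coordinates along [G]. These sums are averaged over the signs, and
    Khintchine's lower inequality is applied at each coordinate. *)
Lemma square_function_le al r : pe al = r%:E -> exists2 C, 0 < C &
  forall F G f, in_class cl al G ->
  \sum_(i : G) (\sum_(j : F) (modulus (c f (val j)) * modulus (d (x (val j)) (val i))) ^+ 2) `^ (r / 2)
    <= C * qnorm f `^ r.
Proof.
move=> per; have := peA al; rewrite per => /admissible_finite/andP[r0 r2].
have [kappa kq] := @quasi_triangleP R k X; have k0 : 0 < kappa by have := kq.1; lra.
pose D' := D * (D * (3 * kappa * D)).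
have D'0 : 0 < D' by rewrite !mulr_gt0.
exists (12 * 4 `^ (r / 2) * D' `^ r); first by rewrite !mulr_gt0// powR_gt0.
move=> F G f Gal; set Q := \sum_(i : G) _.
pose g s := sign_sum (fun j : F => c f (val j) *: x (val j)) s.
have dg s i : d (g s) i = sign_sum (fun j : F => c f (val j) * d (x (val j)) i) s.
  by rewrite (coords_sign_sum ec); apply: eq_bigr => j _; rewrite (coordsZ ec).
have gs s : \sum_(i : G) modulus (d (g s) (val i)) `^ r <= D' `^ r * qnorm f `^ r.
  have := @eE al; rewrite per => eP.
  apply: le_trans (ell_class_lower _ eP r0 (ltW D0) Gal) _.
  rewrite -!powRM ?qnorm_ge0 ?(ltW D0) ?(ltW D'0)//.
  apply: le_powR; [exact: ltW|by rewrite mulr_ge0 ?qnorm_ge0// ltW|].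
  rewrite /D' -!mulrA ler_pM2l//; apply: le_trans (coords_bounded ec _ _) _.
  by rewrite ler_pM2l// !mulrA (sign_sum_bound xc).
have N0 : 0 < (nsigns F)%:R :> R by rewrite ltr0n nsigns_gt0.
rewrite -(ler_pM2l N0) mulr_sumr.
apply: (@le_trans _ _ (\sum_(i : G) 12 * 4 `^ (r / 2) * \sum_(s : {ffun F -> bool}) modulus (d (g s) (val i)) `^ r)).
  apply: ler_sum => i _; under [X in _ <= _ * X]eq_bigr do rewrite dg.
  apply: le_trans (khintchine_lower _ r0).
  rewrite ler_pM2l// le_eqVlt; apply/orP; left; apply/eqP; congr (_ `^ _).
  by apply: eq_bigr => j _; rewrite modulusM.
rewrite -mulr_sumr exchange_big/= mulrCA -!mulrA ler_pM2l// ler_pM2l ?powR_gt0//.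
apply: le_trans (ler_sum _ (fun s _ => gs s)) _.
by rewrite sumr_const -[leLHS]mulr_natl mulrCA.
Qed.

Lemma sup_function_le : exists2 C, 0 < C & forall F i f,
  \sum_(j : F) modulus (c f (val j)) * modulus (d (x (val j)) i) <= C * qnorm f.
Proof.
have [kappa kq] := @quasi_triangleP R k X; have k0 : 0 < kappa by have := kq.1; lra.
exists (2 * (D * (3 * kappa * D))); first by rewrite !mulr_gt0.
move=> F i f.
have [s hs] := sum_le_sign_sum (fun j : F => c f (val j) * d (x (val j)) i).
under eq_bigr do rewrite -modulusM.
apply: le_trans hs _; rewrite -!mulrA ler_pM2l//.
have -> : sign_sum (fun j : F => c f (val j) * d (x (val j)) i) s =
    d (sign_sum (fun j : F => c f (val j) *: x (val j)) s) i.
  by rewrite (coords_sign_sum ec); apply: eq_bigr => j _; rewrite (coordsZ ec).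
apply: le_trans (coords_le ec en _ _) _.
by rewrite ler_pM2l// !mulrA (sign_sum_bound xc).
Qed.

(* By unconditionality the norm of a vector is controlled by the norms of all
   its sign changes, and some class carries a fixed proportion of them. *)
Lemma qnorm_le_square_function : exists2 C : A -> R, (forall al, 0 < C al) &
  forall F (b : J -> K), 0 < qnorm (lcomb x b F) -> exists al, exists2 G, in_class cl al G &
    if pe al is r%:E then
      qnorm (lcomb x b F) `^ r <= C al * \sum_(i : G) (\sum_(j : F)
        (modulus (b (val j)) * modulus (d (x (val j)) (val i))) ^+ 2) `^ (r / 2)
    else exists i : G, qnorm (lcomb x b F) <=
      C al * \sum_(j : F) modulus (b (val j)) * modulus (d (x (val j)) (val i)).
Proof.
have [kappa kq] := @quasi_triangleP R k X; have k1 := kq.1; have k0 : 0 < kappa by lra.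
pose D' := 3 * kappa * D; have D'0 : 0 < D' by rewrite !mulr_gt0.
pose n := size (index_enum A).
(* Factor by factor: [2 * kappa] for approximating each [g s] by a finite sum, [D'] for undoing the
   signs, [kappa ^+ n] for splitting along the classes. *)
pose c1 := 2 * kappa * D' * kappa ^+ n.
have c10 : 0 < c1 by rewrite !mulr_gt0// exprn_gt0.
pose c2 := c1 * (#|A|%:R + 1).
have A10 : 0 < #|A|%:R + 1 :> R by rewrite ltr_wpDl.
have c20 : 0 < c2 by rewrite mulr_gt0.
exists (fun al => if pe al is r%:E then (#|A|%:R + 1) * 2 * (c2 * D) `^ r else c2 * (2 * D)).
  have h1 : 0 < c2 * (2 * D) by apply: mulr_gt0 => //; apply: mulr_gt0.
  have h2 : 0 < c2 * D by apply: mulr_gt0.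
  move=> al; case: (pe al) => // r; apply: mulr_gt0; last exact: powR_gt0.
  exact: mulr_gt0.
move=> F b; set f := lcomb x b F; set n0 := qnorm f => n00.
pose g s := sign_sum (fun j : F => b (val j) *: x (val j)) s.
have dg s i : d (g s) i = sign_sum (fun j : F => b (val j) * d (x (val j)) i) s.
  by rewrite (coords_sign_sum ec); apply: eq_bigr => j _; rewrite (coordsZ ec).
have gn s : n0 <= D' * qnorm (g s).
  have -> : n0 = qnorm (sign_sum (fun j : F => c (g s) (val j) *: x (val j)) s).
    congr qnorm; apply: eq_bigr => j _.
    have -> : c (g s) (val j) = signed (s j) (b (val j)).
      rewrite (coords_sign_sum xc) /sign_sum (bigD1 j)//= (coordsZ xc) (coords_dual xc) eqxx mulr1.
      rewrite big1 ?addr0// => i ij; rewrite (coordsZ xc) (coords_dual xc).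
      rewrite (_ : (_ == _) = false) ?mulr0; first by case: (s i); rewrite //= oppr0.
      by apply: contraNF ij => /eqP ji; apply/eqP/val_inj.
    by case: (s j) => //=; rewrite scaleNr opprK.
  exact: (sign_sum_bound xc).
have ep0 : 0 < n0 / (2 * kappa * D') by rewrite divr_gt0// !mulr_gt0.
have /choice[G0 hG0] : forall s, exists G0 : {fset I}, forall G, (G0 `<=` G)%fset ->
    qnorm (lcomb e (d (g s)) G - g s) < n0 / (2 * kappa * D').
  by move=> s; exact: (coords_cvg ec).
pose G := \big[fsetU/fset0]_(s : {ffun F -> bool}) G0 s.
have Gn s : n0 <= 2 * kappa * D' * qnorm (lcomb e (d (g s)) G).
  have hG : (G0 s `<=` G)%fset by apply: bigfcup_sup; rewrite ?mem_index_enum.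
  have := hG0 s G hG; rewrite qnormC ltr_pdivlMr ?mulr_gt0// => h1.
  have := kq.2 (g s - lcomb e (d (g s)) G) (lcomb e (d (g s)) G); rewrite subrK => h2.
  have := gn s; move: h1 h2; move: (qnorm (g s - _)) (qnorm (g s)) (qnorm (lcomb _ _ _)) => u v w.
  move=> h1 h2 h3; have := ler_wpM2l (ltW D'0) h2; nra.
pose Gc al := [fset i in G | cl i == al]%fset.
have Gcin al : in_class cl al (Gc al) by move=> i; have := valP i; rewrite !inE => /andP[].
have Gsum s : n0 / c1 <= \sum_al qnorm (lcomb e (d (g s)) (Gc al)).
  rewrite ler_pdivrMr// mulrC; apply: le_trans (Gn s) _.
  rewrite /c1 -!mulrA !ler_pM2l//.
  rewrite {1}/lcomb {1}/partial_sum (sum_fset_class cl (fun i => d (g s) i *: e i)).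
  exact: qnorm_sum_le.
have /choice[h hh] : forall s, exists al, n0 / c2 <= qnorm (lcomb e (d (g s)) (Gc al)).
  move=> s; have [|al hal] := exists_ge_mean _ (Gsum s); first by rewrite divr_gt0.
  exists al; apply: le_trans hal; rewrite -mulrA -invfM ler_pM2l//.
  have A0 : 0 < #|A|%:R :> R by rewrite ltr0n; apply/card_gt0P; exists al.
  by rewrite lef_pV2 ?posrE ?(mulr_gt0 c10 A0)// /c2 ler_pM2l// lerDl.
(* [al] is the class selected by at least a [1 / #|A|] share of the sign vectors. *)
clearbody c2; have [al hal] := @pigeonhole R A _ h nsigns_gt0.
exists al, (Gc al) => //.
have := peA al; have := @eE al; case pal: (pe al) => [r||] eP ad; last by inversion ad.
  have /andP[r0 r2] := admissible_finite ad.
  have N0 : 0 < (nsigns F)%:R :> R by rewrite ltr0n nsigns_gt0.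
  have hr s : s \in [pred s | h s == al] -> n0 `^ r <= (c2 * D) `^ r * \sum_(i : Gc al) modulus (d (g s) (val i)) `^ r.
    rewrite inE => /eqP hs; have := hh s; rewrite hs ler_pdivrMr// mulrC => {}hs.
    apply: le_trans (le_powR (ltW r0) (ltW n00) hs) _.
    rewrite !powRM ?qnorm_ge0 ?(ltW c20) ?(ltW D0)// -mulrA ler_pM2l ?powR_gt0//.
    exact: (ell_class_upper _ eP r0 (ltW D0) (Gcin al)).
  have : (nsigns F)%:R / #|A|%:R * n0 `^ r <= (c2 * D) `^ r *
      \sum_(s : {ffun F -> bool}) \sum_(i : Gc al) modulus (d (g s) (val i)) `^ r.
    apply: le_trans (ler_wpM2r (powR_ge0 _ _) hal) _.
    rewrite -sum1_card natr_sum mulr_suml mulr_sumr [leLHS]big_mkcond/=.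
    apply: ler_sum => s _; case: ifPn => [/hr|_]; first by rewrite mul1r.
    by rewrite mulr_ge0 ?powR_ge0// sumr_ge0// => *; exact: powR_ge0.
  rewrite exchange_big/= => hs.
  have : (nsigns F)%:R / #|A|%:R * n0 `^ r <= (c2 * D) `^ r * (2 * (nsigns F)%:R *
      \sum_(i : Gc al) (\sum_(j : F) (modulus (b (val j)) * modulus (d (x (val j)) (val i))) ^+ 2) `^ (r / 2)).
    apply: le_trans hs _; rewrite ler_pM2l ?powR_gt0 ?mulr_gt0// mulr_sumr.
    apply: ler_sum => i _; under eq_bigr do rewrite dg.
    apply: le_trans (khintchine_upper _ _) _; first by rewrite r0.
    rewrite ler_pM2l ?mulr_gt0// le_eqVlt; apply/orP; left; apply/eqP; congr (_ `^ _).
    by apply: eq_bigr => j _; rewrite modulusM.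
  set Q := \sum_(i : Gc al) _.
  have Q0 : 0 <= Q by apply: sumr_ge0 => *; exact: powR_ge0.
  have A0 : 0 < #|A|%:R :> R by rewrite ltr0n; apply/card_gt0P; exists al.
  rewrite mulrAC ler_pdivrMr// => h2; rewrite -(ler_pM2l N0) (le_trans h2)//.
  set z := (c2 * D) `^ r; have z0 : 0 <= z by exact: powR_ge0.
  rewrite -subr_ge0 [X in 0 <= X](_ : _ = 2 * (z * ((nsigns F)%:R * Q))); last by ring.
  by do 3 apply: mulr_ge0 => //.
(* For the supremum norm a single sign vector selecting [al] is enough. *)
have [s hs] : exists s, h s == al.
  apply: contrapT => /forallNP hn; have h0 : #|[pred s | h s == al]| = 0%N.
    by apply: eq_card0 => s; rewrite inE; apply/negbTE/negP/hn.
  move: hal; rewrite h0 leNgt divr_gt0// ?ltr0n ?nsigns_gt0//.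
  by apply/card_gt0P; exists al.
have := hh s; rewrite (eqP hs) => {}hs.
have gs0 : 0 < qnorm (lcomb e (d (g s)) (Gc al)) by apply: lt_le_trans hs; rewrite divr_gt0.
have [i hi] := ell_class_sup eP D0 (Gcin al) gs0.
exists i; move: hs; rewrite ler_pdivrMr// mulrC => /le_trans; apply.
rewrite -!mulrA ler_pM2l//; apply: le_trans hi _; rewrite -mulrA !ler_pM2l//.
rewrite dg; apply: le_trans (modulus_sum _ _ _) _; apply: ler_sum => j _.
by rewrite modulus_signed modulusM.
Qed.

End comparison.

(** The chord at the full sum [T] makes the power linear, and then it suffices to count how often
    each [j] is selected. *)
Lemma powR_sum_thinning {R : realType} {F Om : finType} (t : F -> R) (sel : Om -> pred F) (de h : R) :
  0 < h <= 1 -> (forall j, 0 <= t j) ->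
  (forall j, de * #|Om|%:R <= #|[pred w | sel w j]|%:R) ->
  de * #|Om|%:R * (\sum_j t j) `^ h <= \sum_w (\sum_(j | sel w j) t j) `^ h.
Proof.
move=> h01 t0 hsel; set T := \sum_j t j.
have T0 : 0 <= T by exact: sumr_ge0.
have [TE|Tn0] := eqVneq T 0.
  rewrite TE powR0 ?mulr0; last by rewrite gt_eqF// (andP h01).1.
  by apply: sumr_ge0 => *; exact: powR_ge0.
have {}T0 : 0 < T by rewrite lt_neqAle eq_sym Tn0.
have hw w : T `^ h * ((\sum_(j | sel w j) t j) / T) <= (\sum_(j | sel w j) t j) `^ h.
  apply: ge_powR_affine => //; rewrite sumr_ge0//= big_mkcond; apply: ler_sum => j _.
  by case: ifP.
apply: le_trans (ler_sum _ (fun w _ => hw w)); rewrite -mulr_sumr -mulr_suml mulrC.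
rewrite ler_pM2l ?powR_gt0// ler_pdivlMr//.
under eq_bigr do rewrite big_mkcond/=.
rewrite exchange_big/= mulr_sumr; apply: ler_sum => j _.
rewrite -big_mkcond/= sumr_const -[leRHS]mulr_natl ler_wpM2r//; exact: hsel.
Qed.

(** * L-convexity of the lattice structure induced by a basis *)

Section transfer.
Context {R : realType} {k : scalar_kind} {X : quasiBanachType R k} {A : finType}.
Local Notation K := (scalars R k).
Context (pe : A -> \bar R) (peA : forall al, admissible (pe al)).
Context {J : countType} (x : J -> X) (c : X -> J -> K) (D : R).
Context (xc : basis_coords x c D) (xn : normalized x).
Context {I : countType} (e : I -> X) (d : X -> I -> K).
Context (ec : basis_coords e d D) (en : normalized e) (cl : I -> A).
Context (eE : ell_classes pe e cl D).
Implicit Types (f g : X) (F : {fset J}) (G : {fset I}) (al : A).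

Let D1 : 1 <= D := coords_bound_ge1 xc.
Let D0 : 0 < D. Proof. by apply: lt_le_trans D1. Qed.

(* A form of L-convexity for the lattice structure induced by the basis x: its
   norm is equivalent to that of the square function, read in the spaces l_p. *)
Lemma lattice_convexity (de : R) : 0 < de -> exists2 C, 0 < C &
  forall F (b : J -> K) (Om : finType) (f : Om -> X) (M : R), 0 < M -> (0 < #|Om|)%N ->
  \sum_w qnorm (f w) ^+ 2 <= #|Om|%:R * M ^+ 2 ->
  (forall j : F, de * #|Om|%:R <=
    #|[pred w | modulus (b (val j)) <= modulus (c (f w) (val j))]|%:R) ->
  qnorm (lcomb x b F) <= C * M.
Proof.
move=> de0.
have [C1 C10 hC1] := qnorm_le_square_function peA xc ec eE.
have [C2 C20 hC2] := sup_function_le xc ec en.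
have /choice[C3 hC3] : forall al, exists C, 0 < C /\ forall r, pe al = r%:E ->
    forall F G f, in_class cl al G ->
    \sum_(i : G) (\sum_(j : F) (modulus (c f (val j)) * modulus (d (x (val j)) (val i))) ^+ 2) `^ (r / 2)
    <= C * qnorm f `^ r.
  move=> al; case pal: (pe al) => [r||]; last 2 first.
  - by exists 1.
  - by exists 1.
  have [C C0 hC] := square_function_le peA xc ec eE pal.
  by exists C; split => // _ [<-].
pose K1 al := if pe al is r%:E then (C1 al * (C3 al * 2) / de) `^ r^-1 else C1 al * (C2 * 2) / de.
exists (\big[Num.max/1]_al K1 al); first by rewrite (lt_le_trans ltr01)// bigmax_ge_id.
move=> F b Om f M M0 Om0 fM fb.
set n0 := qnorm _; have [n00|n0n0] := leP n0 0.
  by rewrite (le_trans n00)// mulr_ge0 ?(ltW M0)// (le_trans ler01)// bigmax_ge_id.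
have Om0' : 0 < #|Om|%:R :> R by rewrite ltr0n.
have [al [G Gal h0]] := hC1 F b n0n0.
suff h : n0 <= K1 al * M.
  apply: le_trans h _; rewrite ler_wpM2r ?(ltW M0)//.
  exact: (le_bigmax _ K1).
rewrite /K1; move: h0; case pal: (pe al) => [r||] h0.
- have := peA al; rewrite pal => /admissible_finite/andP[r0 r2].
  have h01 : 0 < r / 2 <= 1 by rewrite divr_gt0//= ler_pdivrMr// mul1r.
  pose t (i : G) (j : F) := (modulus (b (val j)) * modulus (d (x (val j)) (val i))) ^+ 2.
  have t0 i j : 0 <= t i j by exact: sqr_ge0.
  have := fun i => powR_sum_thinning h01 (t0 i) fb => thin.
  have M20 : 0 < M ^+ 2 by rewrite exprn_gt0.
  have h1 : de * #|Om|%:R * \sum_(i : G) (\sum_(j : F) t i j) `^ (r / 2) <=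
      C3 al * (2 * #|Om|%:R * M `^ r).
    rewrite mulr_sumr; apply: le_trans (ler_sum _ (fun i _ => thin i)) _.
    rewrite exchange_big/=.
    (* For fixed [w], the selected [j] are those where [b] is dominated by the coordinate of [f w];
       the thinned sum is therefore at most the square function of [f w]. *)
    apply: (@le_trans _ _ (\sum_w C3 al * qnorm (f w) `^ r)).
      apply: ler_sum => w _; apply: le_trans ((hC3 al).2 _ pal F G (f w) Gal).
      apply: ler_sum => i _; apply: le_powR; [by have /andP[/ltW] := h01|exact: sumr_ge0|].
      rewrite [leLHS]big_mkcond/=; apply: ler_sum => j _; case: ifPn => [hj|_]; last exact: sqr_ge0.
      by rewrite /t ler_pXn2r ?nnegrE ?mulr_ge0 ?modulus_ge0// ler_wpM2r ?modulus_ge0.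
    rewrite -mulr_sumr ler_pM2l ?(hC3 al).1//.
    (* The affine majorant at scale [M ^+ 2] passes from the mean square to the mean of the [r]-th
       powers; this uses [r <= 2]. *)
    have hf w : qnorm (f w) `^ r <= M `^ r * (1 + qnorm (f w) ^+ 2 / M ^+ 2).
      rewrite -(powR_sqr_half r (qnorm_ge0 (f w))) -(powR_sqr_half r (ltW M0)).
      by apply: powR_le_affine => //; exact: sqr_ge0.
    apply: le_trans (ler_sum _ (fun w _ => hf w)) _.
    rewrite -mulr_sumr big_split/= -mulr_suml sumr_const mulrC ler_wpM2r ?powR_ge0//.
    rewrite mulr_natl mulr2n lerD// ler_pdivrMr//.
  have h2 : n0 `^ r <= C1 al * (C3 al * 2) / de * M `^ r.
    apply: le_trans h0 _; rewrite -!mulrA ler_pM2l//.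
    rewrite -(ler_pM2l Om0') -(ler_pM2l de0) mulrA (le_trans h1)//.
    by rewrite le_eqVlt; apply/orP; left; apply/eqP; field; rewrite gt_eqF.
  have C0 : 0 <= C1 al * (C3 al * 2) / de.
    by rewrite divr_ge0 ?(ltW de0)// mulr_ge0 ?(ltW (C10 al))// mulr_ge0// ltW// (hC3 al).1.
  rewrite -(powR_mulVK r0 (ltW n0n0)) -(powR_mulVK r0 (ltW M0)) -powRM ?powR_ge0//.
  by apply: le_powR; rewrite ?invr_ge0 ?(ltW r0) ?powR_ge0.
- move: h0 => -[i hi].
  pose t (j : F) := modulus (b (val j)) * modulus (d (x (val j)) (val i)).
  have t0 j : 0 <= t j by rewrite mulr_ge0 ?modulus_ge0.
  have h01 : (0 : R) < (1 : R) <= 1 by rewrite ltr01 lexx.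
  have := powR_sum_thinning h01 t0 fb; rewrite powRr1 ?sumr_ge0// => h1.
  have h2 : de * #|Om|%:R * \sum_j t j <= C2 * (2 * #|Om|%:R * M).
    apply: le_trans h1 _; apply: (@le_trans _ _ (\sum_w C2 * qnorm (f w))).
      apply: ler_sum => w _; rewrite powRr1 ?sumr_ge0//; apply: le_trans (hC2 F (val i) (f w)).
      rewrite [leLHS]big_mkcond/=; apply: ler_sum => j _; case: ifPn => [hj|_].
        by rewrite /t ler_wpM2r ?modulus_ge0.
      by rewrite mulr_ge0 ?modulus_ge0.
    rewrite -mulr_sumr ler_pM2l//.
    have hf w : qnorm (f w) <= M * (1 + qnorm (f w) ^+ 2 / M ^+ 2).
      rewrite -expr_div_n -{1}(divfK (lt0r_neq0 M0) (qnorm (f w))) mulrC ler_pM2l//.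
      by have := sqr_ge0 (qnorm (f w) / M - 1); set v := _ / _; have := sqr_ge0 v; nra.
    apply: le_trans (ler_sum _ (fun w _ => hf w)) _.
    rewrite -mulr_sumr big_split/= -mulr_suml sumr_const mulrC ler_wpM2r ?(ltW M0)//.
    by rewrite mulr_natl mulr2n lerD// ler_pdivrMr// exprn_gt0.
  apply: le_trans hi _; rewrite -!mulrA ler_pM2l//.
  rewrite -(ler_pM2l Om0') -(ler_pM2l de0) mulrA (le_trans h2)//.
  by rewrite le_eqVlt; apply/orP; left; apply/eqP; field; rewrite gt_eqF.
- by have := peA al; rewrite pal => ad; inversion ad.
Qed.

End transfer.

Lemma lcombZ (R : realType) (k : scalar_kind) (X : quasiBanachType R k) (J : countType)
    (x : J -> X) (t : scalars R k) (a : J -> scalars R k) (F : {fset J}) :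
  lcomb x (fun j => t * a j) F = t *: lcomb x a F.
Proof. by rewrite /lcomb /partial_sum scaler_sumr; apply: eq_bigr => j _; rewrite scalerA. Qed.

Lemma sum_signed (V : zmodType) (S : finType) b (v : S -> V) :
  \sum_i signed b (v i) = signed b (\sum_i v i).
Proof. by case: b; rewrite //= sumrN. Qed.

Lemma signed_mull (A : pzRingType) b (u v : A) : signed b u * v = signed b (u * v).
Proof. by case: b; rewrite //= mulNr. Qed.

Section diagonal.
Context {R : realType} {k : scalar_kind} {X : quasiBanachType R k} {A : finType}.
Local Notation K := (scalars R k).
Context {J : countType} (x : J -> X) (c : X -> J -> K) (D : R).
Context (xc : basis_coords x c D) (xn : normalized x).
Context {I : countType} (e : I -> X) (d : X -> I -> K).
Context (ec : basis_coords e d D) (cl : I -> A).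

(* Each x_j is seen through one class: the diagonal entry
   1 = sum_i d(x_j, i) c(e_i, j) is split along the finitely many classes. *)
Lemma diagonal_class : exists (clx : J -> A) (Gs : J -> {fset I}) (c0 : R),
  [/\ 0 < c0, forall j, in_class cl (clx j) (Gs j)
    & forall j, c0 <= modulus (\sum_(i : Gs j) d (x j) (val i) * c (e (val i)) j)].
Proof.
have D0 : 0 < D by rewrite (lt_le_trans ltr01)// (coords_bound_ge1 xc).
have h j : exists al, exists2 G, in_class cl al G &
    2^-1 / #|A|%:R <= modulus (\sum_(i : G) d (x j) (val i) * c (e (val i)) j).
  (* A coordinate costs a factor [D], so this accuracy preserves at least half of the diagonal entry
     1. *)
  have e0 : 0 < 2^-1 / D by rewrite divr_gt0.
  have [G hG] := coords_cvg ec (x j) e0.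
  have := hG G (fsubset_refl _) => {}hG.
  have cG : c (lcomb e (d (x j)) G) j = \sum_(i : G) d (x j) (val i) * c (e (val i)) j.
    by rewrite (coords_sum xc); apply: eq_bigr => i _; rewrite (coordsZ xc).
  have half : 2^-1 <= modulus (\sum_(i : G) d (x j) (val i) * c (e (val i)) j).
    have := coords_le xc xn (lcomb e (d (x j)) G - x j) j.
    rewrite (coordsB xc) (coords_dual xc) eqxx cG modulusB => h1.
    have h2 := modulusD (1 - \sum_(i : G) d (x j) (val i) * c (e (val i)) j)
      (\sum_(i : G) d (x j) (val i) * c (e (val i)) j).
    rewrite subrK modulus1 in h2.
    by move: hG; rewrite ltr_pdivlMr// mulrC; lra.
  have half0 : 0 < 2^-1 :> R by [].
  have [|al hal] := exists_ge_mean (phi := fun al => modulus (\sum_(i : [fset i in G | cl i == al]%fset)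
    d (x j) (val i) * c (e (val i)) j)) half0.
    apply: le_trans half _.
    rewrite (sum_fset_class cl (fun i => d (x j) i * c (e i) j)); exact: modulus_sum.
  by exists al, [fset i in G | cl i == al]%fset => // i; have := valP i; rewrite !inE => /andP[].
have /choice[clx hclx] := h.
have /choice[Gs hGs] : forall j, exists G, in_class cl (clx j) G /\
    2^-1 / #|A|%:R <= modulus (\sum_(i : G) d (x j) (val i) * c (e (val i)) j).
  by move=> j; have [G h1 h2] := hclx j; exists G.
(* If there are no classes there is no [j] either, but [c0] must still be positive. *)
exists clx, Gs, (if (#|A| == 0)%N then 1 else 2^-1 / #|A|%:R); split.
- by case: ifPn => // A0; rewrite divr_gt0// ltr0n lt0n.
- by move=> j; exact: (hGs j).1.
move=> j; case: ifPn => [/eqP/card0_eq A0|_]; last exact: (hGs j).2.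
by have := A0 (clx j).
Qed.

End diagonal.

(** * Classes of finite exponent *)

Section estimates.
Context {R : realType} {k : scalar_kind} {X : quasiBanachType R k} {A : finType}.
Local Notation K := (scalars R k).
Context (pe : A -> \bar R) (peA : forall al, admissible (pe al)).
Context {J : countType} (x : J -> X) (c : X -> J -> K) (D : R).
Context (xc : basis_coords x c D) (xn : normalized x).
Context {I : countType} (e : I -> X) (d : X -> I -> K).
Context (ec : basis_coords e d D) (en : normalized e) (cl : I -> A).
Context (eE : ell_classes pe e cl D).
Context (clx : J -> A) (Gs : J -> {fset I}) (c0 : R) (c00 : 0 < c0).
Context (Gs_class : forall j, in_class cl (clx j) (Gs j)).
Context (diag_ge : forall j,
  c0 <= modulus (\sum_(i : Gs j) d (x j) (val i) * c (e (val i)) j)).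
Implicit Types (f g : X) (F : {fset J}) (G : {fset I}) (al : A).

Let D1 : 1 <= D := coords_bound_ge1 xc.
Let D0 : 0 < D. Proof. by apply: lt_le_trans D1. Qed.

Definition supports F : {fset I} := \big[fsetU/fset0]_(j : F) Gs (val j).

Lemma Gs_supports F (j : F) : (Gs (val j) `<=` supports F)%fset.
Proof. by apply: (bigfcup_sup (fun j : F => Gs (val j))); rewrite ?mem_index_enum. Qed.

Lemma supports_class al F : in_class clx al F -> in_class cl al (supports F).
Proof.
move=> Fal [i /= iF]; move: (iF); rewrite /supports => /bigfcupP[j _ ij].
by rewrite (eqP (Gs_class (FSetSub ij))) (eqP (Fal j)).
Qed.

Lemma entry_le j i : modulus (d (x j) i) <= D.
Proof. by have := coords_le ec en (x j) i; rewrite xn mulr1. Qed.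

Lemma diag_sum_ge j G : (Gs j `<=` G)%fset ->
  c0 <= \sum_(i : G) modulus (d (x j) (val i)) * modulus (c (e (val i)) j).
Proof.
move=> GjG; apply: le_trans (diag_ge j) _; apply: le_trans (modulus_sum _ _ _) _.
under eq_bigr do rewrite modulusM.
apply: (sum_fset_le (phi := fun i => modulus (d (x j) i) * modulus (c (e i) j)) GjG) => i.
by rewrite mulr_ge0 ?modulus_ge0.
Qed.

Section finite_exponent.
Context (al : A) (r : R) (pal : pe al = r%:E).

Let r02 : 0 < r <= 2. Proof. by have := peA al; rewrite pal => /admissible_finite. Qed.
Let r0 : 0 < r. Proof. by case/andP: r02. Qed.
Let eP : ell_class e r%:E (fun i => cl i == al) D.
Proof. by have := @eE al; rewrite pal. Qed.

Lemma sum_entry_powR_le j G : in_class cl al G ->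
  \sum_(i : G) modulus (d (x j) (val i)) `^ r <= (D ^+ 2) `^ r.
Proof.
move=> Gal; apply: le_trans (ell_class_lower _ eP r0 (ltW D0) Gal) _.
rewrite -powRM ?qnorm_ge0 ?(ltW D0)//; apply: le_powR; rewrite ?(ltW r0)// ?mulr_ge0 ?qnorm_ge0 ?(ltW D0)//.
by rewrite expr2 ler_pM2l// (le_trans (coords_bounded ec _ _))// xn mulr1.
Qed.

(** The part of [x_j] carried by [Gs j] has a [j]-th coordinate of modulus at least [c0], hence norm
    at least [c0 / D]; it lies in a single class of [e], where the norm is controlled by the [l_r]
    sum. *)
Lemma sum_entry_powR_ge j G : clx j == al -> (Gs j `<=` G)%fset ->
  (c0 / D ^+ 2) `^ r <= \sum_(i : G) modulus (d (x j) (val i)) `^ r.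
Proof.
move=> /eqP jal GjG.
apply: le_trans (sum_fset_le (phi := fun i => modulus (d (x j) i) `^ r) GjG (fun _ => powR_ge0 _ _)).
have Gjal : in_class cl al (Gs j) by rewrite -jal; exact: Gs_class.
have := ell_class_upper (d (x j)) eP r0 (ltW D0) Gjal.
have : c0 / D <= qnorm (lcomb e (d (x j)) (Gs j)).
  rewrite ler_pdivrMr// mulrC; apply: le_trans (coords_le xc xn _ j).
  rewrite (coords_sum xc); apply: le_trans (diag_ge j) _.
  by under [X in modulus X <= _]eq_bigr do rewrite -(coordsZ xc).
move=> h1 h2; have h3 : 0 <= c0 / D by rewrite divr_ge0 ?(ltW c00) ?(ltW D0).
have := le_trans (le_powR (ltW r0) h3 h1) h2.
have -> : c0 / D = D * (c0 / D ^+ 2) by field; rewrite gt_eqF.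
have h4 : 0 <= c0 / D ^+ 2 by rewrite divr_ge0 ?(ltW c00)// exprn_ge0// ltW.
by rewrite powRM ?(ltW D0)// ler_pM2l ?powR_gt0.
Qed.

Lemma class_square_function_le : exists2 C, 0 < C & forall F (a : J -> K), in_class clx al F ->
  \sum_(i : supports F) (\sum_(j : F) (modulus (a (val j)) * modulus (d (x (val j)) (val i))) ^+ 2) `^ (r / 2)
    <= C * qnorm (lcomb x a F) `^ r.
Proof.
have [C C0 hC] := square_function_le peA xc ec eE pal.
exists C => // F a Fal; apply: le_trans (hC F _ (lcomb x a F) (supports_class Fal)).
rewrite le_eqVlt; apply/orP; left; apply/eqP; apply: eq_bigr => i _; congr (_ `^ _).
by apply: eq_bigr => j _; rewrite (coords_lcomb xc).
Qed.

Lemma lower_two_estimate : exists2 C, 0 < C & forall F (a : J -> K), in_class clx al F ->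
  \sum_(j : F) modulus (a (val j)) ^+ 2 <= C * qnorm (lcomb x a F) ^+ 2.
Proof.
have [C C0 hC] := class_square_function_le.
pose c1 := (c0 / D ^+ 2) `^ r; have c10 : 0 < c1 by rewrite powR_gt0// divr_gt0// exprn_gt0.
have B0 : 0 < C `^ r^-1 by exact: powR_gt0.
exists (((c1 / 2) `^ (r / 2)^-1)^-1 * (C `^ r^-1) ^+ 2).
  by rewrite mulr_gt0 ?exprn_gt0// invr_gt0 powR_gt0// divr_gt0.
move=> F a Fal; have [f0|f0] := eqVneq (qnorm (lcomb x a F)) 0.
  rewrite f0 expr0n mulr0 big1// => j _.
  by rewrite -(coords_lcomb xc) (qnorm_eq0 _ f0) (coords0 xc) modulus0 expr0n.
have {}f0 : 0 < qnorm (lcomb x a F) by rewrite lt_neqAle eq_sym f0 qnorm_ge0.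
rewrite -mulrA -exprMn.
apply: (mixed_norm_l2 (p := r) r02 c10 (mulr_gt0 B0 f0) (a := fun j : F => modulus (a (val j)))
  (u := fun (j : F) (i : supports F) => modulus (a (val j)) * modulus (d (x (val j)) (val i)))).
- by move=> j; exact: modulus_ge0.
- by move=> j i; rewrite mulr_ge0 ?modulus_ge0.
- move=> j; under eq_bigr do rewrite powRM ?modulus_ge0//.
  rewrite -mulr_sumr mulrC ler_wpM2l ?powR_ge0//.
  exact: (sum_entry_powR_ge (Fal j) (Gs_supports j)).
- by rewrite powRM ?powR_ge0 ?qnorm_ge0// powR_mulKV ?(ltW C0)//; exact: hC.
Qed.

Lemma lower_estimate_le1 : r <= 1 -> exists2 C, 0 < C & forall F (a : J -> K), in_class clx al F ->
  \sum_(j : F) modulus (a (val j)) `^ r <= C * qnorm (lcomb x a F) `^ r.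
Proof.
move=> r1; have [C C0 hC] := class_square_function_le.
have [C2 C20 hC2] := lower_two_estimate.
(* One constant for the entries, the [l_r] sums of the rows and the square sums of the columns. *)
pose B := D + (D ^+ 2) `^ r + C2 * D ^+ 2.
have B1 : 1 <= B.
  by rewrite /B -addrA (le_trans D1)// lerDl addr_ge0 ?powR_ge0// mulr_ge0 ?sqr_ge0// ltW.
have B0 : 0 < B by apply: lt_le_trans B1.
pose C' := (2 / c0) * B * (c0 / (2 * B ^+ 2)) `^ (r - 1) * (1 + B).
have C'0 : 0 < C'.
  apply: mulr_gt0; last exact: addr_gt0.
  apply: mulr_gt0; last by rewrite powR_gt0// divr_gt0// mulr_gt0// exprn_gt0.
  by apply: mulr_gt0 => //; exact: divr_gt0.
exists (C' * C); first exact: mulr_gt0.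
move=> F a Fal; rewrite -mulrA.
apply: le_trans (ler_wpM2l (ltW C'0) (hC F a Fal)).
have r01 : 0 < r <= 1 by rewrite r0.
apply: (mixed_norm_lp r01 c00 B1 (a := fun j : F => modulus (a (val j)))
  (y := fun (j : F) (i : supports F) => modulus (d (x (val j)) (val i)))
  (z := fun (j : F) (i : supports F) => modulus (c (e (val i)) (val j)))).
- by move=> j; exact: modulus_ge0.
- move=> j i; rewrite modulus_ge0/= (le_trans (entry_le _ _))// /B -addrA lerDl.
  by rewrite addr_ge0 ?powR_ge0// mulr_ge0 ?sqr_ge0// ltW.
- by move=> j i; exact: modulus_ge0.
- move=> j; apply: le_trans (sum_entry_powR_le _ (supports_class Fal)) _.
  by rewrite /B addrAC lerDr addr_ge0 ?mulr_ge0 ?sqr_ge0 ?(ltW C20) ?(ltW D0).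
- by move=> j; apply: diag_sum_ge; exact: Gs_supports.
(* The bootstrap: the [l_2] estimate is applied to the coefficients [c (e i) j], whose combination
   over [F] is a projection of [e i] and has norm at most [D]. *)
- move=> i; apply: le_trans (hC2 F (c (e (val i))) Fal) _.
  apply: (@le_trans _ _ (C2 * D ^+ 2)).
    rewrite ler_pM2l// ler_pXn2r ?nnegrE ?qnorm_ge0 ?(ltW D0)//.
    by have := coords_bounded xc F (e (val i)); rewrite en mulr1.
  by rewrite /B lerDr addr_ge0 ?powR_ge0 ?(ltW D0).
Qed.

(* rnd a s is the vector sum_j eps_j a_j u_j, where u_j is the part of x_j carried
   by Gs j and eps_j = -1 or 1 according to s. *)
Let w j i : K := if i \in Gs j then d (x j) i else 0.
Let rnd F (a : J -> K) (s : {ffun F -> bool}) : X :=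
  lcomb e (fun i => sign_sum (fun j : F => a (val j) * w (val j) i) s) (supports F).

Let coords_rnd F a s (j : J) : c (rnd a s) j =
  sign_sum (fun j' : F => a (val j') * \sum_(i : Gs (val j')) d (x (val j')) (val i) * c (e (val i)) j) s.
Proof.
rewrite /rnd /lcomb /partial_sum (coords_sum xc).
under eq_bigr do rewrite (coordsZ xc) /sign_sum mulr_suml.
rewrite exchange_big/=; apply: eq_bigr => j' _.
have -> : \sum_(i : Gs (val j')) d (x (val j')) (val i) * c (e (val i)) j =
    \sum_(i : supports F) w (val j') (val i) * c (e (val i)) j.
  rewrite -(big_seq_fsetE _ _ predT (fun i => d (x (val j')) i * c (e i) j))/=.
  rewrite -(big_seq_fsetE _ _ predT (fun i => w (val j') i * c (e i) j))/=.
  have {1}-> : Gs (val j') = [fset i in supports F | i \in Gs (val j')]%fset.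
    apply/fsetP => i; rewrite !inE/=; case iG: (i \in Gs _); rewrite ?andbF//.
    by rewrite andbT (fsubsetP (Gs_supports j')).
  rewrite -big_fset_condE/= big_mkcond/=; apply: eq_bigr => i _; rewrite /w.
  by case: ifP; rewrite ?mul0r.
rewrite mulr_sumr -sum_signed; apply: eq_bigr => i _.
by rewrite signed_mull mulrA.
Qed.

Let w_le j i : modulus (w j i) <= modulus (d (x j) i).
Proof. by rewrite /w; case: ifP; rewrite ?modulus0 ?modulus_ge0. Qed.

(** For at least half of the signs the [j]-th coordinate of [rnd a s] is not smaller than its
    diagonal term, hence at least [c0] times the modulus of [a_j]. This is the hypothesis of
    [lattice_convexity] for the proportion one half. *)
Let rnd_convexity : exists2 C, 0 < C & forall F (a : J -> K) M, 0 < M ->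
  \sum_s qnorm (rnd (F := F) a s) ^+ 2 <= (nsigns F)%:R * M ^+ 2 -> qnorm (lcomb x a F) <= C * M.
Proof.
have h2 : 0 < 2^-1 :> R by [].
have [C C0' hC] := lattice_convexity peA xc ec en eE h2.
exists (C / c0); first exact: divr_gt0.
move=> F a M M0 hM.
have mc0 : modulus (of_real c0 : K) = c0 by rewrite modulus_of_real ger0_norm// ltW.
have := hC F (fun j => of_real c0 * a j) _ (rnd (F := F) a) M M0 nsigns_gt0 hM.
rewrite lcombZ qnormZ mc0 [C / c0 * M]mulrAC ler_pdivlMr// [qnorm _ * c0]mulrC; apply => j.
pose v (j' : F) := a (val j') * \sum_(i : Gs (val j')) d (x (val j')) (val i) * c (e (val i)) (val j).
have := sign_sum_half v j; rewrite -(ler_nat R) natrM => h.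
rewrite mulrC ler_pdivrMr// mulrC (le_trans h)// ler_wpM2l// ler_nat.
apply: subset_leq_card; apply/fintype.subsetP => s; rewrite !inE => /(le_trans _); rewrite coords_rnd; apply.
by rewrite !modulusM mc0 mulrC ler_wpM2l ?modulus_ge0.
Qed.

Let lcomb_eq0 F (a : J -> K) : (forall j : F, a (val j) = 0) -> qnorm (lcomb x a F) = 0.
Proof. by move=> a0; rewrite /lcomb /partial_sum big1 ?qnorm0// => j _; rewrite a0 scale0r. Qed.

Let sum_powR_le0 F (a : J -> K) : \sum_(j : F) modulus (a (val j)) `^ r <= 0 `^ r ->
  forall j : F, a (val j) = 0.
Proof.
rewrite powR0 ?gt_eqF// => h j; apply: modulus_eq0.
have : \sum_(j : F) modulus (a (val j)) `^ r == 0.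
  by rewrite eq_le h sumr_ge0// => *; exact: powR_ge0.
rewrite psumr_eq0 => [/allP/(_ j)|*]; last exact: powR_ge0.
by rewrite mem_index_enum => /(_ isT)/eqP/powR_eq0_eq0.
Qed.

(** The [r]-th power is subadditive for [r <= 1], so that [rnd a s] is bounded for every choice of
    signs. *)
Lemma upper_estimate_le1 : r <= 1 -> exists2 C, 0 < C & forall F (a : J -> K) M, in_class clx al F ->
  0 <= M -> \sum_(j : F) modulus (a (val j)) `^ r <= M `^ r -> qnorm (lcomb x a F) <= C * M.
Proof.
move=> r1; have [C C0 hC] := rnd_convexity.
have D30 : 0 < D * D ^+ 2 by rewrite mulr_gt0// exprn_gt0.
exists (C * (D * D ^+ 2)); first exact: mulr_gt0.
move=> F a M Fal; rewrite le_eqVlt => /predU1P[<-|M0 aM].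
  by move=> /sum_powR_le0/lcomb_eq0 ->; rewrite mulr0.
rewrite -mulrA; apply: hC => //; first exact: mulr_gt0.
rewrite mulr_natl -sumr_const; apply: ler_sum => s _.
have DM0 : 0 <= D * D ^+ 2 * M by rewrite ltW// mulr_gt0.
rewrite ler_pXn2r ?nnegrE ?qnorm_ge0//.
rewrite -[leLHS](powR_mulVK r0 (qnorm_ge0 _)) -[leRHS](powR_mulVK r0 DM0).
apply: le_powR; rewrite ?invr_ge0 ?(ltW r0) ?powR_ge0//.
apply: le_trans (ell_class_upper _ eP r0 (ltW D0) (supports_class Fal)) _.
have -> : (D * D ^+ 2 * M) `^ r = D `^ r * (D ^+ 2 * M) `^ r.
  by rewrite -mulrA powRM ?(ltW D0)// mulr_ge0 ?sqr_ge0 ?(ltW M0).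
rewrite ler_pM2l ?powR_gt0//.
apply: (@le_trans _ _ (\sum_(i : supports F) \sum_(j : F) modulus (a (val j)) `^ r * modulus (d (x (val j)) (val i)) `^ r)).
  apply: ler_sum => i _.
  apply: le_trans (le_powR (ltW r0) (modulus_ge0 _) (modulus_sum _ _ _)) _.
  have r01 : 0 < r <= 1 by rewrite r0.
  apply: le_trans (powR_sum_le r01 _) _; first by move=> *; exact: modulus_ge0.
  apply: ler_sum => j _; rewrite modulus_signed modulusM powRM ?modulus_ge0//.
  by rewrite ler_wpM2l ?powR_ge0// le_powR ?modulus_ge0 ?(ltW r0).
rewrite exchange_big/= powRM ?sqr_ge0 ?(ltW M0)//.
apply: le_trans (ler_wpM2l (powR_ge0 _ _) aM); rewrite mulr_sumr; apply: ler_sum => j _.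
by rewrite -mulr_sumr mulrC ler_wpM2r ?powR_ge0// (sum_entry_powR_le _ (supports_class Fal)).
Qed.

(** A particular choice of signs need not be good here; only the mean square over all signs, in
    which the cross terms cancel, is bounded, and this is all that [rnd_convexity] asks for. *)
Lemma upper_estimate_two : r = 2 -> exists2 C, 0 < C & forall F (a : J -> K) M, in_class clx al F ->
  0 <= M -> \sum_(j : F) modulus (a (val j)) `^ r <= M `^ r -> qnorm (lcomb x a F) <= C * M.
Proof.
move=> r2; have [C C0 hC] := rnd_convexity.
have D30 : 0 < D * D ^+ 2 by rewrite mulr_gt0// exprn_gt0.
exists (C * (D * D ^+ 2)); first exact: mulr_gt0.
move=> F a M Fal; rewrite le_eqVlt => /predU1P[<-|M0 aM].
  by move=> /sum_powR_le0/lcomb_eq0 ->; rewrite mulr0.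
rewrite -mulrA; apply: hC => //; first exact: mulr_gt0.
have p2 (t : R) : 0 <= t -> t `^ r = t ^+ 2 by move=> t0; rewrite r2 powR_mulrn.
apply: (@le_trans _ _ (\sum_s D ^+ 2 * \sum_(i : supports F)
    modulus (sign_sum (fun j : F => a (val j) * w (val j) (val i)) s) ^+ 2)).
  apply: ler_sum => s _.
  have := ell_class_upper (fun i => sign_sum (fun j : F => a (val j) * w (val j) i) s) eP r0 (ltW D0) (supports_class Fal).
  rewrite !p2 ?qnorm_ge0 ?(ltW D0)// => /le_trans; apply.
  by rewrite ler_pM2l ?exprn_gt0//; apply: ler_sum => i _; rewrite p2 ?modulus_ge0.
rewrite -mulr_sumr exchange_big/=.
under eq_bigr do rewrite sum_modulus_sign_sum_sqr.
rewrite -mulr_sumr exchange_big/= mulrCA ler_pM2l ?ltr0n ?nsigns_gt0//.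
have -> : (D * D ^+ 2 * M) ^+ 2 = D ^+ 2 * ((D ^+ 2) ^+ 2 * M ^+ 2) by ring.
rewrite ler_pM2l ?exprn_gt0//.
move: aM; rewrite p2 ?(ltW M0)// => aM.
apply: le_trans (ler_wpM2l _ aM); last by rewrite sqr_ge0.
rewrite mulr_sumr; apply: ler_sum => j _; rewrite p2 ?modulus_ge0//.
rewrite mulrC; apply: (@le_trans _ _ (modulus (a (val j)) ^+ 2 * \sum_(i : supports F) modulus (d (x (val j)) (val i)) ^+ 2)).
  rewrite mulr_sumr; apply: ler_sum => i _; rewrite modulusM exprMn ler_wpM2l ?sqr_ge0//.
  by rewrite ler_pXn2r ?nnegrE ?modulus_ge0.
rewrite ler_wpM2l ?sqr_ge0//.
have := sum_entry_powR_le (val j) (supports_class Fal); rewrite p2 ?sqr_ge0// => /(le_trans _); apply.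
by apply: ler_sum => i _; rewrite p2 ?modulus_ge0.
Qed.

Let r_cases : r <= 1 \/ r = 2.
Proof.
have := peA al; rewrite pal => h; inversion h as [s hs|hs|]; last by right.
by left; case/andP: hs.
Qed.

Lemma finite_ell_class : exists2 C, 0 < C & ell_class x r%:E (fun j => clx j == al) C.
Proof.
have [Cu Cu0 hu] : exists2 C, 0 < C & forall F (a : J -> K) M, in_class clx al F ->
    0 <= M -> \sum_(j : F) modulus (a (val j)) `^ r <= M `^ r -> qnorm (lcomb x a F) <= C * M.
  by have [r1|r2] := r_cases; [exact: upper_estimate_le1|exact: upper_estimate_two].
have [Cl Cl0 hl] : exists2 C, 0 < C & forall F (a : J -> K), in_class clx al F ->
    \sum_(j : F) modulus (a (val j)) `^ r <= C * qnorm (lcomb x a F) `^ r.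
  have [r1|r2] := r_cases; first exact: lower_estimate_le1.
  have [C C0 hC] := lower_two_estimate.
  exists C => // F a Fal; rewrite r2 powR_mulrn ?qnorm_ge0//; apply: le_trans (hC F a Fal).
  by apply: ler_sum => j _; rewrite powR_mulrn ?modulus_ge0.
exists (Num.max Cu (Cl `^ r^-1)); first by rewrite lt_max Cu0.
move=> F a Fal; split.
  move=> M M0 aM; apply: le_trans (hu F a M Fal M0 aM) _.
  by rewrite ler_wpM2r// le_max lexx.
rewrite /ell_le; apply: le_trans (hl F a Fal) _.
rewrite -{1}(powR_mulKV r0 (ltW Cl0)) -powRM ?powR_ge0 ?qnorm_ge0//.
apply: le_powR; rewrite ?(ltW r0) ?mulr_ge0 ?powR_ge0 ?qnorm_ge0//.
by rewrite ler_wpM2r ?qnorm_ge0// le_max lexx orbT.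
Qed.

End finite_exponent.
End estimates.

(** * Classes of exponent infinity *)

Lemma jump_dichotomy (R : realDomainType) (u v w p q z t : R) :
  p <= z -> t * 2 <= w + p -> w <= u + v -> z <= t -> q * 2 <= t -> u < q -> q <= v.
Proof. lra. Qed.

Lemma good_half (R : realFieldType) (u v s : R) :
  u <= s + v -> s <= 12 / 25 * u -> 0 <= u -> u <= 2 * v.
Proof. lra. Qed.

Lemma good_quarter (R : realFieldType) (n g b : R) : n <= 2 * g -> g <= 2 * b -> 4^-1 * n <= b.
Proof. lra. Qed.

Section infinite_exponent.
Context {R : realType} {k : scalar_kind} {X : quasiBanachType R k} {A : finType}.
Local Notation K := (scalars R k).
Context (pe : A -> \bar R) (peA : forall al, admissible (pe al)).
Context {J : countType} (x : J -> X) (c : X -> J -> K) (D : R).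
Context (xc : basis_coords x c D) (xn : normalized x).
Context {I : countType} (e : I -> X) (d : X -> I -> K).
Context (ec : basis_coords e d D) (en : normalized e) (cl : I -> A).
Context (eE : ell_classes pe e cl D).
Context (clx : J -> A) (Gs : J -> {fset I}) (c0 : R) (c00 : 0 < c0).
Context (Gs_class : forall j, in_class cl (clx j) (Gs j)).
Context (diag_ge : forall j,
  c0 <= modulus (\sum_(i : Gs j) d (x j) (val i) * c (e (val i)) j)).
Context (al : A) (pal : pe al = +oo%E).
Implicit Types (f g : X) (F : {fset J}) (G : {fset I}).

Let D1 : 1 <= D := coords_bound_ge1 xc.
Let D0 : 0 < D. Proof. by apply: lt_le_trans D1. Qed.

Let eP : ell_class e +oo%E (fun i => cl i == al) D.
Proof. by have := @eE al; rewrite pal. Qed.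

(* Dual form of Khintchine's inequality: truncating the sign sums of the rows of
   rho produces bounded vectors of c_0 whose j-th coordinate in the basis x
   still jumps by about 2 t_j when the j-th sign is flipped. *)
Lemma truncated_sign_sums : exists2 C, 0 < C & forall F G (rho : I -> J -> R) (b : J -> K),
  in_class cl al G -> (forall i j, 0 <= rho i j) ->
  (forall i : G, \sum_(j : F) rho (val i) (val j) ^+ 2 <= 1) ->
  (forall j : F, modulus (b (val j)) <=
     (\sum_(i : G) modulus (c (e (val i)) (val j)) * rho (val i) (val j)) / 2) ->
  qnorm (lcomb x b F) <= C.
Proof.
have h4 : 0 < 4^-1 :> R by [].
have [C C0 hC] := lattice_convexity peA xc ec en eE h4.
have M0 : 0 < D * 5 by rewrite mulr_gt0.
(* With truncation at level 5, a sign sum of the i-th row is altered with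
   probability at most 1/25, which costs at most (12/25) t_j on average. *)
exists (C * (D * 5)); first exact: mulr_gt0.
move=> F G rho b Gal rho0 rho1 bt.
(* These phases turn every contribution to the [j]-th coordinate into a nonnegative real, so nothing
   cancels in the sum over [i]. *)
have /choice[ph0 hph0] : forall ij : I * J, exists w, modulus w <= 1 /\
    c (e ij.1) ij.2 * w = of_real (modulus (c (e ij.1) ij.2)).
  by move=> [i j]; have [w w1 hw] := modulus_phase (c (e i) j); exists w.
pose g i j : K := of_real (rho i j) * ph0 (i, j).
have g_le i j : modulus (g i j) <= rho i j.
  by rewrite modulusM modulus_of_real ger0_norm// ler_piMr//; exact: (hph0 (i, j)).1.
have gc i j : g i j * c (e i) j = of_real (modulus (c (e i) j) * rho i j).
  by rewrite of_realM -(hph0 (i, j)).2 /g mulrC mulrCA mulrC -mulrA [ph0 _ * _]mulrC.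
pose S i (s : {ffun F -> bool}) : K := sign_sum (fun j : F => g i (val j)) s.
have five0 : 0 < 5 :> R by [].
pose f s := lcomb e (fun i => truncate 5 (S i s)) G.
have fn s : qnorm (f s) <= D * 5.
  have [h _] := eP (fun i => truncate 5 (S i s)) Gal; apply: h => //.
  by move=> i; exact: truncate_le.
have N0 : 0 < (nsigns F)%:R :> R by rewrite ltr0n nsigns_gt0.
apply: (hC F b _ f) => //; first exact: nsigns_gt0.
  rewrite mulr_natl -sumr_const; apply: ler_sum => s _.
  by rewrite ler_pXn2r ?nnegrE ?qnorm_ge0// ltW.
move=> j; pose t := \sum_(i : G) modulus (c (e (val i)) (val j)) * rho (val i) (val j).
have t0 : 0 <= t by apply: sumr_ge0 => i _; rewrite mulr_ge0 ?modulus_ge0.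
have {bt} : modulus (b (val j)) <= t / 2 := bt j; move: (b (val j)) => bj bt.
pose bad i s := 5 < modulus (S i s).
(* Bound for the loss in the rows where truncation acts: the truncated jump is at most [4 rho], by
   the Lipschitz constant 2, and the jump without truncation at most [2 rho]. *)
pose Rs s := \sum_(i : G) 6 * (modulus (c (e (val i)) (val j)) * rho (val i) (val j)) *
  (bad (val i) s || bad (val i) (flip j s))%:R.
have jump s : modulus (c (f s) (val j) - c (f (flip j s)) (val j) -
    signed (s j) (of_real t) *+ 2) <= Rs s.
  have -> : signed (s j) (of_real t : K) *+ 2 =
      \sum_(i : G) signed (s j) (g (val i) (val j)) *+ 2 * c (e (val i)) (val j).
    rewrite raddf_sum -sum_signed -sumrMnl; apply: eq_bigr => i _.
    by rewrite mulrnAl signed_mull gc.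
  have cf s' : c (f s') (val j) =
      \sum_(i : G) truncate 5 (S (val i) s') * c (e (val i)) (val j).
    by rewrite (coords_sum xc); apply: eq_bigr => i _; rewrite (coordsZ xc).
  rewrite !cf -!sumrB; apply: le_trans (modulus_sum _ _ _) _; apply: ler_sum => i _.
  rewrite -!mulrBl modulusM mulrCA mulrC -!mulrA ler_wpM2l ?modulus_ge0//.
  have SE : S (val i) (flip j s) = S (val i) s - signed (s j) (g (val i) (val j)) *+ 2.
    exact: sign_sum_flip.
  have [_|] := boolP (bad (val i) s || _); last first.
    rewrite negb_or /bad -!leNgt => /andP[h1 h2].
    by rewrite !truncate_id// SE subKr subrr modulus0 !mulr0.
  rewrite mulr1; have h1 := truncate_lipschitz five0 (S (val i) s) (S (val i) (flip j s)).
  rewrite [X in _ <= 2 * modulus (_ - X)]SE subKr in h1.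
  apply: le_trans (modulusD _ _) _; rewrite modulusN.
  move: h1; rewrite modulusMn modulus_signed => h1.
  by have := g_le (val i) (val j); lra.
have badN i : i \in G -> 25 * #|[pred s | bad i s]|%:R <= (nsigns F)%:R :> R.
  move=> iG; have h1 := sum_modulus_sign_sum_sqr (fun j : F => g i (val j)).
  have h2 : \sum_(j : F) modulus (g i (val j)) ^+ 2 <= 1.
    apply: le_trans (rho1 [` iG]%fset); apply: ler_sum => j' _.
    by rewrite ler_pXn2r ?nnegrE ?modulus_ge0.
  apply: (@le_trans _ _ (\sum_s modulus (S i s) ^+ 2)); last by rewrite h1 ler_piMr// ltW.
  rewrite -sum1_card natr_sum mulr_sumr big_mkcond/=; apply: ler_sum => s _.
  rewrite inE; case: ifPn => [bs|_]; last exact: sqr_ge0.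
  rewrite mulr1 (_ : 25 = 5 ^+ 2); last by ring.
  by rewrite ler_pXn2r ?nnegrE ?modulus_ge0// ltW.
have sumR : \sum_s Rs s <= (12 / 25) * (nsigns F)%:R * t.
  rewrite exchange_big/= mulr_sumr; apply: ler_sum => i _; rewrite -mulr_sumr.
  set m := modulus _ * _; have m0 : 0 <= m by rewrite mulr_ge0 ?modulus_ge0.
  have : \sum_s (bad (val i) s || bad (val i) (flip j s))%:R <= 2 * #|[pred s | bad (val i) s]|%:R :> R.
    apply: (@le_trans _ _ (\sum_s ((bad (val i) s)%:R + (bad (val i) (flip j s))%:R))).
      by apply: ler_sum => s _; case: (bad _ s); case: (bad _ (flip j s)); rewrite /= ?addr0 ?add0r// lerDl.
    have cardE : \sum_s (bad (val i) s)%:R = #|[pred s | bad (val i) s]|%:R :> R.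
      rewrite -sum1_card natr_sum [RHS]big_mkcond/=; apply: eq_bigr => s _.
      by rewrite inE; case: (bad _ s).
    by rewrite big_split/= (sum_flip j (fun s => (bad (val i) s)%:R)) cardE mulr_natl mulr2n.
  have := badN (val i) (valP i); set q := #|_|%:R; set n := (nsigns F)%:R; set z := \sum_s _ => h1 h2.
  have h3 : z <= 2 / 25 * n by move: h1 h2; clearbody z q n; lra.
  rewrite (_ : 12 / 25 * n * m = 6 * m * (2 / 25 * n)); last by field.
  by rewrite ler_wpM2l// mulr_ge0.
pose Gd : pred {ffun F -> bool} := fun s => Rs s <= t.
pose B : pred {ffun F -> bool} := fun s => modulus bj <= modulus (c (f s) (val j)).
(* If the loss is at most [t], the coordinates at [s] and at its flip differ by at least [2 t - t],
   so one of them is at least [t / 2]. *)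
have GB : (#|Gd| <= 2 * #|B|)%N.
  apply: (@card_flip_le _ j) => s Gs'.
  have h1 := jump s; have h2 := modulusD (c (f s) (val j) - c (f (flip j s)) (val j))
    (signed (s j) (of_real t) *+ 2 - (c (f s) (val j) - c (f (flip j s)) (val j))).
  rewrite subrKC modulusMn modulus_signed modulus_of_real ger0_norm// in h2.
  rewrite modulusB in h1; have h3 := modulusD (c (f s) (val j)) (- c (f (flip j s)) (val j)).
  rewrite modulusN in h3; rewrite /Gd in Gs'; rewrite /B.
  have [//|h5/=] := leP (modulus bj) (modulus (c (f s) (val j))).
  by apply: (jump_dichotomy h1 h2 h3 Gs' _ h5); rewrite -ler_pdivlMr.
(* Markov's inequality: outside [Gd] the loss exceeds [t], while its mean is at most
   [(12 / 25) t]. *)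
have NG : (nsigns F)%:R <= 2 * #|Gd|%:R :> R.
  have [tE|tn0] := eqVneq t 0.
    rewrite (_ : #|Gd| = nsigns F); first by rewrite ler_peMl ?ler1n// ltW.
    apply: eq_card => s; rewrite /in_mem/= /Gd; suff -> : Rs s = 0 by rewrite tE lexx.
    rewrite /Rs big1// => i _; move/eqP : tE.
    rewrite psumr_eq0 => [/allP/(_ i)|i' _]; last by rewrite mulr_ge0 ?modulus_ge0.
    by rewrite mem_index_enum => /(_ isT)/eqP ->; rewrite mulr0 mul0r.
  have {}t0 : 0 < t by rewrite lt_neqAle eq_sym tn0.
  have h1 : (nsigns F)%:R * t <= \sum_s Rs s + #|Gd|%:R * t.
    rewrite mulr_natl -sumr_const -sum1_card natr_sum mulr_suml [X in _ + X]big_mkcond/=.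
    rewrite -big_split/=; apply: ler_sum => s _; rewrite /in_mem/= /Gd.
    case: (leP (Rs s) t) => [_|/ltW tR]; last by rewrite addr0.
    rewrite mul1r lerDr; apply: sumr_ge0 => i _.
    by rewrite !mulr_ge0 ?modulus_ge0.
  rewrite -(ler_pM2r t0) -[leRHS]mulrA; apply: good_half h1 _ _; last by rewrite mulr_ge0// ltW.
  by rewrite mulrA.
have := GB; rewrite -(ler_nat R) natrM => h1.
rewrite (_ : #|[pred s | _]| = #|B|); last exact: eq_card.
exact: good_quarter NG h1.
Qed.

Let diag_sum F (j : F) : c0 <= \sum_(i : supports Gs F)
  modulus (d (x (val j)) (val i)) * modulus (c (e (val i)) (val j)).
Proof. exact: (@diag_sum_ge _ _ _ _ x c _ e d Gs c0 diag_ge (val j) _ (Gs_supports Gs j)). Qed.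

Let of_real_scale (t : R) (z : K) : 0 <= t -> modulus (of_real t * z) = t * modulus z.
Proof. by move=> t0; rewrite modulusM modulus_of_real ger0_norm. Qed.

Let lcomb_eq0 F (a : J -> K) : (forall j : F, modulus (a (val j)) <= 0) -> qnorm (lcomb x a F) = 0.
Proof.
move=> a0; rewrite /lcomb /partial_sum big1 ?qnorm0// => j _.
rewrite (_ : a (val j) = 0) ?scale0r//; apply: modulus_eq0; apply/eqP.
by rewrite eq_le a0 modulus_ge0.
Qed.

(** All rows of [rho] are the normalized moduli of [a]. As the entries [d (x j) i] are at most [D],
    the diagonal sum leaves [c0 / D] for the sum over [i] of the moduli of [c (e i) j]. *)
Lemma upper_two_estimate_infty : exists2 C, 0 < C & forall F (a : J -> K), in_class clx al F ->
  qnorm (lcomb x a F) ^+ 2 <= C * \sum_(j : F) modulus (a (val j)) ^+ 2.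
Proof.
have [C C0 hC] := truncated_sign_sums.
exists ((2 * D * C / c0) ^+ 2); first by rewrite exprn_gt0// divr_gt0// !mulr_gt0.
move=> F a Fal; set sg := \sum_(j : F) _.
have sg0 : 0 <= sg by apply: sumr_ge0 => *; exact: sqr_ge0.
have [sgE|sgn0] := eqVneq sg 0.
  rewrite lcomb_eq0 => [|j]; first by rewrite sgE expr0n mulr0.
  move/eqP : sgE.
  rewrite psumr_eq0 => [/allP/(_ j)|j' _]; last exact: sqr_ge0.
  by rewrite mem_index_enum sqrf_eq0 => /(_ isT)/eqP ->.
have {sgn0} {}sg0 : 0 < sg by rewrite lt_neqAle eq_sym sgn0.
pose s0 := Num.sqrt sg; have s00 : 0 < s0 by rewrite sqrtr_gt0.
have s0E : s0 ^+ 2 = sg by rewrite sqr_sqrtr// ltW.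
pose u := c0 / (2 * D * s0); have u0 : 0 < u by rewrite divr_gt0// !mulr_gt0.
have : qnorm (lcomb x (fun j => of_real u * a j) F) <= C.
  apply: (hC F (supports Gs F) (fun _ j => modulus (a j) / s0)).
  - exact: supports_class.
  - by move=> _ j; rewrite divr_ge0 ?modulus_ge0// ltW.
  - move=> _; under eq_bigr do rewrite expr_div_n.
    by rewrite -mulr_suml s0E divff// gt_eqF.
  - move=> j; rewrite of_real_scale ?(ltW u0)//.
    rewrite -mulr_suml.
    have h : c0 / D <= \sum_(i : supports Gs F) modulus (c (e (val i)) (val j)).
      rewrite ler_pdivrMr// mulr_suml; apply: le_trans (diag_sum j) _.
      by apply: ler_sum => i _; rewrite [leRHS]mulrC ler_wpM2r ?modulus_ge0// (entry_le xn ec en).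
    have aj0 : 0 <= modulus (a (val j)) / s0 / 2 by rewrite !divr_ge0 ?modulus_ge0// ltW.
    rewrite -[leRHS]mulrA; apply: le_trans (ler_wpM2r aj0 h).
    by rewrite /u le_eqVlt; apply/orP; left; apply/eqP; field; rewrite !gt_eqF.
rewrite lcombZ qnormZ modulus_of_real ger0_norm ?(ltW u0)// mulrC -ler_pdivlMr// => h.
have h2 : 0 <= C / u by rewrite divr_ge0// ltW.
have := h; rewrite -(ler_pXn2r (n := 2)) ?nnegrE ?qnorm_ge0// => /le_trans; apply.
by rewrite -s0E /u le_eqVlt; apply/orP; left; apply/eqP; field; rewrite !gt_eqF.
Qed.

(** The upper [l_2] estimate is tested on the column itself: with the right phases, the [i]-th
    coordinate of the combination is the whole sum [sg], so that [sg ^+ 2 <= D ^+ 2 * C * sg]. *)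
Lemma column_bound : exists2 B, 0 < B & forall F i, in_class clx al F ->
  \sum_(j : F) modulus (d (x (val j)) i) ^+ 2 <= B.
Proof.
have [C C0 hC] := upper_two_estimate_infty.
exists (D ^+ 2 * C); first by rewrite mulr_gt0// exprn_gt0.
move=> F i Fal; set sg := \sum_(j : F) _.
have sg0 : 0 <= sg by apply: sumr_ge0 => *; exact: sqr_ge0.
have /choice[w hw] : forall j : J, exists w, modulus w <= 1 /\
    d (x j) i * w = of_real (modulus (d (x j) i)).
  by move=> j; have [w w1 hw] := modulus_phase (d (x j) i); exists w.
pose a j := of_real (modulus (d (x j) i)) * w j.
have a_le j : modulus (a j) <= modulus (d (x j) i).
  by rewrite of_real_scale ?modulus_ge0// ler_piMr ?modulus_ge0//; exact: (hw j).1.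
have dE : d (lcomb x a F) i = of_real sg.
  rewrite (coords_sum ec) raddf_sum; apply: eq_bigr => j _.
  by rewrite (coordsZ ec) /a -mulrA [w _ * _]mulrC (hw _).2 -of_realM expr2.
have h1 : sg <= D * qnorm (lcomb x a F).
  by have := coords_le ec en (lcomb x a F) i; rewrite dE modulus_of_real ger0_norm.
have h2 : qnorm (lcomb x a F) ^+ 2 <= C * sg.
  apply: le_trans (hC F a Fal) _; rewrite ler_pM2l//; apply: ler_sum => j _.
  by rewrite ler_pXn2r ?nnegrE ?modulus_ge0.
have [->|sgn0] := eqVneq sg 0; first by rewrite mulr_ge0 ?sqr_ge0// ltW.
have {sgn0} {}sg0 : 0 < sg by rewrite lt_neqAle eq_sym sgn0.
rewrite -(ler_pM2r sg0) -mulrA -expr2.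
have D20 : 0 < D ^+ 2 by rewrite exprn_gt0.
apply: le_trans (ler_wpM2l (ltW D20) h2); rewrite -exprMn.
by rewrite ler_pXn2r ?nnegrE ?mulr_ge0 ?qnorm_ge0 ?(ltW D0) ?(ltW sg0).
Qed.

(** By [column_bound] the rows with entries the moduli of [d (x j) i], divided by [s1], are allowed
    in [truncated_sign_sums]. With them the weighted sum is at least [c0 / s1] for every [j],
    independently of [a]. The lower estimate is the boundedness of the coordinates. *)
Lemma infty_ell_class : exists2 C, 0 < C & ell_class x +oo%E (fun j => clx j == al) C.
Proof.
have [B B0 hB] := column_bound.
have [C C0 hC] := truncated_sign_sums.
pose s1 := Num.sqrt B; have s10 : 0 < s1 by rewrite sqrtr_gt0.
have s1E : s1 ^+ 2 = B by rewrite sqr_sqrtr// ltW.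
pose u := c0 / (2 * s1); have u0 : 0 < u by rewrite divr_gt0// mulr_gt0.
exists (Num.max D (C / u)); first by rewrite lt_max D0.
move=> F a Fal; split; last first.
  move=> j /=; rewrite -(coords_lcomb xc a j); apply: le_trans (coords_le xc xn _ _) _.
  by rewrite ler_wpM2r ?qnorm_ge0// le_max lexx.
move=> M; rewrite le_eqVlt => /predU1P[<-|M0] aM; first by rewrite lcomb_eq0 ?mulr0.
apply: (@le_trans _ _ (C / u * M)); last by rewrite ler_pM2r// le_max lexx orbT.
have uM : 0 < u / M by rewrite divr_gt0.
have : qnorm (lcomb x (fun j => of_real (u / M) * a j) F) <= C.
  apply: (hC F (supports Gs F) (fun i j => modulus (d (x j) i) / s1)).
  - exact: supports_class.
  - by move=> i j; rewrite divr_ge0 ?modulus_ge0// ltW.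
  - move=> i; under eq_bigr do rewrite expr_div_n.
    by rewrite -mulr_suml s1E ler_pdivrMr// mul1r hB.
  - move=> j; rewrite of_real_scale ?(ltW uM)//.
    apply: (@le_trans _ _ u).
      by rewrite mulrAC ler_pdivrMr// ler_pM2l//; exact: aM.
    under eq_bigr do rewrite mulrA; rewrite -mulr_suml /u invfM mulrA mulrAC.
    rewrite ler_pM2r// ler_pM2r ?invr_gt0//.
    under eq_bigr do rewrite mulrC.
    exact: (diag_sum j).
rewrite lcombZ qnormZ modulus_of_real ger0_norm ?(ltW uM)// mulrC -ler_pdivlMr// => /le_trans; apply.
by rewrite invf_div mulrA mulrAC.
Qed.

End infinite_exponent.

Section constants.
Context {R : realType} {k : scalar_kind} {X : quasiBanachType R k}.
Local Notation K := (scalars R k).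

Lemma basis_coords_mono (J : countType) (x : J -> X) c (D D' : R) :
  basis_coords x c D -> D <= D' -> basis_coords x c D'.
Proof.
move=> [h1 h2 h3 h4 h5] DD'; split => //; first exact: le_trans DD'.
by move=> F f; rewrite (le_trans (h4 F f))// ler_wpM2r ?qnorm_ge0.
Qed.

Lemma ell_class_mono (J : countType) (x : J -> X) p P (C C' : R) :
  admissible p -> 0 <= C -> C <= C' -> ell_class x p P C -> ell_class x p P C'.
Proof.
move=> pad C0 CC' xP F a FP; have [h1 h2] := xP F a FP; split.
  by move=> M M0 aM; rewrite (le_trans (h1 M M0 aM))// ler_wpM2r.
have CC'' : C * qnorm (lcomb x a F) <= C' * qnorm (lcomb x a F) by rewrite ler_wpM2r ?qnorm_ge0.
case: p pad h2 {xP h1} => [r||] pad h2.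
- have /andP[r0 _] := admissible_finite pad; apply: le_trans h2 _.
  by apply: le_powR; rewrite ?(ltW r0)// mulr_ge0// qnorm_ge0.
- by move=> i; rewrite (le_trans (h2 i)).
- by move=> i; rewrite (le_trans (h2 i)).
Qed.

End constants.

(** The diagonal data [Gs] and [c0] are kept in the conclusion because the count of the classes uses
    them with the two bases exchanged. *)
Theorem ell_classes_comparison (R : realType) (k : scalar_kind) (X : quasiBanachType R k)
    (A : finType) (pe : A -> \bar R) (J : countType) (x : J -> X) c (I : countType) (e : I -> X) d
    (D : R) (cl : I -> A) :
  (forall al, admissible (pe al)) -> basis_coords x c D -> normalized x ->
  basis_coords e d D -> normalized e -> ell_classes pe e cl D ->
  exists (clx : J -> A) (C c0 : R) (Gs : J -> {fset I}),
    [/\ 1 <= C, ell_classes pe x clx C, 0 < c0, forall j, in_class cl (clx j) (Gs j)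
      & forall j, c0 <= modulus (\sum_(i : Gs j) d (x j) (val i) * c (e (val i)) j)].
Proof.
move=> peA xc xn ec en eE.
have [clx [Gs [c0 [c00 Gsc diag]]]] := diagonal_class xc xn ec cl.
have /choice[Ca hCa] : forall al, exists C, 0 < C /\ ell_class x (pe al) (fun j => clx j == al) C.
  move=> al; have := peA al; case pal: (pe al) => [r||] ad.
  - have [C C0 hC] := finite_ell_class peA xc xn ec en eE c00 Gsc diag pal.
    by exists C.
  - have [C C0 hC] := infty_ell_class peA xc xn ec en eE c00 Gsc diag pal.
    by exists C.
  - by inversion ad.
exists clx, (\big[Num.max/1]_al Ca al), c0, Gs; split => //; first exact: bigmax_ge_id.
move=> al.
apply: (ell_class_mono (peA al) _ _ (hCa al).2); first by rewrite ltW// (hCa al).1.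
exact: (le_bigmax _ Ca).
Qed.

(** * Infinitude of the classes *)

Section infinite_classes.
Context {R : realType} {k : scalar_kind} {X : quasiBanachType R k}.
Local Notation K := (scalars R k).

(** Order of the fundamental function: a sum of [n] vectors of a class of exponent [p] has norm
    comparable to [n] to the power [growth p]. *)
Definition growth (p : \bar R) : R := if p is r%:E then r^-1 else 0.

Lemma growth_inj (p q : \bar R) : admissible p -> admissible q -> growth p = growth q -> p = q.
Proof.
have fin0 (r : R) : admissible r%:E -> r^-1 <> 0.
  by move=> /admissible_finite/andP[r0 _] /eqP; rewrite invr_eq0 gt_eqF.
case: p q => [r||] [s||] pa qa //=; try by [inversion pa|inversion qa].
- by move=> /invr_inj ->.
- by move=> /(fin0 _ pa).
- by move=> /esym/(fin0 _ qa).
Qed.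

Lemma qnorm_sum_ones (I : countType) (e : I -> X) p P (C : R) (G : {fset I}) :
  admissible p -> 0 <= C -> ell_class e p P C -> (forall i : G, P (val i)) -> (0 < #|` G|)%N ->
  #|` G|%:R `^ growth p <= C * qnorm (lcomb e (fun=> 1) G) /\
  qnorm (lcomb e (fun=> 1) G) <= C * #|` G|%:R `^ growth p.
Proof.
move=> pa C0 eP GP; rewrite cardfE => G0; have [h1 h2] := eP G (fun=> 1) GP.
have CG0 : 0 <= C * qnorm (lcomb e (fun=> 1) G) by rewrite mulr_ge0 ?qnorm_ge0.
case: p pa {eP} h1 h2 => [r||] pa h1 h2; last by inversion pa.
- have /andP[r0 _] := admissible_finite pa.
  have ones : \sum_(i : G) modulus (1 : K) `^ r = #|{: G}|%:R.
    by rewrite modulus1 powR1 sumr_const.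
  split.
    rewrite -(powR_mulVK r0 CG0); apply: le_powR; rewrite ?invr_ge0 ?(ltW r0)//.
    by rewrite -ones.
  by apply: h1; rewrite ?powR_ge0//= ones powR_mulKV.
- rewrite /= powRr0; split; last by apply: h1 => // i; rewrite /= modulus1.
  have [i _] : exists i : G, true by move/card_gt0P : G0 => [i _]; exists i.
  by have := h2 i; rewrite /= modulus1.
Qed.

(** Sums of [n] common vectors would have to grow at two different rates. *)
Lemma common_class_finite (I : countType) (e : I -> X) p q (P Q : pred I) (C : R) :
  admissible p -> admissible q -> p <> q -> 0 <= C ->
  ell_class e p P C -> ell_class e q Q C -> finite_set [set i | P i /\ Q i].
Proof.
wlog pq : p q P Q / growth q < growth p => [hw|] pa qa npq C0 eP eQ.
  have [|] := ltP (growth q) (growth p) => [h|]; first exact: (hw p q).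
  rewrite le_eqVlt => /predU1P[/growth_inj pqE|h]; first by case: npq; exact: pqE.
  rewrite (_ : [set i | P i /\ Q i] = [set i | Q i /\ P i]); last first.
    by apply/seteqP; split => i /= [].
  by apply: (hw q p) => // /esym.
apply: contrapT => inf.
have t0 : 0 < growth p - growth q by rewrite subr_gt0.
(* More than [b] common vectors would contradict [n^(growth p - growth q) <= C * C]. *)
pose b := (C * C) `^ (growth p - growth q)^-1.
have b0 : 0 <= b by exact: powR_ge0.
have [G GPQ Gb] := infinite_set_fset (Num.bound b) inf.
have bG : b < #|` G|%:R by apply: lt_le_trans (archi_boundP b0) _; rewrite ler_nat.
have G0 : (0 < #|` G|)%N by rewrite -(ltr_nat R) (le_lt_trans b0).
have GP (i : G) : P (val i) by have [] := GPQ _ (valP i).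
have GQ (i : G) : Q (val i) by have [] := GPQ _ (valP i).
have [h1 _] := qnorm_sum_ones pa C0 eP GP G0.
have [_ h2] := qnorm_sum_ones qa C0 eQ GQ G0.
have G0' : 0 < #|` G|%:R :> R by rewrite ltr0n.
have := le_trans h1 (ler_wpM2l C0 h2); rewrite mulrA -ler_pdivrMr ?powR_gt0//.
rewrite -powRN -powRD; last by rewrite gt_eqF ?implybT.
move=> /(le_powR (_ : 0 <= (growth p - growth q)^-1)).
rewrite invr_ge0 (ltW t0) powR_ge0 => /(_ isT isT).
rewrite -powRrM mulfV ?gt_eqF// powRr1 ?(ltW G0')//.
by rewrite leNgt bG.
Qed.

Lemma large_coords_finite (I : countType) (e : I -> X) d (D : R) (f : X) (eta : R) :
  basis_coords e d D -> normalized e -> 0 < eta -> finite_set [set i | eta <= modulus (d f i)].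
Proof.
move=> ec en eta0.
have D0 : 0 < D by rewrite (lt_le_trans ltr01)// (coords_bound_ge1 ec).
have [F hF] := coords_cvg ec f (divr_gt0 eta0 D0).
apply: (sub_finite_set _ (finite_fset F)) => i /= hi.
apply: contraLR hi => iF; rewrite -ltNge.
have := coords_le ec en (f - lcomb e (d f) F) i.
rewrite (coordsB ec) (_ : d (lcomb e (d f) F) i = 0) ?subr0; last first.
  rewrite (coords_sum ec) big1// => i' _; rewrite (coordsZ ec) (coords_dual ec).
  by rewrite (_ : (_ == i) = false) ?mulr0//; apply: contraNF iF => /eqP <-; exact: valP.
move=> /le_lt_trans; apply; rewrite qnormC mulrC -ltr_pdivlMr//; exact: hF.
Qed.

Lemma infinite_class (A : finType) (pe : A -> \bar R) (J : countType) (x : J -> X) c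
    (I : countType) (e : I -> X) d (D : R) (cl : I -> A) (clx : J -> A) :
  injective pe -> (forall al, admissible (pe al)) ->
  basis_coords x c D -> normalized x -> ell_classes pe x clx D ->
  basis_coords e d D -> normalized e -> ell_classes pe e cl D ->
  forall al, infinite_set [set i | cl i = al] -> infinite_set [set j | clx j = al].
Proof.
move=> pei peA xc xn xE ec en eE al inf fin; apply: inf.
have D0 : 0 < D by rewrite (lt_le_trans ltr01)// (coords_bound_ge1 xc).
(* The comparison with the bases exchanged: [cle] assigns classes to the vectors of [e], and [Hs i]
   consists of vectors of [x] through which [e i] is seen. *)
have [cle [C [c0 [Hs [C1 eE' c00 Hsc diag]]]]] := ell_classes_comparison peA ec en xc xn xE.
have fin_other be : be <> al -> finite_set [set i | cl i == al /\ cle i == be].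
  move=> beal; pose C' := Num.max D C.
  have D0C : 0 <= C' by rewrite le_max (ltW D0).
  apply: (@common_class_finite _ e (pe al) (pe be) _ _ C') => //.
  - by move=> /pei/esym.
  - by apply: (ell_class_mono (peA al) (ltW D0) _ (@eE al)); rewrite le_max lexx.
  - apply: (ell_class_mono (peA be) _ _ (@eE' be)); last by rewrite le_max lexx orbT.
    exact: le_trans ler01 C1.
have [F hF] := finite_fsetP.1 fin.
(* Small enough for the terms indexed by [F], each at most [D * eta], to stay below [c0] in total; 1
   is added in case [F] is empty. *)
pose eta := c0 / (D * (#|` F|%:R + 1)).
have eta0 : 0 < eta by rewrite divr_gt0// mulr_gt0// ltr_wpDl.
have fin_same : finite_set [set i | exists2 j, j \in F & eta <= modulus (d (x j) i)].
  rewrite (_ : [set _ | _] = \bigcup_(j in [set` F]) [set i | eta <= modulus (d (x j) i)]).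
    by apply: bigcup_finite => [|j _]; [exact: finite_fset|exact: large_coords_finite ec en eta0].
  by apply/seteqP; split => [i [j jF hj]|i [j /= jF hj]]; exists j.
have fin_others : finite_set (\bigcup_(be in [set be | be <> al]) [set i | cl i == al /\ cle i == be]).
  by apply: bigcup_finite => //; exact: finite_finset.
have := conj fin_others fin_same; rewrite -finite_setU; apply: sub_finite_set => i /= /eqP ial.
have [ceal|ceal] := eqVneq (cle i) al; last by left; exists (cle i) => //; exact/eqP.
right; apply: contrapT => small.
have h j : j \in F -> modulus (d (x j) i) < eta.
  by move=> jF; rewrite ltNge; apply/negP => hj; apply: small; exists j.
(* [Hs i] lies in the class [al] of [x], which is the finite set [F]. *)
have HF : (Hs i `<=` F)%fset.
  apply/fsubsetP => j jH; have : [set j | clx j = al] j.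
    by rewrite /= -ceal; apply/eqP; exact: (Hsc i (FSetSub jH)).
  by rewrite hF.
have := diag i; rewrite leNgt => /negP; apply.
apply: le_lt_trans (modulus_sum _ _ _) _.
apply: (@le_lt_trans _ _ (\sum_(j : F) D * eta)).
  apply: le_trans (_ : \sum_(j : Hs i) D * eta <= _).
    apply: ler_sum => j _; rewrite modulusM; apply: ler_pM; rewrite ?modulus_ge0//.
      by have := coords_le xc xn (e i) (val j); rewrite en mulr1.
    by rewrite ltW// h//; exact: (fsubsetP HF _ (valP j)).
  by apply: (sum_fset_le (phi := fun=> D * eta) HF) => _; rewrite mulr_ge0 ?(ltW D0) ?(ltW eta0).
rewrite sumr_const -cardfE -[X in X < _]mulr_natl.
have -> : D * eta = c0 / (#|` F|%:R + 1).
  by rewrite /eta; field; rewrite !gt_eqF// ltr_wpDl.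
by rewrite mulrCA gtr_pMr// ltr_pdivrMr ?mul1r ?ltrDl// ltr_wpDl.
Qed.

End infinite_classes.

(** * Equivalence of bases *)

Section equivalence.
Context {R : realType} {k : scalar_kind} {X : quasiBanachType R k}.
Local Notation K := (scalars R k).

Lemma coords_inj (J : countType) (x : J -> X) c D f g :
  basis_coords x c D -> (forall j, c f j = c g j) -> f = g.
Proof.
move=> xc fg; apply/eqP; rewrite -subr_eq0; apply/eqP/qnorm_eq0/eqP.
rewrite eq_le qnorm_ge0 andbT; apply/ler_addgt0Pr => e e0; rewrite add0r.
have [F hF] := coords_cvg xc (f - g) e0.
have := hF F (fsubset_refl _); rewrite /lcomb /partial_sum big1 => [|j _].
  by rewrite sub0r qnormN => /ltW.
by rewrite (coordsB xc) fg subrr scale0r.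
Qed.

Lemma cvg_coords (J : countType) (y : J -> X) c D (a : J -> K) f :
  basis_coords y c D -> normalized y ->
  (forall e : R, 0 < e -> exists F0 : {fset J}, forall F, (F0 `<=` F)%fset -> qnorm (lcomb y a F - f) < e) ->
  c f = a.
Proof.
move=> yc yn ha; apply/funext => j; apply/eqP; rewrite -subr_eq0; apply/eqP/modulus_eq0/eqP.
have D0 : 0 < D by rewrite (lt_le_trans ltr01)// (coords_bound_ge1 yc).
rewrite eq_le modulus_ge0 andbT; apply/ler_addgt0Pr => e e0; rewrite add0r.
have [F0 hF0] := ha _ (divr_gt0 e0 D0).
pose F := (j |` F0)%fset; have jF : j \in F by rewrite !inE eqxx.
have := hF0 F (fsubsetUr _ _); rewrite ltr_pdivlMr// mulrC => /ltW; apply: le_trans.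
rewrite -modulusN opprB -(coords_lcomb yc a [` jF]%fset) -(coordsB yc).
exact: (coords_le yc yn).
Qed.

(** By domination, the expansion of [f] in [x] becomes a Cauchy net when its coefficients are
    attached to [y]; [T f] is the limit. *)
Lemma domination_operator (J : countType) (x y : J -> X) cx cy (D C : R) :
  basis_coords x cx D -> basis_coords y cy D -> normalized y -> 0 <= C ->
  (forall F (a : J -> K), qnorm (lcomb y a F) <= C * qnorm (lcomb x a F)) ->
  exists (T : X -> X) (C' : R), (forall f j, cy (T f) j = cx f j) /\
    forall f, qnorm (T f) <= C' * qnorm f.
Proof.
move=> xc yc yn C0 dom; have D1 := coords_bound_ge1 xc.
have [kappa kq] := @quasi_triangleP R k X; have k1 := kq.1; have k0 : 0 < kappa by lra.
have ex f : exists g, forall e : R, 0 < e -> exists F0 : {fset J}, forall F, (F0 `<=` F)%fset ->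
    qnorm (lcomb y (cx f) F - g) < e.
  have cauchy (e : R) : 0 < e -> exists F0 : {fset J}, forall F G, (F0 `<=` F)%fset -> (F0 `<=` G)%fset ->
      qnorm (lcomb y (cx f) F - lcomb y (cx f) G) < e.
    move=> e0; pose e' := e / (2 * kappa * (C + 1)).
    have C10 : 0 < C + 1 by rewrite ltr_wpDl.
    have e'0 : 0 < e' by rewrite divr_gt0// !mulr_gt0.
    have [F0 hF0] := coords_cvg xc f e'0; exists F0 => F G FF FG.
    (* The difference of two partial sums is a single combination over the union of [F] and [G], to
       which domination applies. *)
    pose b j := (if j \in F then cx f j else 0) - (if j \in G then cx f j else 0).
    have bE z : lcomb z b (F `|` G)%fset = lcomb z (cx f) F - lcomb z (cx f) G.
      have restr (H : {fset J}) : (H `<=` F `|` G)%fset ->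
          lcomb z (fun j => if j \in H then cx f j else 0) (F `|` G)%fset = lcomb z (cx f) H.
        move=> HFG; rewrite /lcomb /partial_sum.
        rewrite -(big_seq_fsetE _ _ predT (fun j => (if j \in H then cx f j else 0) *: z j))/=.
        rewrite -(big_seq_fsetE _ _ predT (fun j => cx f j *: z j))/=.
        have {2}-> : H = [fset j in (F `|` G)%fset | j \in H]%fset.
          by apply/fsetP => j; rewrite !inE/=; case jH: (j \in H); rewrite ?andbF ?andbT// -in_fsetU (fsubsetP HFG).
        rewrite -big_fset_condE/= [RHS]big_mkcond/=; apply: eq_bigr => j _.
        by case: ifP; rewrite ?scale0r.
      by rewrite lcombB !restr ?fsubsetUl ?fsubsetUr.
    rewrite -bE; apply: le_lt_trans (dom _ _) _; rewrite bE.
    apply: (@le_lt_trans _ _ (C * (kappa * (e' + e')))).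
      rewrite ler_wpM2l//; apply: le_trans (qnorm_dist_le _ f _ kq) _.
      rewrite ler_wpM2l ?(ltW k0)// lerD//; first exact/ltW/hF0.
      by rewrite qnormC; exact/ltW/hF0.
    have -> : C * (kappa * (e' + e')) = e * (C / (C + 1)).
      by rewrite /e'; field; rewrite !gt_eqF.
    by rewrite gtr_pMr// ltr_pdivrMr// mul1r ltrDl.
  have /choice[Fn hFn] : forall n : nat, exists F0 : {fset J}, forall F G, (F0 `<=` F)%fset ->
      (F0 `<=` G)%fset -> qnorm (lcomb y (cx f) F - lcomb y (cx f) G) < n.+1%:R^-1.
    by move=> n; apply: cauchy; rewrite invr_gt0.
  (* Completeness concerns sequences: the sets belonging to the accuracies [1 / (n + 1)] are
     accumulated, so that their sums form a Cauchy sequence. *)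
  pose Gn n := (\big[fsetU/fset0]_(i < n.+1) Fn i).
  have FG i n : (i <= n)%N -> (Fn i `<=` Gn n)%fset.
    move=> ni; have ni' : (i < n.+1)%N by rewrite ltnS.
    by apply: (bigfcup_sup (fun i : 'I_n.+1 => Fn i) (j := Ordinal ni')); rewrite ?mem_index_enum.
  have inv_small (e : R) : 0 < e -> exists N : nat, N.+1%:R^-1 < e.
    move=> e0; exists (Num.bound e^-1); rewrite invf_plt ?posrE//.
    apply: lt_trans (archi_boundP _) _; first by rewrite invr_ge0 ltW.
    by rewrite ltr_nat.
  have [e e0|g hg] := @qnorm_complete R k X (fun n => lcomb y (cx f) (Gn n)).
    have [N hN] := inv_small e e0; exists N => m n Nm Nn.
    by apply: lt_trans (hFn N _ _ (FG _ _ Nm) (FG _ _ Nn)) hN.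
  exists g => e e0; have ek : 0 < e / (2 * kappa) by rewrite divr_gt0// mulr_gt0.
  have [N hN] := inv_small _ ek; exists (Fn N) => F NF.
  have /cvgrPdist_lt/(_ _ ek)[M _ hM] := hg.
  have := hM (maxn M N) (leq_maxl _ _); rewrite /= sub0r normrN ger0_norm ?qnorm_ge0// => h1.
  have h2 := lt_trans (hFn N _ _ NF (FG _ _ (leq_maxr M N))) hN.
  apply: le_lt_trans (qnorm_dist_le _ (lcomb y (cx f) (Gn (maxn M N))) _ kq) _.
  rewrite mulrC -ltr_pdivlMr//.
  have -> : e / kappa = e / (2 * kappa) + e / (2 * kappa) by field; rewrite gt_eqF.
  exact: ltrD.
have /choice[T hT] := ex; exists T, (kappa * (C * D)); split.
  by move=> f j; rewrite (cvg_coords yc yn (hT f)).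
move=> f; apply/ler_addgt0Pr => e e0.
have [F0 hF0] := hT f _ (divr_gt0 e0 k0).
have h1 := hF0 F0 (fsubset_refl _); rewrite qnormC in h1.
rewrite -[X in qnorm X](subrK (lcomb y (cx f) F0)); apply: le_trans (kq.2 _ _) _.
rewrite mulrDr addrC lerD//; last by rewrite mulrC -ler_pdivlMr// ltW.
rewrite -!mulrA ler_pM2l//; apply: le_trans (dom _ _) _.
by rewrite ler_wpM2l// (coords_bounded xc).
Qed.

(** Within one class both norms are comparable to the same [l_p] norm; the projections onto the
    classes are bounded, and recombining the classes costs a power of [kappa]. *)
Lemma ell_classes_domination (A : finType) (pe : A -> \bar R) (J : countType) (x y : J -> X)
    cx (D Cx Cy : R) (cl : J -> A) :
  (forall al, admissible (pe al)) -> basis_coords x cx D -> 0 <= Cx -> 0 <= Cy ->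
  ell_classes pe x cl Cx -> ell_classes pe y cl Cy ->
  exists2 C, 0 <= C & forall F (a : J -> K), qnorm (lcomb y a F) <= C * qnorm (lcomb x a F).
Proof.
move=> peA xc Cx0 Cy0 xE yE; have D1 := coords_bound_ge1 xc.
have D0 : 0 < D by lra.
have [kappa kq] := @quasi_triangleP R k X; have k1 := kq.1; have k0 : 0 < kappa by lra.
exists (kappa ^+ size (index_enum A) * (\sum_(al : A) Cy * (Cx * D))).
  by rewrite mulr_ge0 ?exprn_ge0 ?(ltW k0)// sumr_ge0// => *; rewrite !mulr_ge0// ltW.
move=> F a; rewrite {1}/lcomb {1}/partial_sum (sum_fset_class cl (fun j => a j *: y j)).
apply: le_trans (qnorm_sum_le _ _ _ kq) _.
rewrite -mulrA ler_wpM2l ?exprn_ge0 ?(ltW k0)// mulr_suml; apply: ler_sum => al _.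
set Fa := [fset j in F | cl j == al]%fset.
have Fal : in_class cl al Fa by move=> j; have := valP j; rewrite !inE => /andP[].
have [h1 _] := @yE al Fa a Fal; have [_ h2] := @xE al Fa a Fal.
have M0 : 0 <= Cx * qnorm (lcomb x a Fa) by rewrite mulr_ge0 ?qnorm_ge0.
apply: le_trans (h1 _ M0 h2) _; rewrite -!mulrA !ler_wpM2l//.
have -> : lcomb x a Fa = lcomb x (cx (lcomb x a F)) Fa.
  apply: eq_bigr => j _; have jF : val j \in F by have := valP j; rewrite !inE => /andP[].
  by rewrite -(coords_lcomb xc a [` jF]%fset).
exact: (coords_bounded xc).
Qed.

Section reindexing.
Context (J I : countType) (pi : J -> I) (pi' : I -> J) (piK : cancel pi pi') (pi'K : cancel pi' pi).

Lemma lcomb_reindex (e : I -> X) (a : J -> K) (F : {fset J}) :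
  lcomb (e \o pi) a F = lcomb e (a \o pi') [fset pi j | j in F]%fset.
Proof.
rewrite /lcomb /partial_sum -(big_seq_fsetE _ _ predT (fun j => a j *: (e \o pi) j))/=.
rewrite -(big_seq_fsetE _ _ predT (fun i => (a \o pi') i *: e i))/=.
rewrite big_imfset/=; last by move=> ? ? _ _; exact: (can_inj piK).
by apply: eq_bigr => j _; rewrite /= piK.
Qed.

Lemma basis_coords_reindex (e : I -> X) d D :
  basis_coords e d D -> basis_coords (e \o pi) (fun f j => d f (pi j)) D.
Proof.
move=> ec; split.
- by move=> *; rewrite (coords_linear ec).
- by move=> i j; rewrite (coords_dual ec) (inj_eq (can_inj piK)).
- exact: coords_bound_ge1 ec.
- move=> F f; rewrite lcomb_reindex (_ : _ \o _ = d f); first exact: (coords_bounded ec).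
  by apply/funext => i; rewrite /= pi'K.
move=> f eps eps0; have [F0 hF0] := coords_cvg ec f eps0.
exists [fset pi' i | i in F0]%fset => F hF.
rewrite lcomb_reindex (_ : _ \o _ = d f); last by apply/funext => i; rewrite /= pi'K.
apply: hF0; apply/fsubsetP => i iF0; apply/imfsetP; exists (pi' i); rewrite ?pi'K//=.
by apply: (fsubsetP hF); apply/imfsetP; exists i.
Qed.

Lemma ell_classes_reindex (A : finType) (pe : A -> \bar R) (e : I -> X) (cl : I -> A) (C : R) :
  ell_classes pe e cl C -> ell_classes pe (e \o pi) (cl \o pi) C.
Proof.
move=> eE al F a Fal.
pose G := [fset pi j | j in F]%fset.
have Gal : in_class cl al G.
  move=> [i /= iG]; have /imfsetP[j /= jF ->] := iG; exact: (Fal [` jF]%fset).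
have [h1 h2] := @eE al G (a \o pi') Gal.
have le_iff M : ell_le (pe al) F a M <-> ell_le (pe al) G (a \o pi') M.
  rewrite /ell_le; case: (pe al) => [r||].
  - rewrite -(big_seq_fsetE _ _ predT (fun j => modulus (a j) `^ r))/=.
    rewrite -(big_seq_fsetE _ _ predT (fun i => modulus ((a \o pi') i) `^ r))/=.
    rewrite big_imfset/=; last by move=> ? ? _ _; exact: (can_inj piK).
    by under [X in _ <-> X <= _]eq_bigr do rewrite piK.
  - split=> h.
      by move=> [i /= iG]; have /imfsetP[j /= jF ->] := iG; rewrite piK; exact: (h [` jF]%fset).
    move=> j; have jG : pi (val j) \in G by apply/imfsetP; exists (val j) => //; exact: valP.
    by have := h [` jG]%fset; rewrite /= piK.
  - split=> h.
      by move=> [i /= iG]; have /imfsetP[j /= jF ->] := iG; rewrite piK; exact: (h [` jF]%fset).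
    move=> j; have jG : pi (val j) \in G by apply/imfsetP; exists (val j) => //; exact: valP.
    by have := h [` jG]%fset; rewrite /= piK.
rewrite lcomb_reindex; split; last exact/le_iff.
by move=> M M0 /le_iff; exact: h1.
Qed.

End reindexing.

Lemma closed_span_basis (J : countType) (x : J -> X) c D : basis_coords x c D ->
  closed_span x = setT.
Proof.
move=> xc; apply/seteqP; split => // f _ e e0.
have [F hF] := coords_cvg xc f e0; exists (lcomb x (c f) F); first by exists F, (c f).
by rewrite qnormC; exact: hF.
Qed.

Lemma ell_classes_equivalence (A : finType) (pe : A -> \bar R) (J I : countType)
    (x : J -> X) cx (e : I -> X) d (D : R) (cl : I -> A) (pi : J -> I) :
  (forall al, admissible (pe al)) -> bijective pi ->
  basis_coords x cx D -> normalized x -> ell_classes pe x (cl \o pi) D ->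
  basis_coords e d D -> normalized e -> ell_classes pe e cl D ->
  permutatively_equivalent x e.
Proof.
move=> peA [pi' piK pi'K] xc xn xE ec en eE.
have yc := basis_coords_reindex piK pi'K ec; have yE := ell_classes_reindex piK eE.
have yn : normalized (e \o pi) by move=> j; exact: en.
have D0 : 0 <= D by rewrite (le_trans ler01)// (coords_bound_ge1 xc).
have [C1 C10 dom1] := ell_classes_domination peA xc D0 D0 xE yE.
have [C2 C20 dom2] := ell_classes_domination peA yc D0 D0 yE xE.
have [T [CT [Tc Tn]]] := domination_operator xc yc yn C10 dom1.
have [U [CU [Uc Un]]] := domination_operator yc xc xn C20 dom2.
have TK : cancel T U by move=> f; apply: (coords_inj xc) => j; rewrite Uc Tc.
have UK : cancel U T by move=> f; apply: (coords_inj yc) => j; rewrite Tc Uc.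
exists pi, T; split; first by exists pi'.
  rewrite (closed_span_basis xc) (closed_span_basis ec); split.
  - move=> a f g _ _; apply: (coords_inj yc) => j.
    by rewrite Tc (coords_linear yc) !Tc (coords_linear xc).
  - split=> //; first by move=> f g _ _; exact: (can_inj TK).
    by move=> f _; exists (U f).
  - by exists CT => f _.
  - by exists CU => f _; rewrite -{1}(TK f).
by move=> j; apply: (coords_inj yc) => i; rewrite Tc (coords_dual xc) (coords_dual yc j).
Qed.

End equivalence.

(** * The canonical basis *)

Section canonical.
Context (R : realType) (k : scalar_kind) (A : {fset {posnum \bar R}}).
Local Notation K := (scalars R k).
Local Notation X := (ell_sum k A).
Local Notation cb := (@canonical_basis R k A).
Implicit Types (f g : X) (p : A).

Definition entry f (pn : A * nat) : K := ell_seq (f pn.1) pn.2.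

Lemma entryZ a f pn : entry (a *: f) pn = a * entry f pn.
Proof. by []. Qed.

Lemma entryB f g pn : entry (f - g) pn = entry f pn - entry g pn.
Proof. by []. Qed.

Lemma entry_canonical i pn : entry (cb i) pn = (pn == i)%:R.
Proof.
case: i pn => p n [q m]; rewrite /entry/canonical_basis/= xpair_eqE.
by case: eqVneq => [->|].
Qed.

Lemma entry_lcomb a F pn : entry (lcomb cb a F) pn = if pn \in F then a pn else 0.
Proof.
rewrite /lcomb /partial_sum (big_morph (fun f => entry f pn) (id1 := 0) (op1 := +%R))//.
under eq_bigr do rewrite entryZ entry_canonical.
case: ifPn => pnF.
  rewrite (bigD1 [` pnF]%fset)//= eqxx mulr1 big1 ?addr0// => i ij.
  rewrite (_ : (pn == _) = false) ?mulr0//; apply: contraNF ij => /eqP e.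
  by apply/eqP/val_inj; rewrite /= e.
rewrite big1// => i _; rewrite (_ : (pn == _) = false) ?mulr0//.
by apply: contraNF pnF => /eqP ->; exact: valP.
Qed.

Lemma qnorm_ell_sum_le f (M : R) : 0 <= M -> (forall p n, ell_bound (val p)%:num M (f p) n) ->
  qnorm f <= M.
Proof.
move=> M0 h; apply: direct_sum_qnorm_le => // p.
by apply: ell_norm_le => //; exact: ellP.
Qed.

Lemma qnorm_ell_sum_ge f p n : ell_bound (val p)%:num (qnorm f) (f p) n.
Proof.
have h1 := ell_bound_norm (ellP (f p)) n.
have h2 : ell_norm (val p)%:num (f p) <= qnorm f := qnorm_le_direct_sum f p.
have h0 := ell_norm_ge0 (val p) (f p).
move: h1 h2 h0; move: (ell_norm _ _) => u.
have [q -> [->|[r r0 ->]]] := exponentP (val p) => /= h1 h2 h0; first exact: le_trans h2.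
by apply: le_trans h1 _; apply: le_powR => //; exact: ltW.
Qed.

Lemma modulus_entry_le f pn : modulus (entry f pn) <= qnorm f.
Proof.
apply: le_trans (ell_modulus_le _ _) _; exact: (qnorm_le_direct_sum f pn.1).
Qed.

Lemma normalized_canonical : normalized cb.
Proof.
move=> i; apply/eqP; rewrite eq_le; apply/andP; split; last first.
  by have := modulus_entry_le (cb i) i; rewrite entry_canonical eqxx modulus1.
apply: qnorm_ell_sum_le => // p n.
have entE m : ell_seq (cb i p) m = ((p, m) == i)%:R by exact: (entry_canonical i (p, m)).
have [q -> [->|[r r0 ->]]] := exponentP (val p) => /=.
  by rewrite entE; case: (_ == _); rewrite ?modulus1 ?modulus0.
rewrite powR1 /series/=; under eq_bigr do rewrite entE.
have [ni|ni] := ltnP i.2 n.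
  rewrite (bigD1_seq i.2)/= ?mem_index_iota ?iota_uniq//.
  rewrite big1 ?addr0 => [|m mi].
    by case: (_ == _); rewrite ?modulus1 ?powR1// modulus0 powR0 ?gt_eqF.
  by rewrite (_ : (_ == i) = false) ?modulus0 ?powR0 ?gt_eqF//; apply: contraNF mi => /eqP <-.
rewrite big_nat big1// => m /andP[_ mn].
rewrite (_ : (_ == i) = false) ?modulus0 ?powR0 ?gt_eqF//.
by apply: contraTF mn => /eqP mi; rewrite -leqNgt -mi in ni *.
Qed.

Lemma entry_tail f (e : R) : 0 < e -> exists N : nat, forall F : {fset A * nat},
  (forall pn, (pn.2 < N)%N -> pn \in F) -> qnorm (lcomb cb (entry f) F - f) <= e.
Proof.
move=> e0.
have /choice[N hN] : forall p : A, exists N : nat, forall F : {fset A * nat},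
    (forall n, (n < N)%N -> (p, n) \in F) -> forall n, ell_bound (val p)%:num e ((lcomb cb (entry f) F - f) p) n.
  move=> p.
  have hE F n : ell_seq ((lcomb cb (entry f) F - f) p) n = if (p, n) \in F then 0 else - ell_seq (f p) n.
    rewrite -[LHS]/(entry (lcomb cb (entry f) F - f) (p, n)) entryB entry_lcomb.
    by case: ifP; rewrite ?subrr// sub0r.
  have := ellP (f p); have [q -> [->|[r r0 ->]]] := exponentP (val p) => /=.
    move=> /cvgrPdist_lt/(_ _ e0)[N _ hN]; exists N => F hF n.
    rewrite -[X in modulus X]/(ell_seq ((lcomb cb (entry f) F - f) p) n) hE.
    case: ifPn => nF; first by rewrite modulus0 ltW.
    have Nn : (N <= n)%N by rewrite leqNgt; apply: contraNN nF => /hF.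
    by have := hN n Nn; rewrite /= sub0r normrN ger0_norm ?modulus_ge0// modulusN => /ltW.
  move=> fc; have er0 : 0 < e `^ r by exact: powR_gt0.
  have /cvgrPdist_lt/(_ _ er0)[N _ hN] := fc.
  exists N => F hF n; pose v i := modulus (if (p, i) \in F then 0 else - ell_seq (f p) i) `^ r.
  rewrite (_ : series _ n = \sum_(0 <= i < n) v i); last first.
    by apply: eq_bigr => i _; rewrite /v -hE.
  (* The sum is extended so that it can be split at [N] even when [n < N]. *)
  apply: (@le_trans _ _ (\sum_(0 <= i < maxn N n) v i)).
    rewrite (big_cat_nat (leq0n n) (leq_maxr N n))//= lerDl sumr_ge0// => *; exact: powR_ge0.
  rewrite (big_cat_nat (leq0n N) (leq_maxl N n))//= [X in X + _]big_nat big1 ?add0r; last first.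
    by move=> i /andP[_ iN]; rewrite /v hF// modulus0 powR0 ?gt_eqF.
  apply: (@le_trans _ _ (\sum_(N <= i < maxn N n) modulus (ell_seq (f p) i) `^ r)).
    apply: ler_sum => i _; rewrite /v; case: ifP => _; last by rewrite modulusN.
    by rewrite modulus0 powR0 ?gt_eqF// powR_ge0.
  have := hN N (leqnn N); rewrite /= => h1.
  have h2 := powR_series_le_lim fc (maxn N n).
  rewrite /series/= (big_cat_nat (leq0n N) (leq_maxl N n))//= in h2.
  have h3 := ler_norm (limn (series (fun n => modulus (ell_seq (f p) n) `^ r)) - \sum_(0 <= i < N) modulus (ell_seq (f p) i) `^ r).
  have h4 := le_lt_trans h3 h1.
  by rewrite -lerBrDl in h2; rewrite (le_trans h2)// ltW.
exists (\max_(p : A) N p) => F hF; apply: qnorm_ell_sum_le; first exact: ltW.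
move=> p n; apply: hN => m mN; apply: hF => /=; apply: leq_trans mN _.
exact: (leq_bigmax p).
Qed.

Lemma unconditional_basis_canonical : unconditional_basis cb.
Proof.
move=> f; exists (entry f); split.
  apply/unconditional_sumP => e e0.
  have e20 : 0 < e / 2 by rewrite divr_gt0.
  have [N hN] := entry_tail f e20.
  exists (seq_fset tt [seq (p, n) | p <- enum {: A}, n <- iota 0 N]) => F hF.
  apply: le_lt_trans (hN F _) _; last by rewrite ltr_pdivrMr// ltr_pMr// ltr1n.
  move=> [p n] /= nN; apply: (fsubsetP hF); rewrite seq_fsetE.
  by apply/allpairsP; exists (p, n); rewrite mem_enum mem_iota.
move=> a /unconditional_sumP ha; apply/funext => pn; apply/eqP; rewrite -subr_eq0.
apply/eqP/modulus_eq0/eqP; rewrite eq_le modulus_ge0 andbT.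
apply/ler_addgt0Pr => e e0; rewrite add0r.
have [F0 hF0] := ha e e0.
have h : qnorm (lcomb cb a (pn |` F0)%fset - f) < e := hF0 _ (fsubsetUr _ _).
apply: le_trans (ltW h); rewrite qnormC; apply: le_trans (modulus_entry_le _ pn).
by rewrite entryB entry_lcomb in_fsetU in_fset1 eqxx.
Qed.

End canonical.

(** * The classes of the canonical basis *)

Section canonical_classes.
Context (R : realType) (k : scalar_kind) (A : {fset {posnum \bar R}}).
Local Notation K := (scalars R k).
Local Notation X := (ell_sum k A).
Local Notation cb := (@canonical_basis R k A).

Definition exponent (p : A) : \bar R := (val p)%:num.

Lemma exponent_inj : injective exponent.
Proof. by move=> p q /val_inj pq; apply: val_inj. Qed.

Lemma sum_slice (G : {fset A * nat}) (p : A) (w : A * nat -> R) (n : nat) :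
  (forall i : G, (val i).1 = p) ->
  \sum_(0 <= i < n) (if (p, i) \in G then w (p, i) else 0) =
  \sum_(i : G | ((val i).2 < n)%N) w (val i).
Proof.
move=> Gp; rewrite -big_mkcond/= -(big_seq_fsetE _ _ (fun i => i.2 < n)%N w)/=.
transitivity (\sum_(i <- [seq (p, i) | i <- iota 0 n] | i \in G) w i).
  by rewrite big_map /index_iota subn0.
rewrite -[LHS]big_filter -[RHS]big_filter; apply: perm_big; apply: uniq_perm.
- by rewrite filter_uniq// map_inj_uniq ?iota_uniq// => i j [].
- by rewrite filter_uniq// fset_uniq.
move=> [q m]; rewrite !mem_filter/= andbC; apply: andb_id2r => qmG.
have /= -> := Gp [` qmG]%fset; apply/mapP/idP => [|mn].
  by case=> i; rewrite mem_iota add0n => /andP[_ iN] [->].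
by exists m; rewrite ?mem_iota.
Qed.

Lemma ell_classes_canonical : ell_classes exponent cb (fun pn : A * nat => pn.1) 1.
Proof.
move=> al G a Gal; set f := lcomb cb a G.
have fE p n : ell_seq (f p) n = if (p, n) \in G then a (p, n) else 0.
  exact: (entry_lcomb a G (p, n)).
have in_al p n : (p, n) \in G -> p = al by move=> pnG; exact/eqP/(Gal [` pnG]%fset).
have seriesE r n : r != 0 -> series (fun i => modulus (ell_seq (f al) i) `^ r) n =
    \sum_(i : G | ((val i).2 < n)%N) modulus (a (val i)) `^ r.
  move=> r0; rewrite -(sum_slice (p := al) (fun i => modulus (a i) `^ r)); last by move=> i; exact/eqP.
  by apply: eq_bigr => i _; rewrite fE; case: ifP => _ //; rewrite modulus0 powR0.
split=> [M M0 aM|].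
  rewrite mul1r; apply: qnorm_ell_sum_le => // p n.
  have [->|pal] := eqVneq p al; last first.
    have f0 m : ell_seq (f p) m = 0.
      by rewrite fE; case: ifPn => // /in_al/eqP; rewrite (negPf pal).
    have [q -> [->|[r r0 ->]]] := exponentP (val p) => /=; first by rewrite f0 modulus0.
    rewrite /series/= big1 ?powR_ge0// => i _; by rewrite f0 modulus0 powR0 ?gt_eqF.
  move: aM; rewrite /exponent; have [q -> [->|[r r0 ->]]] := exponentP (val al) => /= aM.
    rewrite fE; case: ifPn => [pnG|_]; last by rewrite modulus0.
    exact: (aM [` pnG]%fset).
  apply: le_trans aM; rewrite seriesE ?gt_eqF// big_mkcond/=; apply: ler_sum => i _.
  by case: ifP => // _; exact: powR_ge0.
have := fun n => qnorm_ell_sum_ge f al n; rewrite mul1r /exponent.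
have [q -> [->|[r r0 ->]]] := exponentP (val al) => /= h.
  move=> i; have := h (val i).2; rewrite -(eqP (Gal i)) fE -surjective_pairing.
  by rewrite (valP i).
(* Past the largest second index occurring in [G] the partial sum covers all of [G]; the successor
   accounts for the strict inequality. *)
have := h (\max_(i : G) (val i).2).+1; rewrite seriesE ?gt_eqF//; apply: le_trans.
rewrite [leRHS]big_mkcond/=; apply: ler_sum => i _.
by rewrite ltnS (leq_bigmax (F := fun i : G => (val i).2) i).
Qed.

End canonical_classes.

Theorem canonical_basis_unique (R : realType) (k : scalar_kind) (A : {fset {posnum \bar R}}) :
  (forall p : A, admissible (exponent p)) ->
  has_unique_unconditional_basis (@canonical_basis R k A).
Proof.
move=> peA; split=> [|J x xb xn]; first exact: unconditional_basis_canonical.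
have [c [D1 xc]] := unconditional_basis_coords xb.
have [d [D2 ec]] := unconditional_basis_coords (@unconditional_basis_canonical R k A).
have en := @normalized_canonical R k A.
have cE := @ell_classes_canonical R k A.
pose D := Num.max D1 D2.
have xcD : basis_coords x c D by apply: basis_coords_mono xc _; rewrite le_max lexx.
have ecD : basis_coords (@canonical_basis R k A) d D by apply: basis_coords_mono ec _; rewrite le_max lexx orbT.
have cED (D' : R) : 1 <= D' -> ell_classes (@exponent R A) (@canonical_basis R k A) fst D'.
  by move=> D'1 p; apply: (ell_class_mono (peA p) _ D'1 (@cE p)).
have [clx [C [c0 [Gs [C1 xE _ _ _]]]]] := ell_classes_comparison peA xcD xn ecD en (cED _ (coords_bound_ge1 ecD)).
(* A common constant for both bases, as needed to exchange their roles. *)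
pose E := Num.max D C.
have DE : D <= E by rewrite le_max lexx.
have xcE := basis_coords_mono xcD DE; have ecE := basis_coords_mono ecD DE.
have xEE : ell_classes (@exponent R A) x clx E.
  move=> p; apply: (ell_class_mono (peA p) _ _ (@xE p)); first exact: le_trans C1.
  by rewrite le_max lexx orbT.
have eEE := cED _ (coords_bound_ge1 ecE).
have inf (p : A) : infinite_set [set j | clx j = p].
  apply: (infinite_class (@exponent_inj R A) peA xcE xn xEE ecE en eEE) => fin.
  apply: infinite_nat; rewrite (_ : setT = snd @` [set i : A * nat | i.1 = p]); first exact: finite_image.
  by apply/seteqP; split => // n _; exists (p, n).
(* Each class of [x] is countably infinite, like each summand of the canonical basis. Numbering the
   classes gives a bijection [pi] whose first component is [clx], so that class is matched with
   class. *)
have /choice[num hnum] : forall p : A, exists num : J -> nat, set_bij [set j | clx j = p] setT num.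
  by move=> p; apply/card_set_bijP; apply: eq_card_nat.
pose pi j := (clx j, num (clx j) j).
have pi_bij : bijective pi.
  have /choice[g hg] : forall pn : A * nat, exists j, pi j = pn.
    move=> [p n]; have [_ _ /(_ n I)[j /= jp jn]] := hnum p.
    by exists j; rewrite /pi jp jn.
  exists g => // j; have [h1 h2] : clx (g (pi j)) = clx j /\ num (clx (g (pi j))) (g (pi j)) = num (clx j) j.
    by have [] := hg (pi j).
  have [_ inj _] := hnum (clx j); apply: inj; rewrite ?inE//.
  by rewrite -{1}h1.
exact: (ell_classes_equivalence peA pi_bij xcE xn xEE ecE en eEE).
Qed.

Local Open Scope ereal_scope.

Theorem theorem4p1 (R : realType) (k : scalar_kind)
    (A : {fset {posnum \bar R}})
    (hA : forall p, p \in A ->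
      0 < p%:num <= 1 \/ p%:num = 2%:E \/ p%:num = +oo) :
  has_unique_unconditional_basis (@canonical_basis R k A).
Proof.
apply: canonical_basis_unique => p.
have := hA _ (valP p); rewrite /exponent; have : 0 < (val p)%:num by exact: gt0e.
case: ((val p)%:num) => [r| |] //= r0 [/andP[_ r1]|[|]] //; last by move=> _; exact: AdmissibleInfty.
  by apply: AdmissibleLe1; rewrite -!lte_fin r0 -lee_fin.
by move=> [->]; exact: AdmissibleTwo.
Qed.
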